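(* Consider the second price auction with an admissible profit sharing contract (PSC) $\phi$ and weakly risk averse buyers, with $s(\cdot,\cdot;\phi)$, $R_{sp}(\phi)$, $R_{sp}(0)$ and $R^{plsc}_{sp}(\alpha)$ as defined in the context. Then: (i) $R_{sp}(\phi)\ge R_{sp}(0)>0$. (ii) If there exists some $\alpha\in(0,1)$ such that $\phi(w+\delta)-\phi(w)\le\alpha\delta$ for all $w\in\mathbb{R}$ and all $\delta\ge0$, then $R_{sp}(\phi)\le R^{plsc}_{sp}(\alpha)$.
   Context: ''Increasing'' means strictly increasing. There are $N\ge 2$ buyers. Real random variables $X_n$ (value of the resource to buyer $n$, possibly negative) and $Y_n$ (signal observed only by buyer $n$), $1\le n\le N$, have a commonly known joint law; $\mathbf{Y}=(Y_1,\dots,Y_N)$ and $\mathbf{Y}_{-n}$ is $\mathbf{Y}$ without the $n$-th entry. Symmetry: the joint CDF of $(X_n,Y_n,\mathbf{Y}_{-n})$ is the same for every $n$ and symmetric in the last $N-1$ components. Each $Y_n$ takes values in an interval $\mathcal{I}_Y\subset\mathbb{R}$; $\mathbf{Y}$ has a joint density that is positive on all of $\mathcal{I}_Y^N$ ($(X_n,\mathbf{Y})$ need not have a density). Positive dependence: for any increasing $h:\mathbb{R}\to\mathbb{R}$ and $a_n\le b_n$ in $\mathcal{I}_Y$, $\mathbb{E}[h(X_1)\mid Y_1\in[a_1,b_1],\dots,Y_N\in[a_N,b_N]]$ is increasing in $a_1$ and $b_1$ and nondecreasing in $a_n,b_n$ for $n\ge2$, whenever it exists ($a_n=b_n$ means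 conditioning on $Y_n=a_n$). Weakly risk averse buyers: all buyers have the same utility of money $u:\mathbb{R}\to\mathbb{R}$, concave (possibly linear), increasing, $u(0)=0$. All expectations and conditional expectations of interest exist and are finite, and $\mathbb{E}[u(X_1)\mid\mathbf{Y}=\mathbf{y}]>0$ for all $\mathbf{y}\in\mathcal{I}_Y^N$. The seller is risk neutral. $Z_1=\max\{Y_2,\dots,Y_N\}$. Admissible PSC: a function $\phi:\mathbb{R}\to\mathbb{R}$ such that $\phi(w)$ is nondecreasing in $w$ and $w-\phi(w)$ is increasing in $w$; $\phi(0)=0$ and $\lim_{w\to\infty}\phi(w)=\infty$; $\phi$ is continuous. In the second price auction with PSC $\phi$, the highest bidder wins and pays the second highest bid $b$, and when his value $x$ is revealed he additionally pays $\phi(x-b)$. $s(y_1,z_1;\phi)$ is the unique $b$ with $\mathbb{E}[u(X_1-b-\phi(X_1-b))\mid Y_1=y_1,Z_1=z_1]=0$; $s(y_1,z_1;0)$ is the unique $b$ with $\mathbb{E}[u(X_1-b)\mid Y_1=y_1,Z_1=z_1]=0$. At the symmetric equilibrium in which buyer $n$ bids $s(Y_n,Y_n;\phi)$, the expected total revenue is $R_{sp}(\phi)=\mathbb{E}[s(Z_1,Z_1;\phi)+\phi(X_1-s(Z_1,Z_1;\phi))\mid Y_1>Z_1]$. $R_{sp}(0)=\mathbb{E}[s(Z_1,Z_1;0)\mid Y_1>Z_1]$ is the revenue with only a one-time payment. $t(\alpha,y_1,z_1)$ is the unique $b$ with $\mathbb{E}[u((1-\alpha)(X_1-b))\mid Y_1=y_1,Z_1=z_1]=0$,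 and $R^{plsc}_{sp}(\alpha)=\mathbb{E}[\alpha X_1+(1-\alpha)t(\alpha,Z_1,Z_1)\mid Y_1>Z_1]$ is the total revenue for the profit and loss sharing contract $\phi(w)=\alpha w$. *)

(* Defs.v *)
From HB Require Import structures.
From mathcomp Require Import all_boot all_order all_fingroup all_algebra.
From mathcomp Require Import all_classical all_reals all_analysis.

Set Implicit Arguments.
Unset Strict Implicit.
Unset Printing Implicit Defensive.

Import Order.TTheory GRing.Theory Num.Theory.
Import numFieldNormedType.Exports.

Local Open Scope classical_set_scope.
Local Open Scope ring_scope.

(* There are m.+2 buyers, so that m : nat ranges over exactly the numbers of
   buyers N >= 2; buyer 1 is [ord0] and buyers 2, ..., N are the
   [lift ord0 j], j : 'I_m.+1. Densities and conditional laws are unique only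
   up to null sets, whereas the model evaluates conditional expectations at
   points (bids are evaluated on the diagonal y1 = z1); therefore a version f
   of the density of Y and a version k of the conditional law of X_1 given Y
   are fixed, and all conditional expectations are computed from f and k. *)

Definition increasing (R : realType) (h : R -> R) : Prop :=
  {homo h : x y / x < y}.

Inductive coord_event (R : realType) : Type :=
  | At of R
  | In of set R.

(* Conditioning on membership in a set reduced to the point p is conditioning
   on the value p; this is the convention "a_n = b_n means Y_n = a_n". *)
Definition coord_in (R : realType) (A : set R) (p : R) : coord_event R :=
  if `[< A `<=` [set p] >] then At p else In A.

Definition coord_int (R : realType) (e : coord_event R) (g : R -> \bar R) :
    \bar R :=
  match e with
  | At p => g p
  | In A => (\int[lebesgue_measure]_(t in A) g t)%E
  end.

(* A cell is a conjunction of events, one for each coordinate. The coordinates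
   conditioned to be [At] a point are substituted, the others are integrated
   out with respect to Lebesgue measure. *)
Fixpoint cell_int (R : realType) (n : nat) :
    ('I_n -> coord_event R) -> (n.-tuple R -> \bar R) -> \bar R :=
  match n return ('I_n -> coord_event R) -> (n.-tuple R -> \bar R) -> \bar R
  with
  | 0 => fun _ g => g [tuple]
  | n'.+1 => fun c g =>
      coord_int (c ord0) (fun t =>
        cell_int (fun i => c (lift ord0 i)) (fun v => g (cons_tuple t v)))
  end.

Definition is_density (R : realType) (n : nat) (d : measure_display)
    (T : measurableType d) (P : probability T R) (Y : T -> n.-tuple R)
    (f : n.-tuple R -> R) : Prop :=
  [/\ measurable_fun setT f, (forall y, 0 <= f y) &
      forall B : set (n.-tuple R), measurable B ->
        P (Y @^-1` B) = cell_int (fun=> In setT) (fun y => (f y * \1_B y)%:E)].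

(* [k y] is a version of the conditional law of X given Y = y. *)
Definition is_cond_law (R : realType) (n : nat) (d : measure_display)
    (T : measurableType d) (P : probability T R) (X : T -> R)
    (Y : T -> n.-tuple R) (k : R.-pker (n.-tuple R) ~> R) : Prop :=
  forall (A : set R) (B : set (n.-tuple R)), measurable A -> measurable B ->
    P (X @^-1` A `&` Y @^-1` B) = (\int[P]_(w in Y @^-1` B) k (Y w) A)%E.

(* In the following, Y has density f and X has conditional law k given Y; the
   conditioning event is the union of a list of cells which have the same
   number of [At] coordinates and overlap only on null sets, and
   E[h(X) | cs] is the ratio
   (\sum_(c <- cs) \int_c E[h(X) | Y = y] f(y) dy)
     / (\sum_(c <- cs) \int_c f(y) dy). *)
Definition cells_mass (R : realType) (n : nat) (f : n.-tuple R -> R)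
    (cs : seq ('I_n -> coord_event R)) : \bar R :=
  (\sum_(c <- cs) cell_int c (fun y => (f y)%:E))%E.

Definition cells_num (R : realType) (n : nat)
    (k : R.-pker (n.-tuple R) ~> R) (f : n.-tuple R -> R)
    (cs : seq ('I_n -> coord_event R)) (h : R -> R) : \bar R :=
  (\sum_(c <- cs)
     cell_int c (fun y => ((\int[k y]_x (h x)%:E) * (f y)%:E)%E))%E.

Definition cond_exists (R : realType) (n : nat)
    (k : R.-pker (n.-tuple R) ~> R) (f : n.-tuple R -> R)
    (cs : seq ('I_n -> coord_event R)) (h : R -> R) : Prop :=
  (0 < cells_mass f cs < +oo)%E /\
  (cells_num k f cs (fun x => `|h x|)%R < +oo)%E.

Definition cond_exp (R : realType) (n : nat)
    (k : R.-pker (n.-tuple R) ~> R) (f : n.-tuple R -> R)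
    (cs : seq ('I_n -> coord_event R)) (h : R -> R) : R :=
  fine (cells_num k f cs h) / fine (cells_mass f cs).

Definition box (R : realType) (n : nat) (a b : 'I_n -> R) :
    seq ('I_n -> coord_event R) :=
  [:: fun i => coord_in `[a i, b i] (a i)].

(* Y_1 = y1 and max(Y_2, ..., Y_N) = z1, where the Y_n take values in IY: one
   cell for each buyer other than buyer 1 whose signal can attain the maximum.
   If z1 is the least element of IY, every cell is Y = (y1, z1, ..., z1). *)
Definition given_Y1_Z1 (R : realType) (m : nat) (IY : set R) (y1 z1 : R) :
    seq ('I_m.+2 -> coord_event R) :=
  [seq (fun i : 'I_m.+2 =>
          if i == ord0 then At y1
          else if i == lift ord0 j then At z1
          else coord_in (IY `&` `]-oo, z1]) z1)
  | j <- enum 'I_m.+1].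

Definition signals (R : realType) (n : nat) (T : Type) (Y : 'I_n -> T -> R)
    (w : T) : n.-tuple R :=
  [tuple Y i w | i < n].

(* max(Y_2, ..., Y_N); R has no least element, so Y_2 serves as the default. *)
Definition Z1 (R : realType) (m : nat) (T : Type) (Y : 'I_m.+2 -> T -> R)
    (w : T) : R :=
  \big[Num.max/Y (lift ord0 ord0) w]_(j < m.+1) Y (lift ord0 j) w.

(* Joint CDF of (X_n, Y_n, Y_{-n}). *)
Definition joint_cdf (R : realType) (m : nat) (d : measure_display)
    (T : measurableType d) (P : probability T R) (X Y : 'I_m.+2 -> {RV P >-> R})
    (n : 'I_m.+2) (x y : R) (v : 'I_m.+1 -> R) : \bar R :=
  P [set w | [/\ X n w <= x, Y n w <= y & forall j, Y (lift n j) w <= v j]].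

Definition symmetric_law (R : realType) (m : nat) (d : measure_display)
    (T : measurableType d) (P : probability T R)
    (X Y : 'I_m.+2 -> {RV P >-> R}) : Prop :=
  (forall n n' x y v, joint_cdf X Y n x y v = joint_cdf X Y n' x y v) /\
  (forall n x y v (sigma : 'S_m.+1),
      joint_cdf X Y n x y (v \o sigma) = joint_cdf X Y n x y v).

(* Monotonicity in each of the a_n, b_n separately, strict for n = 1. *)
Definition positive_dependence (R : realType) (m : nat)
    (k : R.-pker (m.+2.-tuple R) ~> R) (f : m.+2.-tuple R -> R)
    (IY : set R) : Prop :=
  forall (h : R -> R) (a b : 'I_m.+2 -> R) (n : 'I_m.+2) (c : R),
    increasing h ->
    (forall i, [/\ IY (a i), IY (b i) & a i <= b i]) ->
    let increases cs cs' :=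
      cond_exists k f cs h -> cond_exists k f cs' h ->
      if n == ord0 then cond_exp k f cs h < cond_exp k f cs' h
      else cond_exp k f cs h <= cond_exp k f cs' h in
    (a n < c <= b n -> increases (box a b) (box [eta a with n |-> c] b)) /\
    (IY c -> b n < c -> increases (box a b) (box a [eta b with n |-> c])).

(* u is concave, i.e. - u is convex. *)
Definition weakly_risk_averse (R : realType) (u : R -> R) : Prop :=
  [/\ convex_function [set: R^o] (fun x : R^o => - u x : R^o),
      increasing u & u 0 = 0].

Definition admissible_psc (R : realType) (phi : R -> R) : Prop :=
  [/\ {homo phi : w w' / w <= w'},
      increasing (fun w => w - phi w),
      phi 0 = 0,
      phi w @[w --> +oo] --> +oo &
      continuous phi].

(* [xget 0 A] is an element of A if there is one and 0 otherwise; when the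
   conditional expectations exist, the sets below are singletons. *)
Definition bid (R : realType) (m : nat)
    (k : R.-pker (m.+2.-tuple R) ~> R) (f : m.+2.-tuple R -> R) (IY : set R)
    (u phi : R -> R) (y1 z1 : R) : R :=
  xget 0 [set b | cond_exp k f (given_Y1_Z1 m IY y1 z1)
                    (fun x => u (x - b - phi (x - b))) = 0].

Definition bid_plsc (R : realType) (m : nat)
    (k : R.-pker (m.+2.-tuple R) ~> R) (f : m.+2.-tuple R -> R) (IY : set R)
    (u : R -> R) (alpha y1 z1 : R) : R :=
  xget 0 [set b | cond_exp k f (given_Y1_Z1 m IY y1 z1)
                    (fun x => u ((1 - alpha) * (x - b))) = 0].

Definition buyer1_wins (R : realType) (m : nat) (T : Type)
    (Y : 'I_m.+2 -> T -> R) : set T :=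
  [set w | Z1 Y w < Y ord0 w].

Definition exp_given (R : realType) (d : measure_display)
    (T : measurableType d) (P : probability T R) (A : set T) (g : T -> R) : R :=
  (\int[P]_(w in A) g w) / fine (P A).

(* Total payment of buyer 1 when he wins: second highest bid plus profit share;
   phi = 0 gives the one-time payment. *)
Definition payment (R : realType) (m : nat)
    (k : R.-pker (m.+2.-tuple R) ~> R) (f : m.+2.-tuple R -> R) (IY : set R)
    (u phi : R -> R) (T : Type) (X Y : 'I_m.+2 -> T -> R) (w : T) : R :=
  let b := bid k f IY u phi (Z1 Y w) (Z1 Y w) in b + phi (X ord0 w - b).

Definition payment_plsc (R : realType) (m : nat)
    (k : R.-pker (m.+2.-tuple R) ~> R) (f : m.+2.-tuple R -> R) (IY : set R)
    (u : R -> R) (alpha : R) (T : Type) (X Y : 'I_m.+2 -> T -> R) (w : T) : R :=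
  alpha * X ord0 w
  + (1 - alpha) * bid_plsc k f IY u alpha (Z1 Y w) (Z1 Y w).

Definition revenue (R : realType) (m : nat) (d : measure_display)
    (T : measurableType d) (P : probability T R) (X Y : 'I_m.+2 -> {RV P >-> R})
    (k : R.-pker (m.+2.-tuple R) ~> R) (f : m.+2.-tuple R -> R) (IY : set R)
    (u phi : R -> R) : R :=
  exp_given P (buyer1_wins Y) (payment k f IY u phi X Y).

Definition revenue_plsc (R : realType) (m : nat) (d : measure_display)
    (T : measurableType d) (P : probability T R) (X Y : 'I_m.+2 -> {RV P >-> R})
    (k : R.-pker (m.+2.-tuple R) ~> R) (f : m.+2.-tuple R -> R) (IY : set R)
    (u : R -> R) (alpha : R) : R :=
  exp_given P (buyer1_wins Y) (payment_plsc k f IY u alpha X Y).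

(* Main.v *)
(** The conditional law of X_1 given (Y_1, Z_1) = (z, z) mixes cells on which
    one Y_j equals z and the other Y_n are at most z. Let phi1 and phi2 be two
    contracts such that phi2 - phi1, with arbitrary shifts of the arguments, is
    nondecreasing, and let s1 and s2 be the corresponding bids at z. The net
    payoffs p = w - s1 - phi1(w - s1) and q = w - s2 - phi2(w - s2) of a winner
    satisfy E[u(p)] = 0 = E[u(q)], and p - q is nondecreasing in w. A
    supergradient of u at the common value of p and q where they cross gives
    u(p) - u(q) <= c (p - q), so that E[p - q] >= 0, which is to say that the
    expected payment under phi2 is at least that under phi1, given
    (Y_1, Z_1) = (z, z), and hence on one of the cells. Since p - q is
    nondecreasing, positive dependence carries this from Y_1 = z over to the
    event Y_1 >= z on the same cell; symmetry makes all the cells equivalent for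
    almost every z, and integrating over z, up to ties, which are null, gives
    the comparison of revenues. It is used with (0, phi) and with
    (phi, alpha w). *)

From HB Require Import structures.
Require Import Defs.
From mathcomp Require Import all_boot all_order all_fingroup all_algebra.
From mathcomp Require Import all_classical all_reals all_analysis.
From mathcomp Require Import measurable_realfun lra ring.

Set Implicit Arguments.
Unset Strict Implicit.
Unset Printing Implicit Defensive.

Import Order.TTheory GRing.Theory Num.Theory.
Import numFieldNormedType.Exports.

Local Open Scope classical_set_scope.
Local Open Scope ring_scope.

(** * Integrals over cells *)

Section cells.
Context (R : realType).
Local Open Scope ereal_scope.
Local Notation leb := (@lebesgue_measure R).

(** A cell with an [At] coordinate lives on a Lebesgue-null set, so expectations given a cell cannot
    be read off from [P]; they are iterated integrals of the fixed versions [f] and [k]. To have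
    dominated convergence, linearity and strict inequalities for them, each cell or list of cells is
    turned into a measure on pairs (signals, value), by representing the cell integral as a monotone
    functional.

    The passage through a single cell is forced by positive dependence: it speaks of boxes, while
    the event Z_1 = z is a union of cells pinned at different coordinates. For the mixture only the
    sign of a sum is known, so a cell with the right sign exists for each z but may change with z.
    Symmetry, a statement about the law, equates the cells only after integration over z, hence for
    almost every z; this is why the revenue is disintegrated along the signal of the runner-up
    before the comparison is made. Positive and negative parts of the payment difference are carried
    separately, because disintegration and symmetry are proved for nonnegative functions. *)

Definition measurable_event (e : coord_event R) : Prop :=
  if e is In A then measurable A else True.

(** Events that move measurably with a parameter. Both forms occur: later z enters a cell as the
    point of an [At] and as the end point of the range left to the other buyers, which is a section
    of a measurable subset of the plane. *)
Definition measurable_events d (Z : measurableType d)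
    (e : Z -> coord_event R) : Prop :=
  (exists2 p : Z -> R, measurable_fun setT p & forall z, e z = At (p z)) \/
  (exists2 A : set (Z * R), measurable A & forall z, e z = In (xsection A z)).

Lemma measurable_events_cst d (Z : measurableType d) (e : coord_event R) :
  measurable_event e -> measurable_events (fun _ : Z => e).
Proof.
case: e => [p _|A mA]; first by left; exists (fun=> p).
right; exists (setT `*` A); first exact: measurableX.
by move=> z; congr In; apply/seteqP; split => t; rewrite /xsection/= inE => // -[].
Qed.

Lemma measurable_events_comp d (Z : measurableType d) d' (Z' : measurableType d')
    (e : Z -> coord_event R) (h : Z' -> Z) :
  measurable_fun setT h -> measurable_events e -> measurable_events (e \o h).
Proof.
move=> mh [[p mp ep]|[A mA eA]]; [left|right].
  by exists (p \o h) => [|z]; [exact: measurableT_comp|exact: ep].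
exists ((fun zt : Z' * R => (h zt.1, zt.2)) @^-1` A) => [|z].
  rewrite -[X in measurable X]setTI; apply: measurable_fun_pair => //.
  exact: measurableT_comp.
by rewrite /= eA; congr In; apply/seteqP; split => t; rewrite /xsection/= !inE.
Qed.

Lemma measurable_coord_int d (Z : measurableType d) (e : Z -> coord_event R)
    (g : Z * R -> \bar R) :
  measurable_events e -> measurable_fun setT g ->
  measurable_fun setT (fun z => coord_int (e z) (fun t => g (z, t))).
Proof.
move=> [[p mp ep]|[A mA eA]] mg.
  under eq_fun do rewrite ep/=.
  apply: (measurableT_comp mg (g := fun z => (z, p z))).
  exact: measurable_fun_pair.
under eq_fun do rewrite eA/= integral_mkcond.
have mgA : measurable_fun setT (g \_ A).
  by apply/(measurable_restrictT g mA); exact: measurable_funTS mg.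
(* A signed integral is the difference of the integrals of the two parts, and Tonelli makes each of
   these measurable in z. *)
rewrite (_ : (fun _ => _) = fubini_F leb (g \_ A)^\+ \- fubini_F leb (g \_ A)^\-).
  by apply: emeasurable_funB; apply: measurable_fun_fubini_tonelli_F => //;
    [exact: measurable_funepos|exact: measurable_funeneg].
apply/funext => z; rewrite /= integralE/=.
by congr (_ - _); apply: eq_integral => t _;
  rewrite ?(funeposE, funenegE) /patch mem_xsection.
Qed.

Lemma cell_int_ge0 n (c : 'I_n -> coord_event R) (g : n.-tuple R -> \bar R) :
  (forall y, 0 <= g y) -> 0 <= cell_int c g.
Proof.
elim: n => [|n IH] in c g *; move=> g0 //=.
case: (c ord0) => [p|A]/=; first exact: IH.
by apply: integral_ge0 => t _; exact: IH.
Qed.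

(** The parameter space is quantified inside the induction, because the outermost coordinate joins
    the parameter of the inner integrals. *)
Lemma measurable_cell_int n : forall d (Z : measurableType d)
    (c : Z -> 'I_n -> coord_event R) (g : Z * n.-tuple R -> \bar R),
  (forall i, measurable_events (c^~ i)) -> measurable_fun setT g ->
  measurable_fun setT (fun z => cell_int (c z) (fun y => g (z, y))).
Proof.
elim: n => [|n IH] d Z c g mc mg /=.
  apply: (measurableT_comp mg (g := fun z => (z, [tuple]))).
  exact: measurable_fun_pair.
pose h (ztv : (Z * R) * n.-tuple R) :=
  g (ztv.1.1, cons_tuple ztv.1.2 ztv.2).
have mh : measurable_fun setT h.
  apply: (measurableT_comp mg) => /=; apply: measurable_fun_pair.
    exact: measurableT_comp.
  by apply: measurable_cons => //; exact: measurableT_comp.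
have mJ := IH _ (Z * R)%type (fun zt i => c zt.1 (lift ord0 i)) h
  (fun i => measurable_events_comp measurable_fst (mc (lift ord0 i))) mh.
exact: (measurable_coord_int (mc ord0) mJ).
Qed.

Definition measurable_cell n (c : 'I_n -> coord_event R) : Prop :=
  forall i, measurable_event (c i).

Lemma measurable_cell_int_cst d (Z : measurableType d) n
    (c : 'I_n -> coord_event R) (g : Z * n.-tuple R -> \bar R) :
  measurable_cell c -> measurable_fun setT g ->
  measurable_fun setT (fun z => cell_int c (fun y => g (z, y))).
Proof.
move=> mc mg; apply: (measurable_cell_int (c := fun=> c) _ mg) => i.
exact: measurable_events_cst.
Qed.

Lemma measurable_cons_tuple n :
  measurable_fun setT (fun tv : R * n.-tuple R => cons_tuple tv.1 tv.2).
Proof. exact: measurable_cons. Qed.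

Lemma measurable_cons_tuple2 n (t : R) :
  measurable_fun setT (fun v : n.-tuple R => cons_tuple t v).
Proof. exact: measurable_cons. Qed.

Lemma measurable_cell_slice n (c : 'I_n -> coord_event R)
    (g : n.+1.-tuple R -> \bar R) :
  measurable_cell c -> measurable_fun setT g ->
  measurable_fun setT (fun t => cell_int c (fun v => g (cons_tuple t v))).
Proof.
move=> mc mg.
apply: (measurable_cell_int_cst (g := fun tv => g (cons_tuple tv.1 tv.2))) => //.
exact: (measurableT_comp mg (@measurable_cons_tuple n)).
Qed.

Lemma eq_cell_int n (c : 'I_n -> coord_event R) (g h : n.-tuple R -> \bar R) :
  g =1 h -> cell_int c g = cell_int c h.
Proof. by move=> /funext ->. Qed.

Lemma cell_intD n (c : 'I_n -> coord_event R) (g h : n.-tuple R -> \bar R) :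
  measurable_cell c -> measurable_fun setT g -> (forall y, 0 <= g y) ->
  measurable_fun setT h -> (forall y, 0 <= h y) ->
  cell_int c (fun y => g y + h y) = cell_int c g + cell_int c h.
Proof.
elim: n => [|n IH] in c g h *; move=> mc mg g0 mh h0 //=.
have mc' : measurable_cell (fun i => c (lift ord0 i)) by move=> i; exact: mc.
have -> : (fun t => cell_int (fun i => c (lift ord0 i))
      (fun v => g (cons_tuple t v) + h (cons_tuple t v))) =
    fun t => cell_int (fun i => c (lift ord0 i)) (fun v => g (cons_tuple t v)) +
      cell_int (fun i => c (lift ord0 i)) (fun v => h (cons_tuple t v)).
  apply/funext => t; apply: IH => //;
  by apply: measurableT_comp => //; exact: measurable_cons_tuple2.
have := mc ord0; case: (c ord0) => [//|A]/= mA.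
rewrite ge0_integralD//.
- by move=> t _; exact: cell_int_ge0.
- by apply: measurable_funTS; exact: measurable_cell_slice.
- by move=> t _; exact: cell_int_ge0.
- by apply: measurable_funTS; exact: measurable_cell_slice.
Qed.

Lemma cell_intZ n (c : 'I_n -> coord_event R) (g : n.-tuple R -> \bar R)
    (a : \bar R) :
  measurable_cell c -> measurable_fun setT g -> (forall y, 0 <= g y) ->
  0 <= a -> cell_int c (fun y => a * g y) = a * cell_int c g.
Proof.
elim: n => [|n IH] in c g *; move=> mc mg g0 a0 //=.
have mc' : measurable_cell (fun i => c (lift ord0 i)) by move=> i; exact: mc.
have -> : (fun t => cell_int (fun i => c (lift ord0 i))
      (fun v => a * g (cons_tuple t v))) =
    fun t => a *
      cell_int (fun i => c (lift ord0 i)) (fun v => g (cons_tuple t v)).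
  apply/funext => t; apply: IH => //;
  by apply: measurableT_comp => //; exact: measurable_cons_tuple2.
have := mc ord0; case: (c ord0) => [//|A]/= mA.
rewrite ge0_integralZl//.
- by apply: measurable_funTS; exact: measurable_cell_slice.
- by move=> t _; exact: cell_int_ge0.
Qed.

Lemma le_cell_int n (c : 'I_n -> coord_event R) (g h : n.-tuple R -> \bar R) :
  measurable_cell c -> measurable_fun setT g -> (forall y, 0 <= g y) ->
  measurable_fun setT h -> (forall y, g y <= h y) ->
  cell_int c g <= cell_int c h.
Proof.
elim: n => [|n IH] in c g h *; move=> mc mg g0 mh gh //=.
have mc' : measurable_cell (fun i => c (lift ord0 i)) by move=> i; exact: mc.
have IH' t : cell_int (fun i => c (lift ord0 i)) (fun v => g (cons_tuple t v)) <=
      cell_int (fun i => c (lift ord0 i)) (fun v => h (cons_tuple t v)).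
  by apply: IH => //;
  apply: measurableT_comp => //; exact: measurable_cons_tuple2.
have h0 y : 0 <= h y by exact: le_trans (gh y).
have := mc ord0; case: (c ord0) => [p|A]/= mA; first exact: IH'.
apply: ge0_le_integral => //.
- by move=> t _; exact: cell_int_ge0.
- by apply: measurable_funTS; exact: measurable_cell_slice.
- by apply: measurable_funTS; exact: measurable_cell_slice.
Qed.

Lemma cvg_cell_int n (c : 'I_n -> coord_event R)
    (g : (n.-tuple R -> \bar R)^nat) (h : n.-tuple R -> \bar R) :
  measurable_cell c -> (forall k, measurable_fun setT (g k)) ->
  (forall k y, 0 <= g k y) -> (forall y, nondecreasing_seq (g ^~ y)) ->
  (forall y, g k y @[k --> \oo] --> h y) ->
  cell_int c (g k) @[k --> \oo] --> cell_int c h.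
Proof.
elim: n => [|n IH] in c g h *; move=> mc mg g0 ndg gh /=; first exact: gh.
have mc' : measurable_cell (fun i => c (lift ord0 i)) by move=> i; exact: mc.
have mgt k t : measurable_fun setT (fun v : n.-tuple R => g k (cons_tuple t v)).
  by apply: measurableT_comp => //; exact: measurable_cons_tuple2.
have IH' t : cell_int (fun i => c (lift ord0 i))
      (fun v => g k (cons_tuple t v)) @[k --> \oo] -->
    cell_int (fun i => c (lift ord0 i)) (fun v => h (cons_tuple t v)).
  by apply: (IH _ (fun k v => g k (cons_tuple t v))).
have := mc ord0; case: (c ord0) => [p|A]/= mA; first exact: IH'.
rewrite [X in _ --> X](_ : _ = \int[leb]_(t in A) limn (fun k =>
    cell_int (fun i => c (lift ord0 i)) (fun v => g k (cons_tuple t v)))).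
  apply: cvg_monotone_convergence => //.
  - by move=> k; apply: measurable_funTS; exact: measurable_cell_slice.
  - by move=> k t _; exact: cell_int_ge0.
  - move=> t _ k l kl; apply: le_cell_int => //= v.
    exact: ndg.
apply: eq_integral => t _; apply/esym/cvg_lim => //; exact: IH'.
Qed.

(** If the integral vanished, [f] would be zero almost everywhere on [D], and [D] would be a null
    set. *)
Lemma integral_gt0 d (T : measurableType d) (mu : {measure set T -> \bar R})
    (D : set T) (f : T -> \bar R) :
  measurable D -> measurable_fun D f -> (forall x, D x -> 0 < f x) ->
  0 < mu D -> 0 < \int[mu]_(x in D) f x.
Proof.
move=> mD mf f0 muD0; rewrite lt0e integral_ge0 ?andbT => [|x /f0/ltW//].
apply/eqP => If0.
have /(ae_eq_integral_abs _ mD mf) : \int[mu]_(x in D) `|f x| = 0.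
  by rewrite -If0; apply: eq_integral => x /[!inE] /f0/ltW/gee0_abs.
move=> [N [mN N0 DN]]; move: muD0; rewrite ltNge => /negP; apply.
rewrite -N0 le_measure ?inE// => x Dx; apply: DN => /= /(_ Dx) fx0.
by have := f0 _ Dx; rewrite fx0 ltxx.
Qed.

Definition in_event (e : coord_event R) : set R :=
  match e with At p => [set p] | In A => A end.

Definition cell_set n (c : 'I_n -> coord_event R) : set (n.-tuple R) :=
  [set y | forall i, in_event (c i) (tnth y i)].

Lemma measurable_in_event e : measurable_event e -> measurable (in_event e).
Proof. by case: e => [p _|A]; [exact: measurable_set1|]. Qed.

Lemma measurable_cell_set n (c : 'I_n -> coord_event R) :
  measurable_cell c -> measurable (cell_set c).
Proof.
move=> mc.
have -> : cell_set c =
    \bigcap_(i in [set: 'I_n]) ((@tnth _ R)^~ i @^-1` in_event (c i)).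
  by apply/seteqP; split => y /= cy i; [move=> _; exact: cy|exact: (cy i Logic.I)].
apply: fin_bigcap_measurable => // i _; rewrite -[X in measurable X]setTI.
exact: (measurable_tnth i measurableT (measurable_in_event (mc i))).
Qed.

Lemma cell_set_cons n (c : 'I_n.+1 -> coord_event R) t v :
  cell_set c (cons_tuple t v) <->
  in_event (c ord0) t /\ cell_set (fun i => c (lift ord0 i)) v.
Proof.
split=> [ctv|[ct cv] i].
  by split=> [|i]; [have := ctv ord0|have := ctv (lift ord0 i); rewrite tnthS].
by case: (unliftP ord0 i) => [j|] ->; rewrite ?tnthS//; exact: cv.
Qed.

Lemma cell_int_gt0 n (c : 'I_n -> coord_event R) (g : n.-tuple R -> \bar R) :
  measurable_cell c -> measurable_fun setT g ->
  (forall i A, c i = In A -> 0 < leb A) ->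
  (forall y, cell_set c y -> 0 < g y) -> 0 < cell_int c g.
Proof.
elim: n => [|n IH] in c g *; move=> mc mg c0 g0 /=; first by apply: g0 => -[].
have mc' : measurable_cell (fun i => c (lift ord0 i)) by move=> i; exact: mc.
have IH' t : in_event (c ord0) t ->
    0 < cell_int (fun i => c (lift ord0 i)) (fun v => g (cons_tuple t v)).
  move=> ct; apply: IH => // [|i A /c0//|v cv].
    by apply: measurableT_comp => //; exact: measurable_cons_tuple2.
  by apply: g0; apply/cell_set_cons.
have := mc ord0; have := c0 ord0; move: IH'.
case: (c ord0) => [p|A]/= IH' lebA mA; first exact: IH'.
apply: integral_gt0 => //; last exact: lebA.
by apply: measurable_funTS; exact: measurable_cell_slice.
Qed.

(** An [At] is never below an [In]: it would lower the dimension of the integral. Thus a subcell has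
    the same pinned coordinates, and its integral is that of the restricted integrand. *)
Definition sub_event (e' e : coord_event R) : Prop :=
  match e', e with
  | At p, At q => p = q
  | In A, In B => A `<=` B
  | _, _ => False
  end.

Lemma cell_int0 n (c : 'I_n -> coord_event R) : cell_int c (cst 0) = 0.
Proof.
elim: n => [|n IH] in c *; rewrite //=.
by case: (c ord0) => [p|A]/=; [exact: IH|apply: integral0_eq => t _; exact: IH].
Qed.

Lemma cell_int_sub n (c c' : 'I_n -> coord_event R) (g : n.-tuple R -> \bar R) :
  (forall i, sub_event (c' i) (c i)) ->
  cell_int c' g = cell_int c (g \_ (cell_set c')).
Proof.
elim: n => [|n IH] in c c' g *; move=> cc /=.
  by rewrite patchE mem_set// => -[].
have IH' t : cell_int (fun i => c (lift ord0 i))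
      (fun v => (g \_ (cell_set c')) (cons_tuple t v)) =
    if t \in in_event (c' ord0) then
      cell_int (fun i => c' (lift ord0 i)) (fun v => g (cons_tuple t v))
    else 0.
  case: ifPn => [/set_mem tc|/negP tc].
    rewrite [RHS](IH (fun i => c (lift ord0 i))) => [|i]; last exact: cc.
    apply: eq_cell_int => v; rewrite !patchE.
    congr (if _ then _ else _); apply/idP/idP => /set_mem.
      by move=> /cell_set_cons[_ ?]; exact/mem_set.
    by move=> ?; apply/mem_set/cell_set_cons.
  rewrite -[RHS](cell_int0 (fun i => c (lift ord0 i))); apply: eq_cell_int => v.
  rewrite patchE memNset// => /cell_set_cons[ct _].
  by apply: tc; exact/mem_set.
have := cc ord0; case: (c ord0) => [p|A]; case: (c' ord0) IH' => [q|B]//= IH'.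
  by move=> <-; rewrite IH' mem_set.
move=> BA; under [RHS]eq_integral do rewrite IH'.
rewrite -(setIidr BA) integral_mkcondr; apply: eq_integral => t _.
by rewrite patchE; congr (if _ then _ else _); rewrite (setIidr BA).
Qed.

Lemma coord_int_swap (e1 e2 : coord_event R) (g : R * R -> \bar R) :
  measurable_event e1 -> measurable_event e2 ->
  measurable_fun setT g -> (forall st, 0 <= g st) ->
  coord_int e1 (fun s => coord_int e2 (fun t => g (s, t))) =
  coord_int e2 (fun t => coord_int e1 (fun s => g (s, t))).
Proof.
case: e1 => [//|A]; case: e2 => [//|B]/= mA mB mg g0.
(* Extension by zero off the rectangle replaces both domains by one nonnegative function on the
   plane, to which Tonelli applies. *)
pose h := g \_ (A `*` B).
have mh : measurable_fun setT h.
  apply/(measurable_restrictT g (measurableX mA mB)).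
  exact: measurable_funTS mg.
have h0 st : 0 <= h st by rewrite /h patchE; case: ifP.
have H := fubini_tonelli (m1 := leb) (m2 := leb) h mh h0.
rewrite integral_mkcond [in RHS]integral_mkcond; etransitivity.
  etransitivity; last exact: H; apply: eq_integral => s _.
  rewrite /h !patchE; case: ifPn => sA.
    rewrite integral_mkcond; apply: eq_integral => t _.
    by rewrite !patchE in_setX sA.
  by apply/esym/integral0_eq => t _; rewrite patchE in_setX (negbTE sA).
apply: eq_integral => t _.
rewrite /h !patchE; case: ifPn => tB.
  rewrite [RHS]integral_mkcond; apply: eq_integral => s _.
  by rewrite !patchE in_setX tB andbT.
by apply/integral0_eq => s _; rewrite patchE in_setX (negbTE tB) andbF.
Qed.

Definition set_coord n (c : 'I_n -> coord_event R) (i : 'I_n)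
    (e : coord_event R) : 'I_n -> coord_event R :=
  fun j => if j == i then e else c j.

(** [cell_int] integrates in the order of the indices; the induction moves coordinate [i] outwards
    past [ord0] by Tonelli. This is what permits disintegration along the signal of an arbitrary
    buyer. *)
Lemma cell_int_exchange n (c : 'I_n -> coord_event R) (i : 'I_n)
    (g : n.-tuple R -> \bar R) :
  measurable_cell c -> measurable_fun setT g -> (forall y, 0 <= g y) ->
  cell_int c g = coord_int (c i) (fun t => cell_int (set_coord c i (At t)) g).
Proof.
elim: n => [|n IH] in c i g *; first by case: i.
move=> mc mg g0.
have mc' : measurable_cell (fun i => c (lift ord0 i)) by move=> j; exact: mc.
case: (unliftP ord0 i) => [j|] -> /=.
  have IH' s : cell_int (fun i => c (lift ord0 i)) (fun v => g (cons_tuple s v)) =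
      coord_int (c (lift ord0 j)) (fun t =>
        cell_int (set_coord (fun i => c (lift ord0 i)) j (At t))
          (fun v => g (cons_tuple s v))).
    apply: IH => //.
    by apply: measurableT_comp => //; exact: measurable_cons_tuple2.
  under eq_fun do rewrite IH'.
  pose h (st : R * R) :=
    cell_int (set_coord (fun i => c (lift ord0 i)) j (At st.2))
      (fun v => g (cons_tuple st.1 v)).
  have mh : measurable_fun setT h.
    apply: (measurable_cell_int
      (c := fun st : R * R => set_coord (fun i => c (lift ord0 i)) j (At st.2))
      (g := fun stv => g (cons_tuple stv.1.1 stv.2))) => [l|].
      rewrite /set_coord; case: (eqVneq l j) => _.
        by left; exists snd.
      exact: measurable_events_cst.
    apply: (measurableT_comp mg); apply: measurable_cons => //.
    exact: measurableT_comp.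
  have h0 st : 0 <= h st by exact: cell_int_ge0.
  rewrite (coord_int_swap (mc ord0) (mc (lift ord0 j)) mh h0).
  congr coord_int; apply/funext => t.
  by rewrite [in RHS]/set_coord/=; congr coord_int; apply/funext => s.
Qed.

Lemma measurable_set_coord n (c : 'I_n -> coord_event R) i e :
  measurable_cell c -> measurable_event e -> measurable_cell (set_coord c i e).
Proof. by move=> mc me j; rewrite /set_coord; case: ifP. Qed.

Lemma cell_intB n (c : 'I_n -> coord_event R) (g h : n.-tuple R -> \bar R) :
  measurable_cell c -> measurable_fun setT g -> (forall y, 0 <= g y) ->
  measurable_fun setT h -> (forall y, 0 <= h y) ->
  cell_int c g < +oo -> cell_int c h < +oo ->
  cell_int c (fun y => g y - h y) = cell_int c g - cell_int c h.
Proof.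
elim: n => [|n IH] in c g h *; move=> mc mg g0 mh h0 //=.
have mc' : measurable_cell (fun i => c (lift ord0 i)) by move=> j; exact: mc.
have mt (l : n.+1.-tuple R -> \bar R) t : measurable_fun setT l ->
    measurable_fun setT (fun v => l (cons_tuple t v)).
  by move=> ml; apply: measurableT_comp => //; exact: measurable_cons_tuple2.
pose J l t := cell_int (fun i => c (lift ord0 i))
  (fun v : n.-tuple R => l (cons_tuple t v)).
have mJ l : measurable_fun setT l -> measurable_fun setT (J l).
  exact: measurable_cell_slice.
have J0 l t : (forall y, 0 <= l y) -> 0 <= J l t.
  by move=> l0; apply: cell_int_ge0.
have mgh : measurable_fun setT (fun y => g y - h y) by exact: emeasurable_funB.
have := mc ord0; rewrite -/(J g) -/(J h) -/(J (fun y => g y - h y)).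
case: (c ord0) => [p _|A]/=; first by move=> gp hp; apply: IH => //; exact: mt.
move=> mA gA hA.
have iJ l : measurable_fun setT l -> (forall y, 0 <= l y) ->
    \int[leb]_(t in A) J l t < +oo -> leb.-integrable A (J l).
  move=> ml l0 lA; apply/integrableP; split; first exact: measurable_funTS (mJ _ ml).
  by under eq_integral do rewrite gee0_abs ?J0//.
have ig := iJ _ mg g0 gA; have ih := iJ _ mh h0 hA.
rewrite -integralB//; apply: ae_eq_integral => //.
- exact: measurable_funTS (mJ _ mgh).
- by apply: emeasurable_funB; apply: measurable_funTS; exact: mJ.
(* Finiteness of the outer integral makes the inner ones finite only for almost every t, so the
   induction hypothesis is available only there. *)
have gt := @integrable_ae _ _ R leb A mA _ ig.
have ht := @integrable_ae _ _ R leb A mA _ ih.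
apply: filterS2 gt ht => t gt ht At.
apply: (IH _ (fun v => g (cons_tuple t v)) (fun v => h (cons_tuple t v))) => //.
- exact: mt.
- exact: mt.
- by rewrite -ge0_fin_numE ?J0//; exact: gt.
- by rewrite -ge0_fin_numE ?J0//; exact: ht.
Qed.

End cells.

(** * Representation of monotone functionals by measures *)

Section functional.
Context d (T : measurableType d) (R : realType).
Local Open Scope ereal_scope.

(** Conditions of Daniell type on nonnegative functions: additivity, homogeneity and continuity
    along increasing sequences are exactly what makes indicators yield a measure that integrates to
    [I]. *)
Definition monotone_functional (I : (T -> \bar R) -> \bar R) : Prop :=
  [/\ forall g, (forall x, 0 <= g x) -> 0 <= I g,
      forall g h, measurable_fun setT g -> (forall x, 0 <= g x) ->
        measurable_fun setT h -> (forall x, 0 <= h x) ->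
        I (g \+ h) = I g + I h,
      forall (a : R) g, measurable_fun setT g -> (forall x, 0 <= g x) ->
        (0 <= a)%R -> I (fun x => a%:E * g x) = a%:E * I g &
      forall (g : (T -> \bar R)^nat) h, (forall k, measurable_fun setT (g k)) ->
        (forall k x, 0 <= g k x) -> (forall x, nondecreasing_seq (g ^~ x)) ->
        (forall x, g k x @[k --> \oo] --> h x) ->
        I (g k) @[k --> \oo] --> I h].

Definition functional_measure (I : (T -> \bar R) -> \bar R) (A : set T) :=
  I (EFin \o \1_A).

Context (I : (T -> \bar R) -> \bar R) (HI : monotone_functional I).

Lemma functional0 : I (cst 0) = 0.
Proof.
case: HI => _ _ IZ _; have := IZ 0%R (cst 0) (measurable_cst _) (fun=> lexx _) (lexx _).
by rewrite !mul0e; under eq_fun do rewrite mul0e.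
Qed.

Let mu := functional_measure I.

Let mu0 : mu set0 = 0.
Proof.
rewrite /mu/functional_measure -functional0; congr I.
by apply/funext => x /=; rewrite indic0.
Qed.

Let mu_ge0 A : 0 <= mu A.
Proof. by case: HI => I0 _ _ _; apply: I0 => x; rewrite lee_fin. Qed.

Lemma measurable_Eindic A : measurable A ->
  measurable_fun setT (EFin \o \1_A : T -> \bar R).
Proof. by move=> mA; exact/measurable_EFinP/measurable_indic. Qed.

Let mu_sigma : semi_sigma_additive mu.
Proof.
move=> F mF tF mUF; case: (HI) => I0 ID _ Icvg.
pose U n := \big[setU/set0]_(i < n) F i.
have mU n : measurable (U n) by exact: bigsetU_measurable.
(* By disjointness the indicators of the first n sets add up to the indicator of their union; these
   increase to the indicator of the whole union, and continuity of [I] concludes. *)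
have muU n : \sum_(0 <= i < n) mu (F i) = mu (U n).
  elim: n => [|n IH]; first by rewrite big_geq// /U big_ord0 mu0.
  rewrite big_nat_recr//= IH /mu/functional_measure -ID//;
    [|exact: measurable_Eindic|by move=> x; rewrite lee_fin
     |exact: measurable_Eindic|by move=> x; rewrite lee_fin].
  congr I; apply/funext => x /=; rewrite /U big_ord_recr/= -/(U n).
  rewrite !indicE in_setU; case: (boolP (x \in F n)) => /= [|_]; last first.
    by rewrite orbF adde0.
  rewrite orbT inE => Fx; rewrite memNset ?add0e// /U -bigcup_mkord => -[i /= ltin Fix].
  have ii : i = n by apply: (tF i n) => //; exists x.
  by move: ltin; rewrite ii ltnn.
under eq_fun do rewrite muU.
apply: Icvg => [k|k x|x k l kl|x].
- exact: measurable_Eindic.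
- by rewrite lee_fin.
- rewrite /= lee_fin !indicE; case: (boolP (x \in U k)) => // /set_mem.
  rewrite /U -bigcup_mkord => -[i /= ik Fi]; rewrite mem_set//.
  by rewrite -bigcup_mkord; exists i => //=; exact: leq_trans kl.
- apply: cvg_near_cst; have [[i _ Fi]|nF] := pselect ((\bigcup_n F n) x).
    exists i.+1 => // n /= ltin; rewrite !indicE !mem_set//; first by exists i.
    by rewrite /U -bigcup_mkord; exists i.
  apply: nearW => n; rewrite /= !indicE !memNset// => UnX; apply: nF.
  by move: UnX; rewrite /U -bigcup_mkord => -[i _ Fi]; exists i.
Qed.

HB.instance Definition _ := isMeasure.Build _ _ _ mu mu0 mu_ge0 mu_sigma.

Import HBNNSimple.

Let functional_nnsfun (h : {nnsfun T >-> R}) :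
  I (EFin \o h) = \int[mu]_x (h x)%:E.
Proof.
case: HI => _ ID IZ _.
have mi y : measurable_fun setT (EFin \o \1_(h @^-1` [set y]) : T -> \bar R).
  by apply: measurable_Eindic; exact: measurable_sfunP.
have key (s : seq R) : (forall y, y \in s -> (0 <= y)%R) ->
    I (fun x => \sum_(y <- s) y%:E * (\1_(h @^-1` [set y]) x)%:E) =
    \sum_(y <- s) y%:E * mu (h @^-1` [set y]).
  elim: s => [_|y s IH ys].
    rewrite big_nil -[RHS]functional0; congr I.
    by apply/funext => x; rewrite big_nil.
  have y0 : (0 <= y)%R by apply: ys; rewrite mem_head.
  have s0 x (z : R) : z \in s -> 0 <= z%:E * (\1_(h @^-1` [set z]) x)%:E.
    by move=> zs; rewrite mule_ge0// lee_fin// ys// in_cons zs orbT.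
  rewrite big_cons -IH => [|z zs]; last by rewrite ys// in_cons zs orbT.
  rewrite -IZ// => [|x]; last by rewrite lee_fin.
  rewrite -ID => [| |x| |x].
  - by congr I; apply/funext => x; rewrite big_cons.
  - exact: measurable_funeM.
  - by rewrite mule_ge0// lee_fin.
  - by apply: emeasurable_sum => z; exact: measurable_funeM (mi z).
  - by rewrite big_seq; apply: sume_ge0 => z; exact: s0.
rewrite integralT_nnsfun sintegralE fsbig_finite//= -key.
  congr I; apply/funext => x /=; rewrite fimfunE fsbig_finite//= -sumEFin.
  by apply: eq_bigr => y _; rewrite EFinM.
by move=> y; rewrite in_fset_set// inE => -[x _ <-].
Qed.

(** Both sides are continuous along the increasing simple approximations of [g], so agreement on
    simple functions suffices. *)
Lemma functional_integral (g : T -> \bar R) : measurable_fun setT g ->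
  (forall x, 0 <= g x) -> I g = \int[mu]_x g x.
Proof.
move=> mg g0; case: HI => I0 ID IZ Icvg.
pose g_ := nnsfun_approx measurableT mg.
have gg x : (g_ n x)%:E @[n --> \oo] --> g x by apply: cvg_nnsfun_approx.
have ndg x : nondecreasing_seq (fun n => (g_ n x)%:E).
  by move=> k l kl; rewrite lee_fin; exact/lefP/nd_nnsfun_approx.
have mg_ n : measurable_fun setT (EFin \o g_ n) by exact/measurable_EFinP.
have := Icvg (fun n => EFin \o g_ n) g mg_
  (fun n x => ltac:(by rewrite lee_fin)) ndg gg.
under eq_fun do rewrite functional_nnsfun.
have := @cvg_monotone_convergence _ _ _ mu setT measurableT _ (fun n => mg_ n)
  (fun n x _ => ltac:(by rewrite /= lee_fin)) (fun x _ => ndg x).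
under [X in _ --> X -> _]eq_integral do rewrite (cvg_lim _ (gg _))//.
by move=> /cvg_lim <- // /cvg_lim <-.
Qed.

Lemma functional_measureP : exists nu : {measure set T -> \bar R},
  forall g, measurable_fun setT g -> (forall x, 0 <= g x) ->
    I g = \int[nu]_x g x.
Proof. by exists mu => g; exact: functional_integral. Qed.

End functional.

(** Change of variables in the same shape as the representation of cell integrals, so that a law
    under [P] and a cell become two measures on one space, comparable on generating sets. *)
Lemma law_measureP d d' (T : measurableType d) (T' : measurableType d')
    (R : realType) (P : {measure set T -> \bar R}) (phi : T -> T') :
  measurable_fun setT phi -> exists nu : {measure set T' -> \bar R},
    forall g : T' -> \bar R, measurable_fun setT g -> (forall x, 0 <= g x)%E ->
      (\int[P]_x g (phi x) = \int[nu]_x g x)%E.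
Proof.
move=> mphi.
have mg (g : T' -> \bar R) : measurable_fun setT g ->
    measurable_fun setT (g \o phi).
  by move=> mg; exact: measurableT_comp.
have : monotone_functional (fun g : T' -> \bar R => \int[P]_x g (phi x))%E.
  split=> [g g0|g h mg_ g0 mh h0|a g mg_ g0 a0|g h mg_ g0 ndg gh].
  - exact: integral_ge0.
  - by rewrite ge0_integralD//; exact: mg.
  - by rewrite ge0_integralZl//; exact: mg.
  - rewrite [X in _ --> X](_ : _ =
        \int[P]_x limn (fun k => g k (phi x)))%E; last first.
      by apply: eq_integral => x _; apply/esym/cvg_lim => //; exact: gh.
    by apply: cvg_monotone_convergence => // k; exact: mg.
by move=> /functional_measureP.
Qed.

Lemma measure_integral_indic d (T : measurableType d) (R : realType)
    (mu : {measure set T -> \bar R}) (A : set T) : measurable A ->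
  (mu A = \int[mu]_x (\1_A x)%:E)%E.
Proof. by move=> mA; rewrite integral_indic// setIT. Qed.

(** * Cells as measures on signals and value *)

Section joint.
Context (R : realType) (n : nat) (k : R.-pker (n.-tuple R) ~> R)
  (f : n.-tuple R -> R).
Hypotheses (mf : measurable_fun setT f) (f0 : forall y, 0 <= f y).
Local Open Scope ereal_scope.
Implicit Types (G H : n.-tuple R * R -> \bar R).

Definition joint_slice G (y : n.-tuple R) : \bar R :=
  (\int[k y]_x G (y, x)) * (f y)%:E.

Lemma joint_slice_ge0 G y : (forall p, 0 <= G p) -> 0 <= joint_slice G y.
Proof. by move=> G0; rewrite mule_ge0 ?lee_fin// integral_ge0. Qed.

Lemma measurable_joint_slice G : measurable_fun setT G ->
  (forall p, 0 <= G p) -> measurable_fun setT (joint_slice G).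
Proof.
move=> mG G0; apply: emeasurable_funM; last exact/measurable_EFinP.
exact: (measurable_fun_integral_finite_kernel _ k).
Qed.

Lemma measurable_section G y : measurable_fun setT G ->
  measurable_fun setT (fun x => G (y, x)).
Proof. by move=> mG; apply: (measurableT_comp mG); exact: pair1_measurable. Qed.

Lemma kernel_setT y : k y setT = 1.
Proof. exact: prob_kernel. Qed.

Definition joint_int (I : Type) (s : seq I) (c : I -> 'I_n -> coord_event R)
  (G : n.-tuple R * R -> \bar R) : \bar R :=
  \sum_(j <- s) cell_int (c j) (joint_slice G).

Lemma joint_functional (I : Type) (s : seq I) (c : I -> 'I_n -> coord_event R) :
  (forall j, measurable_cell (c j)) -> monotone_functional (joint_int s c).
Proof.
move=> mc; split=> [G G0|G H mG G0 mH H0|a G mG G0 a0|G H mG G0 ndG GH].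
- by apply: sume_ge0 => j _; apply: cell_int_ge0 => y; exact: joint_slice_ge0.
- rewrite /joint_int -big_split/=; apply: eq_bigr => j _.
  rewrite -cell_intD//; last 4 first.
  + exact: measurable_joint_slice.
  + by move=> y; exact: joint_slice_ge0.
  + exact: measurable_joint_slice.
  + by move=> y; exact: joint_slice_ge0.
  apply: eq_cell_int => y; rewrite /joint_slice/= ge0_integralD//;
    [|exact: measurable_section|exact: measurable_section].
  by rewrite ge0_muleDl// integral_ge0.
- rewrite /joint_int ge0_sume_distrr; last first.
    by move=> j _; apply: cell_int_ge0 => y; exact: joint_slice_ge0.
  apply: eq_bigr => j _; rewrite -cell_intZ//; last 2 first.
  + exact: measurable_joint_slice.
  + by move=> y; exact: joint_slice_ge0.
  apply: eq_cell_int => y; rewrite /joint_slice ge0_integralZl//.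
  + by rewrite muleA.
  + exact: measurable_section.
- rewrite /joint_int; elim: s => [|j s IH].
    by under eq_fun do rewrite big_nil; rewrite big_nil; exact: cvg_cst.
  under eq_fun do rewrite big_cons; rewrite big_cons.
  have J0 i G' : (forall p, 0 <= G' p) -> 0 <= cell_int (c i) (joint_slice G').
    by move=> G'0; apply: cell_int_ge0 => y; exact: joint_slice_ge0.
  have H0 p : 0 <= H p.
    have /cvg_lim <- // := GH p; apply: lime_ge; last by apply: nearW.
    by apply/cvg_ex; exists (H p); exact: GH.
  apply: cvgeD => //.
    apply: ge0_adde_def; rewrite inE; first exact: J0.
    by apply: sume_ge0 => i _; exact: J0.
  apply: cvg_cell_int => // [l|l y|y a b ab|y].
  + exact: measurable_joint_slice.
  + exact: joint_slice_ge0.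
  + rewrite /joint_slice lee_wpmul2r ?lee_fin//.
    apply: ge0_le_integral => //; try exact: measurable_section.
    by move=> x _; exact: ndG.
  + rewrite /joint_slice; apply: cvgeZr => //.
    rewrite [X in _ --> X](_ : _ = \int[k y]_x limn (fun l => G l (y, x))).
      by apply: cvg_monotone_convergence => // l; exact: measurable_section.
    by congr integral; apply/funext => x; apply/esym/cvg_lim => //; exact: GH.
Qed.

Lemma joint_measureP (I : Type) (s : seq I) (c : I -> 'I_n -> coord_event R) :
  (forall j, measurable_cell (c j)) ->
  exists mu : {measure set (n.-tuple R * R) -> \bar R},
    forall G, measurable_fun setT G -> (forall p, 0 <= G p) ->
      joint_int s c G = \int[mu]_p G p.
Proof. by move=> mc; exact/functional_measureP/joint_functional. Qed.

(** Infinite values are covered because the integral of [h] against [k y] may be undefined for some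
    y: [+oo - +oo] is [-oo], and so is its product with a positive [r]. *)
Lemma ge0_muleBl (a b : \bar R) (r : R) : 0 <= a -> 0 <= b -> (0 <= r)%R ->
  (a - b) * r%:E = a * r%:E - b * r%:E.
Proof.
move=> a0 b0; rewrite le_eqVlt => /predU1P[<-|r0]; first by rewrite !mule0 sube0.
case: a a0 => [a| |] // a0; case: b b0 => [b| |] // b0.
- by rewrite -EFinB -!EFinM -EFinB mulrBl.
- by rewrite /= gt0_mulNye ?lte_fin// gt0_mulye ?lte_fin.
- by rewrite /= gt0_mulye ?lte_fin.
- by rewrite /= gt0_mulye ?lte_fin// gt0_mulNye ?lte_fin.
Qed.

Lemma joint_int_lt_pinfty (I : Type) (s : seq I)
    (c : I -> 'I_n -> coord_event R) G : (forall p, 0 <= G p) ->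
  joint_int s c G < +oo ->
  forall P, \sum_(j <- s | P j) cell_int (c j) (joint_slice G) < +oo.
Proof.
move=> G0 Goo P; apply: le_lt_trans Goo; rewrite /joint_int [leRHS](bigID P)/= leeDl//.
by apply: sume_ge0 => j _; apply: cell_int_ge0 => y; exact: joint_slice_ge0.
Qed.

Section signed.
Context (I : Type) (s : seq I) (c : I -> 'I_n -> coord_event R)
  (mu : {measure set (n.-tuple R * R) -> \bar R}).
Hypotheses (mc : forall j, measurable_cell (c j))
  (Hmu : forall G, measurable_fun setT G -> (forall p, 0 <= G p) ->
     joint_int s c G = \int[mu]_p G p).

Lemma measurable_Esnd (h : R -> R) : measurable_fun setT h ->
  measurable_fun setT (fun p : n.-tuple R * R => (h p.2)%:E).
Proof. by move=> mh; apply/measurable_EFinP; exact: measurableT_comp. Qed.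

Lemma cells_mass_measure : cells_mass f [seq c j | j <- s] = mu setT.
Proof.
rewrite -[RHS]mul1e -integral_cst// -Hmu// /joint_int /cells_mass big_map.
apply: eq_bigr => j _; apply: eq_cell_int => y.
by rewrite /joint_slice integral_cst// kernel_setT !mul1e.
Qed.

(** The representation by [mu] holds for nonnegative integrands only. The signed numerator is split
    into parts inside each cell, and finiteness of the absolute numerator permits the
    subtraction. *)
Lemma cells_num_measure (h : R -> R) : measurable_fun setT h ->
  cells_num k f [seq c j | j <- s] (fun x => `|h x|%R) < +oo ->
  mu.-integrable setT (fun p => (h p.2)%:E) /\
  cells_num k f [seq c j | j <- s] h = \int[mu]_p (h p.2)%:E.
Proof.
move=> mh; pose G (p : n.-tuple R * R) := (h p.2)%:E.
have mG : measurable_fun setT G by exact: measurable_Esnd.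
have -> : cells_num k f [seq c j | j <- s] (fun x => `|h x|%R) =
    joint_int s c (abse \o G).
  by rewrite /cells_num big_map; apply: eq_bigr.
have mGp : measurable_fun setT G^\+ by exact: measurable_funepos.
have mGn : measurable_fun setT G^\- by exact: measurable_funeneg.
have mGa : measurable_fun setT (abse \o G) by exact: measurableT_comp.
have G0 p : 0 <= (abse \o G) p by exact: abse_ge0.
move=> Goo.
have iG : mu.-integrable setT G.
  by apply/integrableP; split => //; rewrite -Hmu.
split=> //.
have le_oo F : measurable_fun setT F -> (forall p, 0 <= F p) ->
    (forall p, F p <= (abse \o G) p) -> joint_int s c F < +oo.
  move=> mF F0 FG; rewrite Hmu//; apply: (le_lt_trans _ Goo); rewrite Hmu//.
  exact: ge0_le_integral.
have Gpoo : joint_int s c G^\+ < +oo.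
  by apply: le_oo => // p; rewrite funeposE ge_max /G/= !lee_fin ler_norm normr_ge0.
have Gnoo : joint_int s c G^\- < +oo.
  apply: le_oo => // p; rewrite funenegE ge_max /G/= !lee_fin normr_ge0.
  by rewrite andbT -normrN ler_norm.
rewrite integralE -!Hmu// /joint_int /cells_num big_map.
have {Gpoo Gnoo} : (forall P,
    \sum_(j <- s | P j) cell_int (c j) (joint_slice G^\+) < +oo) /\ (forall P,
    \sum_(j <- s | P j) cell_int (c j) (joint_slice G^\-) < +oo).
  by split; apply: joint_int_lt_pinfty.
have Gh y : (\int[k y]_x (h x)%:E) * (f y)%:E =
    joint_slice G^\+ y - joint_slice G^\- y.
  rewrite integralE ge0_muleBl ?integral_ge0//; congr (_ * _ - _ * _);
  by apply: eq_integral => x _; rewrite ?(funeposE, funenegE).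
have Jpos F j : (forall p, 0 <= F p) -> 0 <= cell_int (c j) (joint_slice F).
  by move=> F0; apply: cell_int_ge0 => y; exact: joint_slice_ge0.
elim: s => [_|j t IH [Gp Gn]]; first by rewrite !big_nil sube0.
have Gpj : cell_int (c j) (joint_slice G^\+) < +oo.
  apply: le_lt_trans (Gp xpredT); rewrite big_cons leeDl// sume_ge0// => i _.
  exact: Jpos.
have Gnj : cell_int (c j) (joint_slice G^\-) < +oo.
  apply: le_lt_trans (Gn xpredT); rewrite big_cons leeDl// sume_ge0// => i _.
  exact: Jpos.
have tp P : \sum_(j <- t | P j) cell_int (c j) (joint_slice G^\+) < +oo.
  apply: le_lt_trans (Gp P); rewrite big_cons; case: ifP => // _.
  by rewrite leeDr// Jpos.
have tn P : \sum_(j <- t | P j) cell_int (c j) (joint_slice G^\-) < +oo.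
  apply: le_lt_trans (Gn P); rewrite big_cons; case: ifP => // _.
  by rewrite leeDr// Jpos.
rewrite !big_cons IH//; under eq_cell_int do rewrite Gh.
rewrite cell_intB//; last 4 first.
- exact: measurable_joint_slice.
- by move=> y; exact: joint_slice_ge0.
- exact: measurable_joint_slice.
- by move=> y; exact: joint_slice_ge0.
have fin_sum F : (forall p, 0 <= F p) ->
    \sum_(j <- t) cell_int (c j) (joint_slice F) < +oo ->
    \sum_(j <- t) cell_int (c j) (joint_slice F) \is a fin_num.
  by move=> F0 Foo; rewrite ge0_fin_numE// sume_ge0// => i _; exact: Jpos.
by rewrite fin_num_oppeD ?fin_sum// addeACA.
Qed.

End signed.

Section law.
Context d (T : measurableType d) (P : probability T R)
  (X : T -> R) (Y : T -> n.-tuple R).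
Hypotheses (mX : measurable_fun setT X) (mY : measurable_fun setT Y)
  (Hf : is_density P Y f) (Hk : is_cond_law P X Y k).

Let allc : unit -> 'I_n -> coord_event R := fun _ _ => In setT.

Let mallc j : measurable_cell (allc j).
Proof. by move=> i /=. Qed.

Let joint_fst (g : n.-tuple R -> \bar R) (y : n.-tuple R) :
  joint_slice (fun p => g p.1) y = g y * (f y)%:E.
Proof.
have := integral_cst (k y) measurableT (g y).
by rewrite kernel_setT mule1 /joint_slice => ->.
Qed.

(** The image of [P] under [Y] and the image of the cell measure under [fst] agree on measurable
    sets by the definition of a density, hence on nonnegative functions. *)
Let marginal (g : n.-tuple R -> \bar R) : measurable_fun setT g ->
  (forall y, 0 <= g y) ->
  \int[P]_w g (Y w) = joint_int [:: tt] allc (fun p => g p.1).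
Proof.
move=> mg g0.
have [nu Hnu] := law_measureP P mY.
have [mu Hmu] := joint_measureP [:: tt] mallc.
have [mu1 Hmu1] := @law_measureP _ _ _ _ R mu fst (measurable_fst).
rewrite Hnu// Hmu//; last exact: measurableT_comp.
rewrite Hmu1//; apply: eq_measure_integral => A mA _.
have iA0 (y : n.-tuple R) : 0 <= (\1_A y : R)%:E by rewrite lee_fin.
have miA : measurable_fun setT (EFin \o \1_A : n.-tuple R -> \bar R).
  exact: measurable_Eindic.
rewrite !measure_integral_indic// -Hnu// -Hmu1// -Hmu//; last first.
  exact: (measurableT_comp miA).
rewrite /joint_int big_seq1; transitivity (P (Y @^-1` A)).
  rewrite measure_integral_indic//.
  by rewrite -[X in measurable X]setTI; exact: mY.
case: Hf => _ _ ->//; apply: eq_cell_int => y.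
by rewrite [RHS](joint_fst (EFin \o \1_A)) EFinM muleC.
Qed.

Lemma integral_joint_law G : measurable_fun setT G -> (forall p, 0 <= G p) ->
  \int[P]_w G (Y w, X w) = joint_int [:: tt] allc G.
Proof.
move=> mG G0.
have mYX : measurable_fun setT (fun w => (Y w, X w)).
  exact: measurable_fun_pair.
have [nu Hnu] := law_measureP P mYX.
have [mu Hmu] := joint_measureP [:: tt] mallc.
rewrite Hnu// Hmu//; apply: eq_measure_integral => D mD _.
(* Rectangles are a generating class closed under intersection and contain the whole space, and the
   law is finite. On a rectangle the conditional law removes the value and [marginal] then removes
   the probability space. *)
pose C := [set B `*` A | B in @measurable _ (n.-tuple R) & A in @measurable _ R].
have nuE D' : measurable D' -> nu D' = P ((fun w => (Y w, X w)) @^-1` D').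
  move=> mD'; rewrite measure_integral_indic//.
  rewrite -(Hnu (EFin \o \1_D'))//; last 2 first.
  - exact: measurable_Eindic.
  - by move=> p; rewrite lee_fin.
  rewrite measure_integral_indic//.
  by rewrite -[X in measurable X]setTI; exact: mYX.
have muE D' : measurable D' -> mu D' = joint_int [:: tt] allc (EFin \o \1_D').
  move=> mD'; rewrite measure_integral_indic// Hmu//.
  - exact: measurable_Eindic.
  - by move=> p; rewrite lee_fin.
apply: (measure_unique C (fun=> setT)) => //.
- by rewrite measurable_prod_measurableType.
- move=> _ _ [B1 mB1 [A1 mA1 <-]] [B2 mB2 [A2 mA2 <-]].
  exists (B1 `&` B2); first exact: measurableI.
  by exists (A1 `&` A2); [exact: measurableI|rewrite setXI].
- by move=> _; exists setT => //; exists setT => //; rewrite setXTT.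
- by apply/seteqP; split => // p _; exists 0%N.
- move=> _ [B mB [A mA <-]].
  rewrite nuE ?muE//; [|exact: measurableX..].
  transitivity (P (X @^-1` A `&` Y @^-1` B)).
    by congr (P _); apply/seteqP; split => w [].
  rewrite Hk// integral_mkcond.
  pose g (y : n.-tuple R) := (\1_B y)%:E * k y A.
  transitivity (\int[P]_w g (Y w)).
    apply: eq_integral => w _; rewrite patchE /g indicE.
    rewrite (_ : (Y w \in B) = (w \in Y @^-1` B)); last first.
      by apply/idP/idP => /set_mem ?; exact/mem_set.
    by case: ifP => _; rewrite ?mul1e ?mul0e.
  rewrite marginal; last 2 first.
  + by apply: emeasurable_funM; [exact: measurable_Eindic|exact: measurable_kernel].
  + by move=> y; rewrite mule_ge0// lee_fin.
  rewrite /joint_int !big_seq1; apply: eq_cell_int => y.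
  rewrite [LHS](joint_fst g) /g /joint_slice; congr (_ * _).
  rewrite measure_integral_indic// -ge0_integralZl//; last first.
    exact/measurable_EFinP/measurable_indic.
  by apply: eq_integral => x _; rewrite /= -EFinM !indicE in_setX -mulnb natrM.
- move=> _; rewrite nuE//.
  by apply: (le_lt_trans (probability_le1 P _)); rewrite ?ltry// -[X in measurable X]setTI; exact: mYX.
Qed.

End law.

End joint.

(** * Concave utility *)

Lemma increasing_le (R : realType) (h : R -> R) : increasing h ->
  {homo h : x y / x <= y}.
Proof. by move=> h_incr x y; rewrite le_eqVlt => /predU1P[->//|/h_incr/ltW]. Qed.

Section utility.
Context (R : realType) (u : R -> R).
Hypothesis Hu : weakly_risk_averse u.

Let u_incr : increasing u. Proof. by case: Hu. Qed.

Lemma utility_le (x y : R) : x <= y -> u x <= u y.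
Proof. exact: increasing_le. Qed.

(** Concavity without denominators, so that degenerate intervals are included. *)
Lemma concave_chord (a b c : R) : a <= b <= c ->
  (c - b) * u a + (b - a) * u c <= (c - a) * u b.
Proof.
move=> /andP[ab bc]; have [ac|ca] := ltP a c; last first.
  have -> : b = a by lra.
  have -> : c = a by lra.
  by rewrite !subrr !mul0r addr0.
have ca0 : 0 < c - a by rewrite subr_gt0.
have t0 : 0 <= (c - b) / (c - a) by rewrite divr_ge0 ?subr_ge0// ltW.
have t1 : (c - b) / (c - a) <= 1 by rewrite ler_pdivrMr// mul1r; lra.
have [cvx _ _] := Hu.
have : - u ((c - b) / (c - a) * a + (1 - (c - b) / (c - a)) * c) <=
    (c - b) / (c - a) * - u a + (1 - (c - b) / (c - a)) * - u c.
  exact: (cvx (Itv01 t0 t1) a c (mem_setT _) (mem_setT _)).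
have -> : (c - b) / (c - a) * a + (1 - (c - b) / (c - a)) * c = b.
  by field; lra.
move=> /(ler_wpM2l (ltW ca0)).
have -> : (c - a) * ((c - b) / (c - a) * - u a + (1 - (c - b) / (c - a)) * - u c)
    = - ((c - b) * u a + (b - a) * u c) by field; lra.
by rewrite mulrN lerN2.
Qed.

(** Both chord slopes are compared with the slope over [b, d], in cross-multiplied form; the factor
    d - b > 0 is cancelled at the end. *)
Lemma concave_slopes (a b c d : R) : a < b -> b <= c -> c < d ->
  (u d - u c) * (b - a) <= (u b - u a) * (d - c).
Proof.
move=> ab bc cd.
have h1 : (d - c) * u b + (c - b) * u d <= (d - b) * u c.
  by apply: concave_chord; lra.
have h2 : (d - b) * u a + (b - a) * u d <= (d - a) * u b.
  by apply: concave_chord; lra.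
have h1' : (u d - u c) * (d - b) <= (u d - u b) * (d - c) by lra.
have h2' : (u d - u b) * (b - a) <= (u b - u a) * (d - b) by lra.
have h1'' := ler_wpM2r (ltac:(lra) : 0 <= b - a) h1'.
have h2'' := ler_wpM2r (ltac:(lra) : 0 <= d - c) h2'.
rewrite -(@ler_pM2r _ (d - b)); lra.
Qed.

Lemma utility_continuous : continuous u.
Proof.
move=> a; apply/cvgrPdist_le => e e0.
(* The slope of the chord over [a - 2, a - 1]. By concavity it bounds every chord slope to the right
   of a - 1, so [u] is Lipschitz with constant [K] near a. *)
pose K := u (a - 1) - u (a - 2).
have K0 : 0 < K by rewrite subr_gt0; apply: u_incr; lra.
have lip (x y : R) : a - 1 <= x -> x < y -> `|u y - u x| <= K * (y - x).
  move=> ax xy; rewrite ger0_norm; last by rewrite subr_ge0 utility_le// ltW.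
  have := @concave_slopes (a - 2) (a - 1) x y ltac:(lra) ax xy.
  by rewrite (_ : a - 1 - (a - 2) = 1) ?mulr1//; ring.
near=> y.
have ya1 : `|a - y| < 1 by near: y; apply: cvgr_dist_lt; [exact: cvg_id|].
have yae : `|a - y| < e / K.
  by near: y; apply: cvgr_dist_lt; [exact: cvg_id|rewrite divr_gt0].
have Ke : K * `|a - y| <= e by rewrite mulrC -ler_pdivlMr// ltW.
apply: le_trans Ke; move: ya1; rewrite ltr_norml => /andP[y1 y2].
have [ay|ya|->] := ltgtP a y.
- by rewrite distrC (le_trans (lip _ _ _ ay))//; [lra|rewrite ltr0_norm; lra].
- by rewrite (le_trans (lip _ _ _ ya))//; [lra|rewrite gtr0_norm; lra].
- by rewrite !subrr normr0 mulr0.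
Unshelve. all: by end_near. Qed.

(** Stronger than the usual inequality at [v], which is the case q = v: since q lies between [v] and
    p, the chord from q to p is on one side of [v], and its slope compares with [c] in the right
    direction. *)
Lemma supergradient (v : R) : exists2 c : R, 0 < c & forall p q,
  (v <= q <= p) \/ (p <= q <= v) -> u p - u q <= c * (p - q).
Proof.
(* Slopes of the chords that end at [v]; their infimum is the left derivative of [u] there. Any
   chord to the right of [v] bounds them from below, and the one over [v, v + 1] makes the infimum
   positive. *)
pose S := [set (u v - u (v - h)) / h | h in [set h : R | 0 < h]].
have S1 : S ((u v - u (v - 1)) / 1) by exists 1 => //=.
have lbS w z : v <= w -> w < z -> lbound S ((u z - u w) / (z - w)).
  move=> vw wz _ [h /= h0 <-].
  have := @concave_slopes (v - h) v w z; rewrite (_ : v - (v - h) = h); last ring.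
  move=> /(_ ltac:(lra) vw wz) H.
  rewrite ler_pdivrMr ?subr_gt0// mulrAC ler_pdivlMr//.
have hS : has_inf S.
  by split; [exists ((u v - u (v - 1)) / 1)|exists ((u (v + 1) - u v) / (v + 1 - v));
    apply: lbS; lra].
exists (inf S).
  apply: (@lt_le_trans _ _ ((u (v + 1) - u v) / (v + 1 - v))).
    by rewrite divr_gt0 ?subr_gt0//; [apply: u_incr|]; lra.
  by apply: lb_le_inf => //; [exists ((u v - u (v - 1)) / 1)|apply: lbS; lra].
move=> p q [] /andP[].
  move=> vq; rewrite le_eqVlt => /predU1P[->|qp]; first by rewrite !subrr mulr0.
  rewrite -ler_pdivrMr ?subr_gt0//; apply: lb_le_inf; last exact: lbS.
  by exists ((u v - u (v - 1)) / 1).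
rewrite le_eqVlt => /predU1P[->|pq] qv; first by rewrite !subrr mulr0.
suff H : inf S <= (u q - u p) / (q - p).
  by move: H; rewrite ler_pdivlMr ?subr_gt0//; lra.
(* For q = v the slope over [p, v] belongs to [S]; otherwise the slope over [p, q] is at least that
   over [q, v], which does. *)
move: qv; rewrite le_eqVlt => /predU1P[qv|qv].
  rewrite qv in pq *.
  apply: ge_inf; first exact: hS.2.
  exists (v - p) => /=; first by rewrite subr_gt0.
  by rewrite (_ : v - (v - p) = p)//; ring.
apply: (@le_trans _ _ ((u v - u q) / (v - q))).
  apply: ge_inf; first exact: hS.2.
  exists (v - q) => /=; first by rewrite subr_gt0.
  by rewrite (_ : v - (v - q) = q)//; ring.
rewrite ler_pdivrMr ?subr_gt0// mulrAC ler_pdivlMr ?subr_gt0//.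
exact: concave_slopes.
Qed.

End utility.

(* Admissibility without the limit at infinity, so that the zero contract and
   profit and loss sharing are instances. *)
Definition contract (R : realType) (phi : R -> R) : Prop :=
  [/\ {homo phi : w w' / w <= w'}, increasing (fun w => w - phi w),
      phi 0 = 0 & continuous phi].

Section contract.
Context (R : realType) (phi : R -> R).
Hypothesis Hphi : contract phi.

(** Both [phi] and w - phi w are nondecreasing and vanish at 0, so phi w lies between 0 and w. This
    gives the integrable bound on payments. *)
Lemma contract_norm_le (w : R) : `|phi w| <= `|w|.
Proof.
have [mono incr phi0 _] := Hphi.
have incr' := increasing_le incr.
have [w0|/ltW w0] := leP 0 w.
  have := mono _ _ w0; have := incr' _ _ w0; rewrite phi0 subr0 => a b.
  by rewrite !ger0_norm//; lra.
have := mono _ _ w0; have := incr' _ _ w0; rewrite phi0 subr0 => a b.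
by rewrite !ler0_norm//; lra.
Qed.

(** Since w - phi w lies between 0 and w and u 0 = 0, integrability of the utility without profit
    sharing carries over to every contract. *)
Lemma utility_contract_norm_le (u : R -> R) (w : R) : weakly_risk_averse u ->
  `|u (w - phi w)| <= `|u w|.
Proof.
move=> Hu; have [_ _ u0] := Hu; have [mono incr phi0 _] := Hphi.
have incr' := increasing_le incr.
have ule := utility_le Hu.
have [w0|/ltW w0] := leP 0 w.
  have := mono _ _ w0; have := incr' _ _ w0; rewrite phi0 subr0 => a b.
  have h1 := ule _ _ a; have h2 : u (w - phi w) <= u w by apply: ule; lra.
  by rewrite u0 in h1; rewrite !ger0_norm//; lra.
have := mono _ _ w0; have := incr' _ _ w0; rewrite phi0 subr0 => a b.
have h1 := ule _ _ a; have h2 : u w <= u (w - phi w) by apply: ule; lra.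
by rewrite u0 in h1; rewrite !ler0_norm//; lra.
Qed.

End contract.

(** * Expected utility as a function of the bid *)

Section expected_utility.
Context (R : realType) d (T : measurableType d) (mu : {measure set T -> \bar R})
  (x : T -> R).
Hypotheses (mx : measurable_fun setT x) (mu0 : (0 < mu setT)%E)
  (muoo : (mu setT < +oo)%E).

Lemma Rintegral_lt (g h : T -> R) :
  mu.-integrable setT (EFin \o g) -> mu.-integrable setT (EFin \o h) ->
  (forall w, g w < h w) -> \int[mu]_w g w < \int[mu]_w h w.
Proof.
move=> ig ih gh; rewrite -subr_gt0 -RintegralB//.
have ihg : mu.-integrable setT (fun w => (h w - g w)%:E).
  exact: (integrableB measurableT ih ig).
rewrite /Rintegral fine_gt0//; apply/andP; split; last exact: integrable_lty.
apply: integral_gt0 => //; first exact: measurable_int ihg.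
by move=> w _; rewrite lte_fin subr_gt0.
Qed.

Lemma continuous_measurable_comp (v : R -> R) b : continuous v ->
  measurable_fun setT (fun w => v (x w - b)).
Proof.
move=> cv; apply: (measurableT_comp (continuous_measurable_fun cv)).
exact: measurable_funB.
Qed.

Section root.
Context (v : R -> R).
Hypotheses (v_incr : increasing v) (cv : continuous v) (v0 : v 0 = 0)
  (iv : forall b, mu.-integrable setT (fun w => (v (x w - b))%:E)).

Let F b := \int[mu]_w v (x w - b).

Lemma expectation_decreasing b b' : b < b' -> F b' < F b.
Proof.
by move=> bb; apply: (Rintegral_lt (iv b') (iv b)) => w; apply: v_incr; lra.
Qed.

Let v_le a b : a <= b -> v a <= v b.
Proof. exact: increasing_le. Qed.

Lemma integrable_cst_fin (c : R) : mu.-integrable setT (fun=> c%:E).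
Proof.
apply/integrableP; split; first exact: measurable_cst.
have -> : (fun=> `|c%:E|%E) = cst `|c%:E|%E :> (T -> \bar R) by [].
by rewrite integral_cst//= lte_mul_pinfty ?lee_fin.
Qed.

(** The functions v (x + n) increase without an integrable majorant at hand; cut off at v 1 they are
    dominated by |v x| + v 1 and tend to the constant v 1 > 0. If all F (- n) were nonpositive, the
    limit v 1 times the mass would be nonpositive too. *)
Lemma expectation_pos : exists b, 0 < F b.
Proof.
pose w_ n w := Num.min (v (x w - - n%:R)) (v 1).
have v1 : 0 < v 1 by rewrite -v0; exact: v_incr.
have mw n : measurable_fun setT (w_ n).
  by apply: measurable_minr => //; exact: continuous_measurable_comp.
have ig : mu.-integrable setT (fun w => (`|v (x w - 0)| + v 1)%:E).
  apply: (@integrableD _ _ _ mu setT measurableT (fun w => `|v (x w - 0)|%:E)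
    (fun=> (v 1)%:E)); last exact: integrable_cst_fin.
  exact: (integrable_abse (iv 0)).
have w_le n w : `|w_ n w| <= `|v (x w - 0)| + v 1.
  rewrite /w_; have : v (x w - 0) <= v (x w - - n%:R).
    by apply: v_le; rewrite lerD2l lerN2 lerNl oppr0.
  have := ler_norm (v (x w - 0)); have := ler_norm (- v (x w - 0)).
  rewrite normrN; case: (leP (v (x w - - n%:R)) (v 1)) => h1 h2 h3 h4.
    by rewrite ler_norml; apply/andP; split; lra.
  by rewrite gtr0_norm// lerDr.
have iw n : mu.-integrable setT (fun w => (w_ n w)%:E).
  apply: (le_integrable measurableT _ _ ig); first exact/measurable_EFinP.
  move=> w _ /=; rewrite lee_fin (le_trans (w_le _ _))//.
  exact: ler_norm.
apply: contrapT => Fle.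
have F0 n : (\int[mu]_w (w_ n w)%:E <= 0)%E.
  have Fn : F (- n%:R) <= 0.
    by rewrite leNgt; apply/negP => ?; apply: Fle; exists (- n%:R).
  apply: (@le_trans _ _ (\int[mu]_w (v (x w - - n%:R))%:E)%E).
    apply: (le_integral measurableT (iw n) (iv (- n%:R))) => w _.
    by rewrite lee_fin ge_min lexx.
  rewrite -[leLHS]fineK ?lee_fin//.
  exact: (integrable_fin_num measurableT (iv (- n%:R))).
have mwE n : measurable_fun setT (fun w => (w_ n w)%:E).
  exact/measurable_EFinP.
have cvw : {ae mu, forall w, setT w ->
    (w_ n w)%:E @[n --> \oo] --> cst (v 1)%:E w}.
  apply: aeW => w _; apply: cvg_near_cst; near=> n.
  rewrite /w_; congr EFin; apply/min_idPr; apply: v_le.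
  by rewrite opprK -lerBlDl; near: n; exact: nbhs_infty_ger.
have w_leE : {ae mu, forall w n, setT w ->
    (`|(w_ n w)%:E| <= (`|v (x w - 0)| + v 1)%:E)%E}.
  by apply: aeW => w n _; rewrite lee_fin.
have [_ _] := dominated_convergence measurableT mwE (measurable_cst _) cvw ig w_leE.
rewrite integral_cst// => cv_.
have : ((v 1)%:E * mu setT <= 0)%E.
  move/cvg_lim : (cv_) => <- //; apply: lime_le; last by apply: nearW.
  by apply/cvg_ex; eexists; exact: cv_.
by rewrite leNgt mule_gt0// lte_fin.
Unshelve. all: by end_near. Qed.

(** For c between a and b, monotonicity puts v (x - c) between the values at the end points, so the
    sum of their absolute values dominates. *)
Lemma expectation_continuous a b : {in `]a, b[%classic, continuous F}.
Proof.
apply: (@continuity_under_integral R _ T mu (fun b w => v (x w - b)) setT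
  measurableT a b _ _ (fun w => `|v (x w - a)| + `|v (x w - b)|)).
- by move=> c _; exact: iv.
- apply: aeW => w _ c _; apply: continuous_comp; last exact: cv.
  by apply: continuousB; [exact: cst_continuous|exact: cvg_id].
- exact: (integrableD measurableT (integrable_abse (iv a)) (integrable_abse (iv b))).
- move=> c; rewrite /= in_itv/= => /andP[ac cb]; apply: aeW => w _.
  have h1 : v (x w - c) <= v (x w - a) by apply: v_le; lra.
  have h2 : v (x w - b) <= v (x w - c) by apply: v_le; lra.
  have h3 := ler_norm (v (x w - a)); have h4 := ler_norm (- v (x w - b)).
  rewrite normrN in h4.
  have h5 := normr_ge0 (v (x w - a)); have h6 := normr_ge0 (v (x w - b)).
  by rewrite ler_norml; apply/andP; split; lra.
Qed.

End root.

End expected_utility.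

Section comparison.
Context (R : realType) d (T : measurableType d) (mu : {measure set T -> \bar R})
  (x : T -> R).
Hypotheses (mx : measurable_fun setT x) (mu0 : (0 < mu setT)%E)
  (muoo : (mu setT < +oo)%E).

Lemma expectation_root (v : R -> R) : increasing v -> continuous v -> v 0 = 0 ->
  (forall b, mu.-integrable setT (fun w => (v (x w - b))%:E)) ->
  exists b, \int[mu]_w v (x w - b) = 0.
Proof.
move=> v_incr cv v0 iv.
have [b1 Fb1] := expectation_pos mx mu0 muoo v_incr cv v0 iv.
suff [b2 Fb2] : exists b, \int[mu]_w v (x w - b) < 0.
  have b12 : b1 < b2.
    rewrite ltNge le_eqVlt; apply/negP => /predU1P[b21|b21].
      by move: Fb2; rewrite b21 ltNge ltW.
    have := @expectation_decreasing _ _ _ _ _ mu0 _ v_incr iv _ _ b21.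
    by move=> /(lt_trans Fb1) /lt_trans /(_ Fb2); rewrite ltxx.
  have [|||b _ Fb] := @IVT R (fun b => \int[mu]_w v (x w - b)) b1 b2 0.
  - exact: ltW.
  (* Continuity is available on open intervals, whence the margin of 1 on both sides of [b1, b2]. *)
  - apply: continuous_in_subspaceT => b; rewrite inE/= in_itv/= => /andP[h1 h2].
    apply: (@expectation_continuous R d T mu x v v_incr cv iv (b1 - 1) (b2 + 1)).
    by rewrite inE/= in_itv/=; apply/andP; split; lra.
  - by rewrite ge_min le_max (ltW Fb1) (ltW Fb2) orbT.
  by exists b.
(* A bid with negative expectation comes by reflection: y |-> - v (- y) is again increasing,
   continuous and zero at 0, and it is applied to - x. *)
have vN (b : R) : (fun w => - v (- (- x w - b))) = (fun w => - v (x w - - b)).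
  by apply/funext => w; congr (- v _); ring.
have ivN b : mu.-integrable setT (fun w => (- v (- (- x w - b)))%:E).
  by rewrite (funext (fun w => congr1 EFin (congr1 (@^~ w) (vN b))));
    exact: integrableN (iv (- b)).
have cvN : continuous (fun y => - v (- y)).
  move=> y; apply: continuousN; apply: continuous_comp; last exact: cv.
  by apply: continuousN; exact: cvg_id.
have [||b] := expectation_pos (measurable_funN mx) mu0 muoo
  (v := fun y => - v (- y)) _ cvN _ ivN.
- by move=> y z yz; rewrite ltrN2 v_incr// ltrN2.
- by rewrite oppr0 v0 oppr0.
rewrite vN => Fb; exists (- b).
rewrite -oppr_gt0 -mulN1r -RintegralZl//; last exact: iv.
by under eq_Rintegral do rewrite mulN1r.
Qed.

Lemma expected_utility_comparison (u p q : R -> R) :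
  weakly_risk_averse u -> {homo p : y z / y <= z} -> {homo q : y z / y <= z} ->
  continuous p -> continuous q -> {homo (p \- q) : y z / y <= z} ->
  mu.-integrable setT (fun w => (u (p (x w)))%:E) ->
  mu.-integrable setT (fun w => (u (q (x w)))%:E) ->
  mu.-integrable setT (fun w => (p (x w) - q (x w))%:E) ->
  \int[mu]_w u (p (x w)) = \int[mu]_w u (q (x w)) ->
  0 <= \int[mu]_w (p (x w) - q (x w)).
Proof.
move=> Hu pmono qmono cp cq pq iup iuq ipq Epq.
have u_incr : increasing u by case: Hu.
have [nneg|/existsNP[y1 /negP]] := pselect (forall y, 0 <= p y - q y).
  by apply: Rintegral_ge0 => w _.
rewrite -ltNge => y1neg.
(* Without a sign change there is no crossing: p >= q everywhere is the claim, and p < q everywhere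
   contradicts equal expected utilities. *)
have [neg|/existsNP[y2 /negP]] := pselect (forall y, p y - q y < 0).
  have : \int[mu]_w u (p (x w)) < \int[mu]_w u (q (x w)).
    by apply: Rintegral_lt => // w; apply: u_incr; rewrite -subr_lt0.
  by rewrite Epq ltxx.
rewrite -leNgt => y2nneg.
have y12 : y1 <= y2.
  rewrite leNgt; apply/negP => /ltW/pq /=; rewrite leNgt => /negP; apply.
  exact: lt_le_trans y2nneg.
have [|||x0 _ /= px0] := @IVT R (p \- q) y1 y2 0.
- exact: y12.
- apply: continuous_subspaceT => y; apply: continuousB; [exact: cp|exact: cq].
- by rewrite /= ge_min le_max y2nneg (ltW y1neg) orbT.
have {px0} px0 : q x0 = p x0 by lra.
have [c c0 Hc] := supergradient Hu (p x0).
(* On either side of the crossing, monotonicity of [q] and of p - q places [q] between the common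
   value and [p], as [supergradient] demands. *)
have key w : u (p (x w)) - u (q (x w)) <= c * (p (x w) - q (x w)).
  apply: Hc; have [le0|/ltW le0] := leP x0 (x w); [left|right].
    have := pq _ _ le0; rewrite /= px0 subrr => h.
    by rewrite -{1}px0 qmono//=; lra.
  have := pq _ _ le0; rewrite /= px0 subrr => h.
  by rewrite -px0 qmono// andbT; lra.
have : \int[mu]_w (u (p (x w)) - u (q (x w))) <=
       \int[mu]_w (c * (p (x w) - q (x w))).
  apply: le_Rintegral => //.
  - exact: (integrableB measurableT iup iuq).
  - exact: (integrableZl measurableT c ipq).
rewrite RintegralB// Epq subrr RintegralZl//.
by rewrite pmulr_rge0.
Qed.

End comparison.

(** * Positive dependence *)

Section ladder.
Context (R : realType) (m : nat).
Implicit Types (j : 'I_m.+1) (e : coord_event R).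

(** Buyer 1 in [e0], the runner-up pinned at [z], the remaining buyers in [eo]: the shape shared by
    the cells given Y_1 = Z_1 = z and by the event on which buyer 1 wins. *)
Definition ladder_cell (e0 : coord_event R) j (z : R) (eo : coord_event R) :
    'I_m.+2 -> coord_event R :=
  fun i => if i == ord0 then e0 else if i == lift ord0 j then At z else eo.

Lemma measurable_ladder_cell e0 j z eo :
  measurable_event e0 -> measurable_event eo ->
  measurable_cell (ladder_cell e0 j z eo).
Proof. by move=> me0 meo i; rewrite /ladder_cell; do 2 case: ifP => //. Qed.

Lemma sub_ladder_cell e0 e0' j z eo eo' : sub_event e0' e0 -> sub_event eo' eo ->
  forall i, sub_event (ladder_cell e0' j z eo' i) (ladder_cell e0 j z eo i).
Proof. by move=> s0 so i; rewrite /ladder_cell; do 2 case: ifP => //. Qed.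

Lemma coord_in_singleton (A : set R) (p : R) : A `<=` [set p] -> coord_in A p = At p.
Proof. by move=> Ap; rewrite /coord_in asboolT. Qed.

Lemma coord_in_set (A : set R) (p q : R) : A q -> q != p -> coord_in A p = In A.
Proof.
by move=> Aq /eqP qp; rewrite /coord_in asboolF// => /(_ _ Aq).
Qed.

Lemma box_ladder_At j (a z : R) : a < z ->
  box (fun i => if i == ord0 then z else if i == lift ord0 j then z else a)
      (fun=> z) = [:: ladder_cell (At z) j z (In `[a, z])].
Proof.
move=> az; rewrite /box; congr [:: _]; apply/funext => i; rewrite /ladder_cell.
have z1 : `[z, z] `<=` [set z].
  by move=> t /=; rewrite in_itv/= -eq_le => /eqP.
case: ifP => _; first by rewrite coord_in_singleton.
case: ifP => _; first by rewrite coord_in_singleton.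
apply: (@coord_in_set _ _ z); last by rewrite gt_eqF.
by rewrite /= in_itv/= lexx ltW.
Qed.

(** It differs from the previous box only in the upper end for [ord0], so one application of
    positive dependence, raising that end from [z] to [b], compares the two. *)
Lemma box_ladder_In j (a b z : R) : a < z -> z < b ->
  box (fun i => if i == ord0 then z else if i == lift ord0 j then z else a)
      [eta (fun=> z) with ord0 |-> b] =
  [:: ladder_cell (In `[z, b]) j z (In `[a, z])].
Proof.
move=> az zb; rewrite /box; congr [:: _]; apply/funext => i; rewrite /ladder_cell /=.
have z1 : `[z, z] `<=` [set z].
  by move=> t /=; rewrite in_itv/= -eq_le => /eqP.
case: ifP => _.
  apply: (@coord_in_set _ _ b); last by rewrite gt_eqF.
  by rewrite /= in_itv/= lexx ltW.
case: ifP => _; first by rewrite coord_in_singleton.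
apply: (@coord_in_set _ _ z); last by rewrite gt_eqF.
by rewrite /= in_itv/= lexx ltW.
Qed.

End ladder.

(** If [S] has a least element, the constant sequence serves. Otherwise running minima over an
    enumeration of the rationals in [S] work: below each t of [S] there is another point of [S], and
    a rational in between, which is in [S] because [S] is an interval. *)
Lemma coinitial_seq (R : realType) (S : set R) (a0 : R) : is_interval S -> S a0 ->
  exists a : nat -> R, [/\ forall r, S (a r), forall r, a r <= a0,
    nonincreasing_seq a & forall t, S t -> exists r, a r <= t].
Proof.
move=> iS Sa0; have [[l Sl lmin]|nomin] :=
    pselect (exists2 l, S l & forall t, S t -> l <= t).
  exists (fun=> l); split => // [r|t /lmin lt]; last by exists 0%N.
  exact: lmin.
(* Codes of no rational decode to 0; the membership test in [a] makes this harmless. *)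
pose q (r : nat) : R := ratr (odflt 0%Q (unpickle r)).
pose a := fix a (r : nat) : R :=
  if r is r'.+1 then
    if `[< S (q r') >] then Num.min (a r') (q r') else a r'
  else a0.
have aS r : S (a r).
  elim: r => //= r IH; case: asboolP => // Sq.
  by rewrite minEle; case: ifP.
have a_step r : a r.+1 <= a r.
  by rewrite /=; case: asboolP => // _; rewrite ge_min lexx.
have a_ni : nonincreasing_seq a by apply/nonincreasing_seqP.
exists a; split => // [r|t St]; first exact: (a_ni 0%N r).
have [t' St' t't] : exists2 t', S t' & t' < t.
  apply: contrapT => H; apply: nomin; exists t => // t' St'.
  by rewrite leNgt; apply/negP => t't; apply: H; exists t'.
have [p pt] := rat_in_itvoo t't.
move: pt; rewrite in_itv/= => /andP[p1 p2].
have Sp : S (ratr p).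
  by apply: (iS t' t) => //; rewrite !ltW.
exists (pickle p).+1; rewrite /= /q pickleK/= asboolT//.
by rewrite ge_min (ltW p2) orbT.
Qed.

(** * Restriction of a cell to subcells *)

Section subcell.
Context (R : realType) (n : nat) (k : R.-pker (n.-tuple R) ~> R)
  (f : n.-tuple R -> R).
Hypotheses (mf : measurable_fun setT f) (f0 : forall y, 0 <= f y).
Local Open Scope ereal_scope.
Context (c : 'I_n -> coord_event R)
  (mu : {measure set (n.-tuple R * R) -> \bar R}).
Hypotheses (mc : measurable_cell c)
  (Hmu : forall G, measurable_fun setT G -> (forall p, 0 <= G p) ->
     joint_int k f [:: tt] (fun=> c) G = \int[mu]_p G p).

Definition cell_cyl (c' : 'I_n -> coord_event R) : set (n.-tuple R * R) :=
  [set p | cell_set c' p.1].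

Lemma measurable_cell_cyl c' : measurable_cell c' -> measurable (cell_cyl c').
Proof.
move=> mc'; rewrite -[X in measurable X]setTI.
by apply: measurable_fst => //; exact: measurable_cell_set.
Qed.

Section sub.
Context (c' : 'I_n -> coord_event R).
Hypotheses (mc' : measurable_cell c')
  (cc : forall i, sub_event (c' i) (c i)).

Lemma joint_int_sub (G : n.-tuple R * R -> \bar R) : measurable_fun setT G ->
  (forall p, 0 <= G p) ->
  joint_int k f [:: tt] (fun=> c') G = \int[mu]_(p in cell_cyl c') G p.
Proof.
move=> mG G0; have mD := measurable_cell_cyl mc'.
rewrite integral_mkcond -Hmu; last 2 first.
- by apply/(measurable_restrictT G mD); exact: measurable_funTS mG.
- by move=> p; rewrite patchE; case: ifP.
rewrite /joint_int !big_seq1 (cell_int_sub _ cc); apply: eq_cell_int => y.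
rewrite patchE; case: ifPn => [/set_mem cy|/negP cy]; rewrite /joint_slice.
  by congr (_ * _); apply: eq_integral => x _; rewrite patchE mem_set.
rewrite integral0_eq ?mul0e// => x _; rewrite patchE memNset// => cy'.
by apply: cy; exact/mem_set.
Qed.

Lemma cells_mass_sub : cells_mass f [:: c'] = mu (cell_cyl c').
Proof.
have mD := measurable_cell_cyl mc'.
have := @joint_int_sub (cst 1) (measurable_cst _) (fun=> lee01).
rewrite integral_cst// mul1e => <-.
rewrite /joint_int /cells_mass !big_seq1; apply: eq_cell_int => y.
by rewrite /joint_slice integral_cst// kernel_setT !mul1e.
Qed.

Lemma cells_num_sub (h : R -> R) : measurable_fun setT h ->
  mu.-integrable setT (fun p => (h p.2)%:E) ->
  cells_num k f [:: c'] (fun x => `|h x|%R) < +oo /\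
  cells_num k f [:: c'] h = \int[mu]_(p in cell_cyl c') (h p.2)%:E.
Proof.
move=> mh ih; have mD := measurable_cell_cyl mc'.
pose G (p : n.-tuple R * R) := (h p.2)%:E.
have mG : measurable_fun setT G by exact: measurable_int ih.
have mGa : measurable_fun setT (abse \o G) by exact: measurableT_comp.
have Ga0 p : 0 <= (abse \o G) p by exact: (abse_ge0 (G p)).
have oo : cells_num k f [:: c'] (fun x => `|h x|%R) < +oo.
  have -> : cells_num k f [:: c'] (fun x => `|h x|%R) =
      joint_int k f [:: tt] (fun=> c') (abse \o G).
    by rewrite /cells_num /joint_int !big_seq1.
  rewrite joint_int_sub//.
  apply: (@le_lt_trans _ _ (\int[mu]_p (abse \o G) p)).
    exact: ge0_subset_integral.
  by case/integrableP : ih.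
split => //.
(* The subcell has a measure of its own, through which the signed numerator splits; its two
   nonnegative parts are then read off from [mu]. *)
have [nu Hnu] := @joint_measureP R n k f mf f0 unit [:: tt] (fun=> c') (fun=> mc').
have [_ E] := @cells_num_measure R n k f mf f0 unit [:: tt] (fun=> c') nu
  (fun=> mc') Hnu h mh oo.
rewrite [LHS]E integralE [RHS]integralE.
have mGp : measurable_fun setT G^\+ by exact: measurable_funepos.
have mGn : measurable_fun setT G^\- by exact: measurable_funeneg.
by rewrite -!Hnu// !joint_int_sub.
Qed.

End sub.

Lemma integral_cell_cyl (h : R -> R) : measurable_fun setT h ->
  mu.-integrable setT (fun p => (h p.2)%:E) ->
  \int[mu]_(p in cell_cyl c) (h p.2)%:E = \int[mu]_p (h p.2)%:E.
Proof.
move=> mh ih.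
have cc i : sub_event (c i) (c i) by case: (c i) => [p|A]; [|exact: subset_refl].
have [oo <-] := cells_num_sub mc cc mh ih.
by have [_] := @cells_num_measure R n k f mf f0 unit [:: tt] (fun=> c) mu
  (fun=> mc) Hmu h mh oo.
Qed.

Lemma cvg_cells_num (h : R -> R) (c_ : nat -> 'I_n -> coord_event R) :
  measurable_fun setT h -> mu.-integrable setT (fun p => (h p.2)%:E) ->
  (forall r, measurable_cell (c_ r)) ->
  (forall y, cell_set c y -> \forall r \near \oo, cell_set (c_ r) y) ->
  (forall y, ~ cell_set c y -> forall r, ~ cell_set (c_ r) y) ->
  \int[mu]_(p in cell_cyl (c_ r)) (h p.2)%:E @[r --> \oo] -->
  \int[mu]_p (h p.2)%:E.
Proof.
move=> mh ih mc_ cin cout.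
rewrite -(integral_cell_cyl mh ih) integral_mkcond.
under eq_fun do rewrite integral_mkcond.
pose G (p : n.-tuple R * R) := (h p.2)%:E.
have mG : measurable_fun setT G by exact: measurable_int ih.
have mGD D : measurable D -> measurable_fun setT (G \_ D).
  by move=> mD; apply/(measurable_restrictT G mD); exact: measurable_funTS mG.
have cvG : {ae mu, forall p, setT p ->
    (G \_ (cell_cyl (c_ r))) p @[r --> \oo] --> (G \_ (cell_cyl c)) p}.
  apply: aeW => p _; apply: cvg_near_cst.
  have [cp|ncp] := pselect (cell_set c p.1).
    have /= /cin H := cp; apply: filterS H => r cr.
    by rewrite !patchE !mem_set.
  apply: nearW => r; rewrite !patchE !memNset//; exact: cout.
have leG : {ae mu, forall p r, setT p ->
    `|(G \_ (cell_cyl (c_ r))) p| <= (abse \o G) p}.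
  by apply: aeW => p r _; rewrite patchE; case: ifP => //= _; rewrite normr0 lee_fin.
by have [_ _] := dominated_convergence measurableT
  (fun r => mGD _ (measurable_cell_cyl (mc_ r))) (mGD _ (measurable_cell_cyl mc))
  cvG (integrable_abse ih) leG.
Qed.

End subcell.

Section dependence.
Context (R : realType) (m : nat) (k : R.-pker (m.+2.-tuple R) ~> R)
  (f : m.+2.-tuple R -> R) (IY : set R).
Hypotheses (mf : measurable_fun setT f) (f0 : forall y, 0 <= f y)
  (HIY : is_interval IY)
  (Hfpos : forall y : m.+2.-tuple R, (forall n, IY (tnth y n)) -> 0 < f y).
Local Notation leb := (@lebesgue_measure R).

Lemma measurable_IY : measurable IY.
Proof. exact: is_interval_measurable. Qed.

Definition below (z : R) : coord_event R := In (IY `&` `]-oo, z]).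
Definition above (z : R) : coord_event R := In (IY `&` `[z, +oo[).

Lemma measurable_below z : measurable_event (below z).
Proof. by apply: measurableI => //; exact: measurable_IY. Qed.

Lemma measurable_above z : measurable_event (above z).
Proof. by apply: measurableI => //; exact: measurable_IY. Qed.

Definition represents (c : 'I_m.+2 -> coord_event R)
    (mu : {measure set (m.+2.-tuple R * R) -> \bar R}) : Prop :=
  forall G, measurable_fun setT G -> (forall p, 0 <= G p)%E ->
    joint_int k f [:: tt] (fun=> c) G = (\int[mu]_p G p)%E.

Lemma cells_mass_gt0 (c : 'I_m.+2 -> coord_event R) : measurable_cell c ->
  (forall i A, c i = In A -> (0 < leb A)%E) ->
  (forall i, in_event (c i) `<=` IY) -> (0 < cells_mass f [:: c])%E.
Proof.
move=> mc c0 cI; rewrite /cells_mass big_seq1; apply: cell_int_gt0 => //.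
  exact/measurable_EFinP.
by move=> y cy; rewrite lte_fin; apply: Hfpos => i; exact/cI/cy.
Qed.

Section limit.
Context (Hdep : positive_dependence k f IY) (j : 'I_m.+1) (a0 b0 z : R)
  (M1 M2 : {measure set (m.+2.-tuple R * R) -> \bar R}).
Hypotheses (Ia0 : IY a0) (Ib0 : IY b0) (az : a0 < z) (zb : z < b0)
  (HM1 : represents (ladder_cell (At z) j z (below z)) M1)
  (HM2 : represents (ladder_cell (above z) j z (below z)) M2)
  (M1oo : (M1 setT < +oo)%E) (M2oo : (M2 setT < +oo)%E).

Let Iz : IY z. Proof. by apply: (HIY Ia0 Ib0); rewrite !ltW. Qed.

(* Positive dependence is stated for boxes with end points in IY, whereas the
   cells are unbounded or have end points outside IY; boxes with end points a r
   and b r, obtained from coinitial and cofinal sequences of IY, exhaust them. *)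
Lemma dependence_limit (h : R -> R) : increasing h ->
  M1.-integrable setT (fun p => (h p.2)%:E) ->
  M2.-integrable setT (fun p => (h p.2)%:E) ->
  (\int[M1]_p h p.2) * fine (M2 setT) <= (\int[M2]_p h p.2) * fine (M1 setT).
Proof.
move=> h_incr ih1 ih2.
have mh : measurable_fun setT h.
  exact: (nondecreasing_measurable _ (increasing_le h_incr)).
have [a [aI aa0 a_ni a_cof]] := coinitial_seq HIY Ia0.
(* Negation turns the coinitial sequence of the reflected interval into a cofinal one of [IY]. *)
have INY : is_interval [set t | IY (- t)].
  move=> s t /= Is It r /andP[sr rt]; apply: (HIY It Is); apply/andP; lra.
have INb0 : [set t | IY (- t)] (- b0) by rewrite /= opprK.
have [b' [bI' bb0' b_ni b_cof]] := coinitial_seq INY INb0.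
pose b r := - b' r.
have bI r : IY (b r) by exact: bI'.
(* Strictness keeps the sides of the boxes nondegenerate for every r, so [coord_in] never collapses
   them to points. *)
have ar r : a r < z by exact: le_lt_trans az.
have br r : z < b r by apply: (lt_le_trans zb); rewrite lerNr.
pose c1 r := ladder_cell (At z) j z (In `[a r, z]).
pose c2 r := ladder_cell (In `[z, b r]) j z (In `[a r, z]).
have mc1 r : measurable_cell (c1 r).
  by apply: measurable_ladder_cell => //=; exact: measurable_itv.
have mc2 r : measurable_cell (c2 r).
  by apply: measurable_ladder_cell => /=; exact: measurable_itv.
have mC1 : measurable_cell (ladder_cell (At z) j z (below z)).
  by apply: measurable_ladder_cell => //; exact: measurable_below.
have mC2 : measurable_cell (ladder_cell (above z) j z (below z)).
  by apply: measurable_ladder_cell; [exact: measurable_above|exact: measurable_below].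
have aIz r : `[a r, z] `<=` IY `&` `]-oo, z].
  move=> t /=; rewrite !in_itv/= => /andP[t1 t2]; split => //.
  by apply: (HIY (aI r) Iz); rewrite t1 t2.
have zIb r : `[z, b r] `<=` IY `&` `[z, +oo[.
  move=> t /=; rewrite !in_itv/= => /andP[t1 t2]; split; last by rewrite t1.
  by apply: (HIY Iz (bI r)); rewrite t1 t2.
have s1 r i : sub_event (c1 r i) (ladder_cell (At z) j z (below z) i).
  by apply: sub_ladder_cell => //; exact: aIz.
have s2 r i : sub_event (c2 r i) (ladder_cell (above z) j z (below z) i).
  by apply: sub_ladder_cell => //; [exact: zIb|exact: aIz].
have /all_and2[oo1 E1] r : (cells_num k f [:: c1 r] (fun x => `|h x|%R) < +oo)%E /\
    cells_num k f [:: c1 r] h = (\int[M1]_(p in cell_cyl (c1 r)) (h p.2)%:E)%E.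
  exact: (cells_num_sub mf f0 HM1 (mc1 r) (s1 r) mh ih1).
have /all_and2[oo2 E2] r : (cells_num k f [:: c2 r] (fun x => `|h x|%R) < +oo)%E /\
    cells_num k f [:: c2 r] h = (\int[M2]_(p in cell_cyl (c2 r)) (h p.2)%:E)%E.
  exact: (cells_num_sub mf f0 HM2 (mc2 r) (s2 r) mh ih2).
have m1E r : cells_mass f [:: c1 r] = M1 (cell_cyl (c1 r)).
  exact: (cells_mass_sub HM1 (mc1 r) (s1 r)).
have m2E r : cells_mass f [:: c2 r] = M2 (cell_cyl (c2 r)).
  exact: (cells_mass_sub HM2 (mc2 r) (s2 r)).
have leb_itv (s t : R) : s < t -> (0 < leb `[s, t])%E.
  by move=> st; rewrite lebesgue_measure_itv/= lte_fin st -EFinD lte_fin subr_gt0.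
have m1_gt0 r : (0 < cells_mass f [:: c1 r])%E.
  apply: cells_mass_gt0 => // [i A|i]; rewrite /c1 /ladder_cell.
    by do 2 case: ifP => // _; move=> [<-]; exact: leb_itv.
  by do 2 (case: ifP => _; first by move=> t /= ->); move=> t /(aIz r)[].
have m2_gt0 r : (0 < cells_mass f [:: c2 r])%E.
  apply: cells_mass_gt0 => // [i A|i]; rewrite /c2 /ladder_cell.
    case: ifP => _; first by move=> [<-]; exact: leb_itv.
    by case: ifP => // _; move=> [<-]; exact: leb_itv.
  case: ifP => _; first by move=> t /(zIb r)[].
  by case: ifP => _; [move=> t /= ->|move=> t /(aIz r)[]].
have le_setT (M : {measure set (m.+2.-tuple R * R) -> \bar R}) c :
    measurable_cell c -> (M (cell_cyl c) <= M setT)%E.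
  by move=> mc; apply: le_measure; rewrite ?inE//; exact: measurable_cell_cyl.
have m1_lt r : (cells_mass f [:: c1 r] < +oo)%E.
  by rewrite m1E (le_lt_trans (le_setT _ _ (mc1 r))).
have m2_lt r : (cells_mass f [:: c2 r] < +oo)%E.
  by rewrite m2E (le_lt_trans (le_setT _ _ (mc2 r))).
(* The comparison of ratios in cross-multiplied form, in which numerators and masses converge
   separately; only the weak inequality survives the limit. *)
have key r : fine (cells_num k f [:: c1 r] h) * fine (cells_mass f [:: c2 r]) <=
    fine (cells_num k f [:: c2 r] h) * fine (cells_mass f [:: c1 r]).
  have := @Hdep h
    (fun i => if i == ord0 then z else if i == lift ord0 j then z else a r)
    (fun=> z) ord0 (b r) h_incr.
  case => [i|_ /(_ (bI r) (br r))].
    by case: ifP => _; [|case: ifP => _]; split => //; exact: ltW.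
  rewrite box_ladder_At// box_ladder_In// -/(c1 r) -/(c2 r) eqxx.
  have ce1 : cond_exists k f [:: c1 r] h.
    by split; [apply/andP; split|exact: oo1].
  have ce2 : cond_exists k f [:: c2 r] h.
    by split; [apply/andP; split|exact: oo2].
  move=> /(_ ce1 ce2) /ltW; rewrite /cond_exp.
  rewrite ler_pdivrMr ?fine_gt0 ?m1_gt0 ?m1_lt// mulrAC.
  by rewrite ler_pdivlMr ?fine_gt0 ?m2_gt0 ?m2_lt.
have near_a t : IY t -> \forall r \near \oo, a r <= t.
  move=> /a_cof[r0 r0t]; exists r0 => // r /= r0r; apply: le_trans r0t; exact: a_ni.
have near_b t : IY t -> \forall r \near \oo, t <= b r.
  move=> It; have [r0 r0t] := b_cof (- t) (ltac:(by rewrite /= opprK)).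
  exists r0 => // r /= r0r; rewrite lerNr; apply: le_trans r0t; exact: b_ni.
have cin1 y : cell_set (ladder_cell (At z) j z (below z)) y ->
    \forall r \near \oo, cell_set (c1 r) y.
  move=> cy; apply: filter_forall => i; have := cy i.
  rewrite /c1 /ladder_cell; case: ifP => [_ yi|_]; first exact: nearW.
  case: ifP => [_ yi|_]; first exact: nearW.
  case=> /near_a + yiz; apply: filterS => r; move: yiz.
  by rewrite /= !in_itv/= => -> ->.
have cin2 y : cell_set (ladder_cell (above z) j z (below z)) y ->
    \forall r \near \oo, cell_set (c2 r) y.
  move=> cy; apply: filter_forall => i; have := cy i.
  rewrite /c2 /ladder_cell; case: ifP => [_|_].
    case=> /near_b + yiz; apply: filterS => r; move: yiz.
    by rewrite /= !in_itv/= andbT => -> ->.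
  case: ifP => [_ yi|_]; first exact: nearW.
  case=> /near_a + yiz; apply: filterS => r; move: yiz.
  by rewrite /= !in_itv/= => -> ->.
have cell_sub (c c' : 'I_m.+2 -> coord_event R) y :
    (forall i, sub_event (c' i) (c i)) -> ~ cell_set c y -> ~ cell_set c' y.
  move=> cc ncy c'y; apply: ncy => i; have := c'y i; have := cc i.
  by case: (c' i) => [p|A]; case: (c i) => [q|B] //=; [move=> -> ->|move=> H /H].
have cvg1 v : measurable_fun setT v -> M1.-integrable setT (fun p => (v p.2)%:E) ->
    fine (\int[M1]_(p in cell_cyl (c1 r)) (v p.2)%:E)%E @[r --> \oo] -->
    \int[M1]_p v p.2.
  move=> mv iv; apply: fine_cvg; rewrite fineK; last exact: integrable_fin_num.
  apply: (cvg_cells_num mf f0 mC1 HM1) => // y ncy r.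
  exact: (cell_sub _ _ _ (s1 r) ncy).
have cvg2 v : measurable_fun setT v -> M2.-integrable setT (fun p => (v p.2)%:E) ->
    fine (\int[M2]_(p in cell_cyl (c2 r)) (v p.2)%:E)%E @[r --> \oo] -->
    \int[M2]_p v p.2.
  move=> mv iv; apply: fine_cvg; rewrite fineK; last exact: integrable_fin_num.
  apply: (cvg_cells_num mf f0 mC2 HM2) => // y ncy r.
  exact: (cell_sub _ _ _ (s2 r) ncy).
have cst1 (M : {measure set (m.+2.-tuple R * R) -> \bar R}) :
    (M setT < +oo)%E -> M.-integrable setT (fun=> 1%:E).
  by move=> Moo; exact: (integrable_cst_fin Moo 1).
have massE (M : {measure set (m.+2.-tuple R * R) -> \bar R}) c :
    measurable_cell c -> (\int[M]_(p in cell_cyl c) 1%:E = M (cell_cyl c))%E.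
  move=> mc; have := integral_cst M (measurable_cell_cyl mc) 1%:E.
  by rewrite mul1e.
have massT (M : {measure set (m.+2.-tuple R * R) -> \bar R}) :
    \int[M]_p (1 : R) = fine (M setT).
  by rewrite /Rintegral; have := integral_cst M measurableT 1%:E; rewrite mul1e => ->.
have m1_cvg : fine (cells_mass f [:: c1 r]) @[r --> \oo] --> fine (M1 setT).
  have := cvg1 (cst 1) (measurable_cst _) (cst1 _ M1oo); rewrite massT.
  by under eq_fun do rewrite (massE _ _ (mc1 _)) -m1E.
have m2_cvg : fine (cells_mass f [:: c2 r]) @[r --> \oo] --> fine (M2 setT).
  have := cvg2 (cst 1) (measurable_cst _) (cst1 _ M2oo); rewrite massT.
  by under eq_fun do rewrite (massE _ _ (mc2 _)) -m2E.
have n1_cvg := cvg1 _ mh ih1; have n2_cvg := cvg2 _ mh ih2.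
apply: (ler_cvg_to (cvgM n1_cvg m2_cvg) (cvgM n2_cvg m1_cvg)).
by apply: nearW => r; have := key r; rewrite E1 E2.
Qed.

(** Positive dependence speaks of strictly increasing functions, while the difference of two
    payments may be flat. Adding e x with e > 0 makes it increasing, and e is then taken small. *)
Lemma dependence_nondecreasing (h : R -> R) : {homo h : x y / x <= y} ->
  M1.-integrable setT (fun p => (h p.2)%:E) ->
  M2.-integrable setT (fun p => (h p.2)%:E) ->
  M1.-integrable setT (fun p => p.2%:E) ->
  M2.-integrable setT (fun p => p.2%:E) ->
  (\int[M1]_p h p.2) * fine (M2 setT) <= (\int[M2]_p h p.2) * fine (M1 setT).
Proof.
move=> h_nd ih1 ih2 ix1 ix2.
have key e : 0 < e ->
    (\int[M1]_p h p.2 + e * \int[M1]_p p.2) * fine (M2 setT) <=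
    (\int[M2]_p h p.2 + e * \int[M2]_p p.2) * fine (M1 setT).
  move=> e0; pose he x := h x + e * x.
  have he_incr : increasing he.
    by move=> x y xy; rewrite /he ler_ltD ?ltr_pM2l// h_nd// ltW.
  have ie (M : {measure set (m.+2.-tuple R * R) -> \bar R}) :
      M.-integrable setT (fun p => (h p.2)%:E) ->
      M.-integrable setT (fun p => p.2%:E) ->
      M.-integrable setT (fun p => (he p.2)%:E) /\
      \int[M]_p he p.2 = \int[M]_p h p.2 + e * \int[M]_p p.2.
    move=> ih ix; have iex := integrableZl measurableT e ix.
    split; first exact: (integrableD measurableT ih iex).
    rewrite -RintegralZl// -RintegralD//; exact: iex.
  have [i1 E1] := ie _ ih1 ix1; have [i2 E2] := ie _ ih2 ix2.
  by rewrite -E1 -E2; exact: dependence_limit.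
set A := \int[M1]_p h p.2 in key *; set B := \int[M2]_p h p.2 in key *.
set A' := \int[M1]_p p.2 in key; set B' := \int[M2]_p p.2 in key.
set s := fine (M2 setT) in key *; set t := fine (M1 setT) in key *.
rewrite leNgt; apply/negP => lt.
(* [D] bounds B' t - A' s, the 1 making it positive; e is chosen so that e D is half of the supposed
   gap A s - B t, which contradicts [key]. *)
pose D := `|A' * s| + `|B' * t| + 1.
have D0 : 0 < D by rewrite ltr_pwDr// addr_ge0.
have [e [e0 eD]] : exists e, 0 < e /\ e * D = (A * s - B * t) / 2.
  exists ((A * s - B * t) / (2 * D)).
  split; first by rewrite divr_gt0 ?subr_gt0 ?mulr_gt0.
  by field; rewrite gt_eqF.
have h1 : - `|A' * s| <= A' * s by rewrite lerNl -normrN ler_norm.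
have h2 : B' * t <= `|B' * t| by rewrite ler_norm.
have h3 : e * (B' * t - A' * s) <= e * D.
  by rewrite ler_pM2l//; rewrite /D; lra.
rewrite eD in h3; have := key e e0.
lra.
Qed.

End limit.
End dependence.

(** * Bids on the diagonal *)

Section given.
Context (R : realType) (m : nat) (k : R.-pker (m.+2.-tuple R) ~> R)
  (f : m.+2.-tuple R -> R) (IY : set R) (u : R -> R).
Hypotheses (mf : measurable_fun setT f) (f0 : forall y, 0 <= f y)
  (HIY : is_interval IY) (Hu : weakly_risk_averse u)
  (Hint_condX : forall y1 z1 : R, IY y1 -> IY z1 ->
     cond_exists k f (given_Y1_Z1 m IY y1 z1) (fun x => x))
  (Hint_condu : forall y1 z1 b : R, IY y1 -> IY z1 ->
     cond_exists k f (given_Y1_Z1 m IY y1 z1) (fun x => u (x - b))).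

Definition given_cell (z : R) (j : 'I_m.+1) : 'I_m.+2 -> coord_event R :=
  ladder_cell (At z) j z (coord_in (IY `&` `]-oo, z]) z).

Lemma given_Y1_Z1E z :
  given_Y1_Z1 m IY z z = [seq given_cell z j | j <- enum 'I_m.+1].
Proof. by []. Qed.

Lemma measurable_given_cell z j : measurable_cell (given_cell z j).
Proof.
apply: measurable_ladder_cell => //.
rewrite /coord_in; case: ifP => //= _.
by apply: measurableI => //; exact: is_interval_measurable.
Qed.

Definition represents_given (z : R)
    (mu : {measure set (m.+2.-tuple R * R) -> \bar R}) : Prop :=
  forall G, measurable_fun setT G -> (forall p, 0 <= G p)%E ->
    joint_int k f (enum 'I_m.+1) (given_cell z) G = (\int[mu]_p G p)%E.

Lemma represents_givenP z : exists mu, represents_given z mu.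
Proof. by apply: joint_measureP => // j; exact: measurable_given_cell. Qed.

Section at_z.
Context (z : R) (mu : {measure set (m.+2.-tuple R * R) -> \bar R}).
Hypotheses (Iz : IY z) (Hmu : represents_given z mu).

Lemma given_mass : cells_mass f (given_Y1_Z1 m IY z z) = mu setT.
Proof. exact: cells_mass_measure Hmu. Qed.

Lemma given_mass_gt0 : (0 < mu setT)%E.
Proof. by have [/andP[+ _] _] := Hint_condX Iz Iz; rewrite given_mass. Qed.

Lemma given_mass_lty : (mu setT < +oo)%E.
Proof. by have [/andP[_ +] _] := Hint_condX Iz Iz; rewrite given_mass. Qed.

Lemma given_integrable (h : R -> R) : measurable_fun setT h ->
  (cells_num k f (given_Y1_Z1 m IY z z) (fun x => `|h x|%R) < +oo)%E ->
  mu.-integrable setT (fun p => (h p.2)%:E).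
Proof.
move=> mh oo.
by have [] := cells_num_measure mf f0 (measurable_given_cell z) Hmu mh oo.
Qed.

Lemma given_integrableX : mu.-integrable setT (fun p => p.2%:E).
Proof.
apply: (@given_integrable id); first exact: measurable_id.
by have [] := Hint_condX Iz Iz.
Qed.

Lemma given_integrable_u b : mu.-integrable setT (fun p => (u (p.2 - b))%:E).
Proof.
apply: (@given_integrable (fun x => u (x - b))).
  apply: (measurableT_comp (continuous_measurable_fun (utility_continuous Hu))).
  exact: measurable_funB.
by have [] := Hint_condu b Iz Iz.
Qed.

Lemma given_cells_num (h : R -> R) : measurable_fun setT h ->
  mu.-integrable setT (fun p => (h p.2)%:E) ->
  (cells_num k f (given_Y1_Z1 m IY z z) (fun x => `|h x|%R) < +oo)%E /\
  cells_num k f (given_Y1_Z1 m IY z z) h = (\int[mu]_p (h p.2)%:E)%E.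
Proof.
move=> mh ih.
have oo : (cells_num k f (given_Y1_Z1 m IY z z) (fun x => `|h x|%R) < +oo)%E.
  have -> : cells_num k f (given_Y1_Z1 m IY z z) (fun x => `|h x|%R) =
      joint_int k f (enum 'I_m.+1) (given_cell z) (abse \o (fun p => (h p.2)%:E)).
    by rewrite /cells_num given_Y1_Z1E big_map.
  rewrite Hmu.
  - by case/integrableP : ih.
  - by apply: measurableT_comp => //; exact: measurable_int ih.
  - by move=> p /=; rewrite lee_fin.
split=> //.
by have [] := cells_num_measure mf f0 (measurable_given_cell z) Hmu mh oo.
Qed.

Lemma given_cond_exp (h : R -> R) : measurable_fun setT h ->
  mu.-integrable setT (fun p => (h p.2)%:E) ->
  cond_exp k f (given_Y1_Z1 m IY z z) h =
  (\int[mu]_p h p.2) / fine (mu setT).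
Proof.
by move=> mh ih; rewrite /cond_exp (given_cells_num mh ih).2 given_mass.
Qed.

Section contract_bid.
Context (phi : R -> R).
Hypothesis Hphi : contract phi.

Definition net_utility (w : R) : R := u (w - phi w).

Lemma contract_continuousB : continuous (fun w => w - phi w).
Proof.
have [_ _ _ cphi] := Hphi.
by move=> w; apply: continuousB; [exact: cvg_id|exact: cphi].
Qed.

Lemma net_utility_continuous : continuous net_utility.
Proof.
move=> w; apply: continuous_comp; first exact: contract_continuousB.
exact: utility_continuous.
Qed.

Lemma net_utility_increasing : increasing net_utility.
Proof.
have [_ incr _ _] := Hphi; have [_ u_incr _] := Hu.
by move=> x y xy; apply: u_incr; exact: incr.
Qed.

Lemma net_utility0 : net_utility 0 = 0.
Proof.
have [_ _ phi0 _] := Hphi; have [_ _ u0] := Hu.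
by rewrite /net_utility phi0 subr0 u0.
Qed.

Lemma measurable_net_utility b : measurable_fun setT (fun x : R => net_utility (x - b)).
Proof.
apply: (measurableT_comp (continuous_measurable_fun net_utility_continuous)).
exact: measurable_funB.
Qed.

Lemma given_integrable_net b :
  mu.-integrable setT (fun p => (net_utility (p.2 - b))%:E).
Proof.
apply: (le_integrable measurableT _ _ (given_integrable_u b)).
  apply/measurable_EFinP; exact: (measurableT_comp (measurable_net_utility b)).
by move=> p _; rewrite lee_fin; exact: (utility_contract_norm_le Hphi _ Hu).
Qed.

(** The conditional expectation divides by a positive finite mass, so it vanishes with the integral;
    as a root exists, [xget] returns one rather than its default. *)
Lemma bid_root : \int[mu]_p net_utility (p.2 - bid k f IY u phi z z) = 0.
Proof.
have mu_fin : fine (mu setT) != 0.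
  by rewrite gt_eqF// fine_gt0// given_mass_gt0 given_mass_lty.
have Fbid b : cond_exp k f (given_Y1_Z1 m IY z z)
    (fun x => u (x - b - phi (x - b))) = 0 <->
    \int[mu]_p net_utility (p.2 - b) = 0.
  rewrite (given_cond_exp (measurable_net_utility b) (given_integrable_net b)).
  split=> [/eqP|->]; last by rewrite mul0r.
  by rewrite mulf_eq0 invr_eq0 (negbTE mu_fin) orbF => /eqP.
rewrite /bid; set S := [set b | _].
have [b Fb] := expectation_root measurable_snd given_mass_gt0 given_mass_lty
  net_utility_increasing net_utility_continuous net_utility0 given_integrable_net.
have Sb : S b by exact/Fbid.
by apply/Fbid; exact: (xgetPex 0 (ex_intro _ b Sb)).
Qed.

(** Expected net utility is strictly decreasing in the bid and vanishes at the equilibrium bid. This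
    turns statements on [bid] into signs of cell integrals: measurability in [z], and positivity at
    b = 0. *)
Lemma bid_gt b : b < bid k f IY u phi z z <->
  (0 < cells_num k f (given_Y1_Z1 m IY z z) (fun x => net_utility (x - b)))%E.
Proof.
rewrite (given_cells_num (measurable_net_utility b) (given_integrable_net b)).2.
have -> : (0 < \int[mu]_p (net_utility (p.2 - b))%:E)%E =
    (0 < \int[mu]_p net_utility (p.2 - b)).
  rewrite -[X in (_ < X)%E]fineK ?lte_fin//.
  exact: (integrable_fin_num measurableT (given_integrable_net b)).
have decr := expectation_decreasing given_mass_gt0 net_utility_increasing
  given_integrable_net.
rewrite -bid_root; split=> [|]; first exact: decr.
move=> lt; rewrite ltNge; apply/negP; rewrite le_eqVlt => /predU1P[E|/decr].
  by move: lt; rewrite E ltxx.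
by move=> /(lt_trans lt); rewrite ltxx.
Qed.

End contract_bid.
End at_z.
End given.

Lemma measurable_le_set d (T : measurableType d) (R : realType) (f g : T -> R) :
  measurable_fun setT f -> measurable_fun setT g ->
  measurable [set w | f w <= g w].
Proof.
move=> mf mg.
have -> : [set w | f w <= g w] = (g \- f) @^-1` `[0, +oo[.
  by apply/seteqP; split => w; rewrite /= in_itv/= andbT subr_ge0.
rewrite -[X in measurable X]setTI; exact: measurable_funB.
Qed.

Lemma measurable_lt_set d (T : measurableType d) (R : realType) (f g : T -> R) :
  measurable_fun setT f -> measurable_fun setT g ->
  measurable [set w | f w < g w].
Proof.
move=> mf mg.
have -> : [set w | f w < g w] = ~` [set w | g w <= f w].
  by apply/seteqP; split => w /=; rewrite ltNge => /negP.
exact/measurableC/measurable_le_set.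
Qed.

Section diagonal.
Context (R : realType) (m : nat) (k : R.-pker (m.+2.-tuple R) ~> R)
  (f : m.+2.-tuple R -> R) (IY : set R) (u : R -> R).
Hypotheses (mf : measurable_fun setT f) (f0 : forall y, 0 <= f y)
  (HIY : is_interval IY) (Hu : weakly_risk_averse u)
  (Hint_condX : forall y1 z1 : R, IY y1 -> IY z1 ->
     cond_exists k f (given_Y1_Z1 m IY y1 z1) (fun x => x))
  (Hint_condu : forall y1 z1 b : R, IY y1 -> IY z1 ->
     cond_exists k f (given_Y1_Z1 m IY y1 z1) (fun x => u (x - b))).

(** Points with room on both sides: the range below [z] does not collapse to a point there, and
    boxes with end points in [IY] fit around [z]. Only end points of [IY] are left out, which
    signals hit with probability zero. *)
Definition inner : set R := [set z | exists a b, [/\ IY a, IY b & a < z < b]].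

Lemma inner_sub : inner `<=` IY.
Proof.
by move=> z [a [b [Ia Ib /andP[az zb]]]]; apply: (HIY Ia Ib); rewrite !ltW.
Qed.

Lemma measurable_inner : measurable inner.
Proof.
apply: is_interval_measurable => s t [a [_ [Ia _ /andP[sa _]]]].
move=> [_ [b [_ Ib /andP[_ tb]]]] r /andP[sr rt].
by exists a, b; split => //; rewrite (lt_le_trans sa)//= (le_lt_trans rt).
Qed.

Lemma given_cell_inner z (j : 'I_m.+1) : inner z ->
  given_cell IY z j = ladder_cell (At z) j z (below IY z).
Proof.
move=> [a [b [Ia Ib /andP[az zb]]]]; rewrite /given_cell (@coord_in_set _ _ _ a)//.
  by split => //=; rewrite in_itv/= ltW.
by rewrite lt_eqF.
Qed.

(** The bound |phi w| <= |w| dominates the payment by 2 |b| + |x|. *)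
Lemma contract_payment_integrable (phi : R -> R) (b : R)
    (mu : {measure set (m.+2.-tuple R * R) -> \bar R}) : contract phi ->
  (mu setT < +oo)%E -> mu.-integrable setT (fun p => p.2%:E) ->
  mu.-integrable setT (fun p => (b + phi (p.2 - b))%:E).
Proof.
move=> Hphi muoo ix; have [_ _ _ cphi] := Hphi.
have mpay : measurable_fun setT (fun p : m.+2.-tuple R * R => b + phi (p.2 - b)).
  apply: measurable_funD => //.
  apply: (measurableT_comp (continuous_measurable_fun cphi)).
  exact: measurable_funB.
have ig : mu.-integrable setT (fun p => ((`|b| + `|b|)%:E + `|p.2%:E|)%E).
  apply: (integrableD measurableT); last exact: integrable_abse ix.
  exact: integrable_cst_fin.
apply: (le_integrable measurableT _ _ ig); first exact/measurable_EFinP.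
move=> p _; rewrite -EFinD lee_fin [leRHS]ger0_norm ?addr_ge0//.
rewrite -addrA (le_trans (ler_normD _ _))// lerD2l.
by rewrite (le_trans (contract_norm_le Hphi _))// addrC ler_normB.
Qed.

Lemma given_comparison (phi1 phi2 : R -> R) z :
  contract phi1 -> contract phi2 -> inner z ->
  let s1 := bid k f IY u phi1 z z in let s2 := bid k f IY u phi2 z z in
  {homo (fun x => s2 + phi2 (x - s2) - (s1 + phi1 (x - s1))) : x y / x <= y} ->
  exists j (mu : {measure set (m.+2.-tuple R * R) -> \bar R}),
    [/\ represents k f (ladder_cell (At z) j z (below IY z)) mu,
        (mu setT < +oo)%E, mu.-integrable setT (fun p => p.2%:E) &
        0 <= \int[mu]_p (s2 + phi2 (p.2 - s2) - (s1 + phi1 (p.2 - s1)))].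
Proof.
move=> H1 H2 Jz s1 s2 Hmono; have Iz := inner_sub Jz.
pose H x := s2 + phi2 (x - s2) - (s1 + phi1 (x - s1)).
have [M HM] := represents_givenP k mf f0 HIY z.
have /choice[M_ HM_] : forall j, exists mu, represents k f (given_cell IY z j) mu.
  move=> j; apply: joint_measureP => // _; exact: measurable_given_cell.
have Moo := given_mass_lty Hint_condX Iz HM.
have M0 := given_mass_gt0 Hint_condX Iz HM.
have Mx := given_integrableX mf f0 HIY Hint_condX Iz HM.
(* Each cell is one summand of the mixture, so finiteness and integrability assumed for the mixture
   pass to the cells. *)
have M_le j G : measurable_fun setT G -> (forall p, 0 <= G p)%E ->
    (\int[M_ j]_p G p <= \int[M]_p G p)%E.
  move=> mG G0; rewrite -HM// -HM_// /joint_int big_seq1 big_enum [leRHS](bigD1 j)//.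
  rewrite leeDl// sume_ge0// => i _; apply: cell_int_ge0 => y.
  exact: joint_slice_ge0.
have M_oo j : (M_ j setT < +oo)%E.
  rewrite (le_lt_trans _ Moo)// -[leLHS]mul1e -[leRHS]mul1e.
  by rewrite -!integral_cst//; exact: M_le.
have M_x j : (M_ j).-integrable setT (fun p => p.2%:E).
  apply/integrableP; split; first exact: measurable_int Mx.
  apply: (le_lt_trans (M_le _ _ _ _)).
  - by apply: measurableT_comp => //; exact: measurable_int Mx.
  - by move=> p; exact: abse_ge0.
  - by case/integrableP : Mx.
have iH (mu : {measure set (m.+2.-tuple R * R) -> \bar R}) :
    (mu setT < +oo)%E -> mu.-integrable setT (fun p => p.2%:E) ->
    mu.-integrable setT (fun p : m.+2.-tuple R * R => (H p.2)%:E).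
  move=> muoo mux; rewrite /H; exact: (integrableB measurableT
    (contract_payment_integrable s2 H2 muoo mux)
    (contract_payment_integrable s1 H1 muoo mux)).
have mH : measurable_fun setT H by exact: nondecreasing_measurable.
have H_ge0 : 0 <= \int[M]_p H p.2.
  have r1 := bid_root mf f0 HIY Hu Hint_condX Hint_condu Iz HM H1.
  have r2 := bid_root mf f0 HIY Hu Hint_condX Hint_condu Iz HM H2.
  have i1 := given_integrable_net mf f0 HIY Hu Hint_condu Iz HM H1 s1.
  have i2 := given_integrable_net mf f0 HIY Hu Hint_condu Iz HM H2 s2.
  (* The net payoff of the winner. The value cancels in the difference of two payoffs, which leaves
     the difference [H] of the payments with the opposite order of contracts. *)
  pose p_ phi s (x : R) := x - s - phi (x - s).
  have pmono phi s : contract phi -> {homo p_ phi s : x y / x <= y}.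
    by move=> [_ /increasing_le incr _ _] x y xy; apply: incr; rewrite lerD2r.
  have pc phi s : contract phi -> continuous (p_ phi s).
    move=> Hphi x; apply: (@continuous_comp _ _ _ (fun x => x - s) (fun w => w - phi w)).
      by apply: continuousB; [exact: cvg_id|exact: cst_continuous].
    exact: contract_continuousB.
  have HE x : H x = p_ phi1 s1 x - p_ phi2 s2 x by rewrite /H /p_; ring.
  rewrite (_ : (fun p => H p.2) = fun p : m.+2.-tuple R * R =>
    p_ phi1 s1 p.2 - p_ phi2 s2 p.2); last by apply/funext => p; rewrite HE.
  apply: (expected_utility_comparison M0 Hu (pmono _ s1 H1) (pmono _ s2 H2)
    (pc _ s1 H1) (pc _ s2 H2) _ i1 i2).
  - by move=> x y xy; have := Hmono _ _ xy; rewrite -/(H x) -/(H y) !HE.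
  - rewrite (_ : (fun p => _) = fun p : m.+2.-tuple R * R => (H p.2)%:E).
      exact: iH.
    by apply/funext => p; rewrite HE.
  - by rewrite [LHS]r1 [RHS]r2.
have {}H_ge0 : (0 <= \int[M]_p (H p.2)%:E)%E.
  rewrite -[leRHS]fineK ?lee_fin//.
  exact: (integrable_fin_num measurableT (iH _ Moo Mx)).
have sumE : (\int[M]_p (H p.2)%:E = \sum_(j < m.+1) \int[M_ j]_p (H p.2)%:E)%E.
  rewrite -(given_cells_num mf f0 HIY HM mH (iH _ Moo Mx)).2.
  rewrite /cells_num given_Y1_Z1E big_map big_enum; apply: eq_bigr => j _.
  have mc (i : unit) : measurable_cell (given_cell IY z j).
    exact: measurable_given_cell.
  have cc i : sub_event (given_cell IY z j i) (given_cell IY z j i).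
    by case: (given_cell _ _ _ _) => [p|A]; [|exact: subset_refl].
  have [_] := cells_num_sub mf f0 (HM_ j) (mc tt) cc mH (iH _ (M_oo j) (M_x j)).
  rewrite (integral_cell_cyl mf f0 (mc tt) (HM_ j) mH (iH _ (M_oo j) (M_x j))).
  by rewrite /cells_num big_seq1.
have [j Hj] : exists j, (0 <= \int[M_ j]_p (H p.2)%:E)%E.
  apply: contrapT => nH; have ltj j : (\int[M_ j]_p (H p.2)%:E < 0)%E.
    by rewrite ltNge; apply/negP => ?; apply: nH; exists j.
  move: H_ge0; rewrite sumE leNgt => /negP; apply.
  rewrite big_ord_recl; apply: (@le_lt_trans _ _ (\int[M_ ord0]_p (H p.2)%:E)%E) => //.
  by rewrite geeDl// sume_le0// => i _; exact: ltW.
exists j, (M_ j); split => //.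
  by rewrite -given_cell_inner.
exact: fine_ge0.
Qed.

Lemma measurable_kernel_num (h : R -> R) : measurable_fun setT h ->
  measurable_fun setT (fun y => ((\int[k y]_x (h x)%:E) * (f y)%:E)%E).
Proof.
move=> mh; apply: emeasurable_funM; last exact/measurable_EFinP.
have mhE : measurable_fun setT (EFin \o h) by exact/measurable_EFinP.
under eq_fun do rewrite integralE.
by apply: emeasurable_funB; apply: measurable_fun_integral_kernel => //;
  do ?[exact: measurable_kernel|exact: measurable_funepos|exact: measurable_funeneg].
Qed.

Lemma measurable_events_below : measurable_events (below IY).
Proof.
right; exists ((snd @^-1` IY) `&` [set zt : R * R | zt.2 <= zt.1]).
  apply: measurableI.
    rewrite -[X in measurable X]setTI; apply: measurable_snd => //.
    exact: is_interval_measurable.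
  exact: measurable_le_set.
move=> z; rewrite /below; congr In; apply/seteqP.
by split => t; rewrite /xsection/= inE/= in_itv.
Qed.

Lemma measurable_events_above : measurable_events (above IY).
Proof.
right; exists ((snd @^-1` IY) `&` [set zt : R * R | zt.1 <= zt.2]).
  apply: measurableI.
    rewrite -[X in measurable X]setTI; apply: measurable_snd => //.
    exact: is_interval_measurable.
  exact: measurable_le_set.
move=> z; rewrite /above; congr In; apply/seteqP.
by split => t; rewrite /xsection/= inE/= in_itv/= andbT.
Qed.

(** By [bid_gt], the set where the bid exceeds b is the set where the numerator [F] is positive, and
    [F] is an integral over cells that move measurably with z. *)
Lemma measurable_bid (phi : R -> R) : contract phi ->
  measurable_fun inner (fun z => bid k f IY u phi z z).
Proof.
move=> Hphi mJ; apply: (measurability (@RGenOInfty.G R)) => //.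
  exact: RGenOInfty.measurableE.
move=> _ [_ [b ->] <-].
pose F z := (\sum_(j < m.+1) cell_int (ladder_cell (At z) j z (below IY z))
  (fun y => (\int[k y]_x (net_utility u phi (x - b))%:E) * (f y)%:E))%E.
have mF : measurable_fun setT F.
  apply: emeasurable_sum => j.
  apply: (@measurable_cell_int R _ _ R
    (fun z => ladder_cell (At z) j z (below IY z))
    (fun zy => (\int[k zy.2]_x (net_utility u phi (x - b))%:E) * (f zy.2)%:E)%E).
    move=> i; rewrite /ladder_cell; case: (i == ord0); first by left; exists id.
    case: (i == lift ord0 j); first by left; exists id.
    exact: measurable_events_below.
  apply: (measurableT_comp (measurable_kernel_num _)) => //.
  exact: measurable_net_utility.
rewrite (_ : _ `&` _ = inner `&` F @^-1` `]0%E, +oo[).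
  apply: measurableI => //; rewrite -[X in measurable X]setTI.
  by apply: mF => //; exact: emeasurable_itv.
have FE z : inner z -> F z = cells_num k f (given_Y1_Z1 m IY z z)
    (fun x => net_utility u phi (x - b)).
  move=> Jz; rewrite /F /cells_num given_Y1_Z1E big_map big_enum.
  by apply: eq_bigr => j _; rewrite given_cell_inner.
have FP z : inner z -> b < bid k f IY u phi z z <-> (0 < F z)%E.
  move=> Jz; rewrite FE//; have [M HM] := represents_givenP k mf f0 HIY z.
  exact: (bid_gt mf f0 HIY Hu Hint_condX Hint_condu (inner_sub Jz) HM Hphi).
apply/seteqP; split => z [Jz] /=; rewrite !in_itv/= !andbT.
  by move=> /(FP _ Jz) ?; split.
by move=> /(FP _ Jz) ?; split.
Qed.

End diagonal.

(** * Disintegration of the law of the signals *)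

Section kernel_snd.
Context d d1 d2 (Z : measurableType d) (T1 : measurableType d1)
  (T2 : measurableType d2) (R : realType) (k : R.-pker T1 ~> T2).

(** The kernel made blind to an extra parameter, so that integrands which depend on that parameter
    are covered by the measurability of kernel integrals. *)
Definition kernel_snd (p : Z * T1) : {measure set T2 -> \bar R} := k p.2.

Let measurable_kernel_snd U : measurable U ->
  measurable_fun setT (kernel_snd ^~ U).
Proof.
by move=> mU; apply: (measurableT_comp (measurable_kernel k U mU)).
Qed.

HB.instance Definition _ := isKernel.Build _ _ _ _ _ kernel_snd
  measurable_kernel_snd.

Let kernel_snd_prob p : kernel_snd p [set: T2] = 1%E.
Proof. exact: prob_kernel. Qed.

HB.instance Definition _ := Kernel_isProbability.Build _ _ _ _ _
  kernel_snd kernel_snd_prob.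

Lemma measurable_kernel_integral (G : Z * T2 -> \bar R) :
  measurable_fun setT G -> (forall p, 0 <= G p)%E ->
  measurable_fun setT (fun p : Z * T1 => \int[k p.2]_x G (p.1, x))%E.
Proof.
move=> mG G0.
apply: (measurable_fun_integral_finite_kernel
  (fun q : (Z * T1) * T2 => G (q.1.1, q.2)) kernel_snd) => //.
apply: (measurableT_comp mG); apply: measurable_fun_pair => //.
exact: measurableT_comp.
Qed.

End kernel_snd.

(** * Laws determined by their distribution functions *)

Section orthants.
Context (R : realType) (n : nat).

Definition orthant (v : 'I_n -> R) (a : R) : set (n.-tuple R * R) :=
  [set p | (forall i, tnth p.1 i <= v i) /\ p.2 <= a].

Definition orthants : set (set (n.-tuple R * R)) :=
  [set A | exists v a, A = orthant v a].

Lemma measurable_orthant v a : measurable (orthant v a).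
Proof.
have -> : orthant v a =
    (\bigcap_(i in [set: 'I_n]) [set p | tnth p.1 i <= v i]) `&` [set p | p.2 <= a].
  apply/seteqP; split => p [h1 h2]; split => // i; first by move=> _; exact: h1.
  exact: (h1 i Logic.I).
apply: measurableI; last exact: measurable_le_set.
apply: fin_bigcap_measurable => // i _; apply: measurable_le_set => //.
by apply: (measurableT_comp (measurable_tnth i)).
Qed.

Lemma orthant_cover (p : n.-tuple R * R) :
  exists r, (forall i, tnth p.1 i <= r%:R) /\ p.2 <= r%:R.
Proof.
pose s : R := \sum_i `|tnth p.1 i| + `|p.2|.
have s_ge0 : 0 <= s by rewrite addr_ge0// sumr_ge0.
have s_lt : s <= (Num.bound s)%:R by rewrite ltW// archi_boundP.
exists (Num.bound s); split=> [i|]; apply: le_trans s_lt; rewrite /s; last first.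
  by rewrite (le_trans (ler_norm _))// lerDr sumr_ge0.
rewrite (bigD1 i)//= -addrA (le_trans (ler_norm _))// lerDl addr_ge0//.
by rewrite sumr_ge0.
Qed.

Lemma measurable_orthants : measurable = <<s orthants >>.
Proof.
apply/seteqP; split; last first.
  apply: smallest_sub; first exact: sigma_algebra_measurable.
  by move=> _ [v [a ->]]; exact: measurable_orthant.
pose O := g_sigma_algebraType orthants.
have mO v a : measurable (orthant v a : set O).
  by apply: sub_sigma_algebra; exists v, a.
have mle (g : O -> R) : (forall a, measurable [set p : O | g p <= a]) ->
    measurable_fun setT g.
  move=> mg; apply: (measurability (@RGenOInfty.G R)).
    exact: RGenOInfty.measurableE.
  move=> _ [_ [a ->] <-]; rewrite setTI.
  rewrite (_ : g @^-1` _ = ~` [set p | g p <= a]); first exact/measurableC.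
  by apply/seteqP; split => p /=; rewrite in_itv/= andbT ltNge => /negP.
have m1 i : measurable_fun setT (fun p : O => tnth p.1 i).
  apply: mle => a.
  (* A half-space is a countable union of orthants whose other bounds grow, so the coordinates are
     measurable for the generated algebra; hence so is the identity. *)
  have -> : [set p : O | tnth p.1 i <= a] =
      \bigcup_r orthant (fun l => if l == i then a else r%:R) r%:R.
    apply/seteqP; split => p /=.
      move=> pa; have [r Hr] := orthant_cover p; exists r => //; split => [l|].
        by case: eqVneq => [->//|_]; exact: Hr.1.
      exact: Hr.2.
    by move=> [r _ [/(_ i)]]; rewrite eqxx.
  exact: bigcupT_measurable.
have m2 : measurable_fun setT (fun p : O => p.2).
  apply: mle => a.
  have -> : [set p : O | p.2 <= a] = \bigcup_r orthant (fun=> r%:R) a.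
    apply/seteqP; split => p /=; last by move=> [r _ []].
    move=> pa; have [r Hr] := orthant_cover p; exists r => //; split => // l.
    exact: Hr.1.
  exact: bigcupT_measurable.
move=> D mD.
have : measurable_fun [set: O] (fun p : O => (p.1, p.2) : n.-tuple R * R).
  apply: measurable_fun_pair => //; apply/measurable_fun_tnthP => i; exact: m1.
move=> /(_ measurableT D mD); rewrite setTI.
by rewrite (_ : _ @^-1` D = D)//; apply/seteqP; split => -[p1 p2].
Qed.

(** Orthants generate, are stable under intersection through componentwise minima, and exhaust the
    space. *)
Lemma orthant_measure_unique (m1 m2 : {measure set (n.-tuple R * R) -> \bar R}) :
  (m1 setT < +oo)%E -> (forall v a, m1 (orthant v a) = m2 (orthant v a)) ->
  forall D, measurable D -> m1 D = m2 D.
Proof.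
move=> m1oo m12 D mD.
apply: (measure_unique orthants (fun r => orthant (fun=> r%:R) r%:R)) => //.
- exact: measurable_orthants.
- move=> _ _ [v [a ->]] [v' [a' ->]].
  exists (fun i => Num.min (v i) (v' i)), (Num.min a a').
  apply/seteqP; split => p /=; rewrite /orthant/= le_min.
    by move=> [[h1 h2] [h3 h4]]; split; [move=> i; rewrite le_min h1 h3|rewrite h2 h4].
  move=> [h1 /andP[h2 h3]]; split; split => // i.
    by have := h1 i; rewrite le_min => /andP[].
  by have := h1 i; rewrite le_min => /andP[].
- by move=> r; exists (fun=> r%:R), r%:R.
- by apply/seteqP; split => // p _; have [r Hr] := orthant_cover p; exists r.
- by move=> _ [v [a ->]].
- move=> r; apply: le_lt_trans m1oo; apply: le_measure; rewrite ?inE//.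
  exact: measurable_orthant.
Qed.

End orthants.

Section cell_int_support.
Context (R : realType).
Local Open Scope ereal_scope.
Local Notation leb := (@lebesgue_measure R).

Lemma eq_cell_int_on n (c : 'I_n -> coord_event R) (g h : n.-tuple R -> \bar R) :
  (forall y, cell_set c y -> g y = h y) -> cell_int c g = cell_int c h.
Proof.
move=> gh.
have cc i : sub_event (c i) (c i) by case: (c i) => [p|A]; [|exact: subset_refl].
rewrite (cell_int_sub g cc) (cell_int_sub h cc); apply: eq_cell_int => y.
by rewrite !patchE; case: ifPn => // /set_mem /gh.
Qed.

Lemma cell_int_disintegrate n (c : 'I_n -> coord_event R) i (A : set R)
    (g : n.-tuple R -> \bar R) :
  c i = In A -> measurable_cell c -> measurable_fun setT g ->
  (forall y, 0 <= g y) ->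
  cell_int c g = \int[leb]_(t in A) cell_int (set_coord c i (At t)) g.
Proof. by move=> ci mc mg g0; rewrite (cell_int_exchange i mc mg g0) ci. Qed.

Lemma integral_null_support (N : set R) (g : R -> \bar R) :
  measurable N -> leb N = 0 -> measurable_fun setT g -> (forall t, 0 <= g t) ->
  (forall t, ~ N t -> g t = 0) -> \int[leb]_t g t = 0.
Proof.
move=> mN N0 mg g0 gN.
rewrite (@ge0_negligible_integral _ _ _ leb setT N)//.
by apply: integral0_eq => t [_ /gN].
Qed.

End cell_int_support.

(** * Null events for the signals *)

Section auction.
Context (R : realType) (m : nat) (d : measure_display) (T : measurableType d)
  (P : probability T R) (X Y : 'I_m.+2 -> {RV P >-> R}) (IY : set R)
  (f : m.+2.-tuple R -> R) (k : R.-pker (m.+2.-tuple R) ~> R).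
Hypotheses (HY : forall n w, IY (Y n w)) (Hf : is_density P (signals Y) f)
  (Hk : is_cond_law P (X ord0) (signals Y) k).
Local Notation leb := (@lebesgue_measure R).
Local Notation allc := (fun _ : 'I_m.+2 => @In R setT).

Let mf : measurable_fun setT f. Proof. by case: Hf. Qed.
Let f0 y : 0 <= f y. Proof. by case: Hf. Qed.

Lemma tnth_signals i w : tnth (signals Y w) i = Y i w.
Proof. by rewrite tnth_mktuple. Qed.

Lemma measurable_signals : measurable_fun setT (signals Y).
Proof.
apply/measurable_fun_tnthP => i.
rewrite (_ : _ \o _ = Y i); first exact: measurable_funPT.
by apply/funext => w /=; rewrite tnth_signals.
Qed.

Lemma auction_law (G : m.+2.-tuple R * R -> \bar R) : measurable_fun setT G ->
  (forall p, 0 <= G p)%E ->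
  (\int[P]_w G (signals Y w, X ord0 w) = cell_int allc (joint_slice k f G))%E.
Proof.
move=> mG G0.
rewrite (integral_joint_law mf f0 (measurable_funPT (X ord0)) measurable_signals Hf Hk)//.
by rewrite /joint_int big_seq1.
Qed.

Lemma measurable_allc : measurable_cell allc.
Proof. by move=> i /=. Qed.

Lemma measurable_coord_integral (g : m.+2.-tuple R -> \bar R) i
    (c : 'I_m.+2 -> coord_event R) : measurable_cell c ->
  measurable_fun setT g ->
  measurable_fun setT (fun t => cell_int (set_coord c i (At t)) g).
Proof.
move=> mc mg.
apply: (@measurable_cell_int R _ _ R (fun t => set_coord c i (At t))
  (fun ty => g ty.2)); last exact: measurableT_comp.
move=> l; rewrite /set_coord; case: (l == i); first by left; exists id.
exact: measurable_events_cst.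
Qed.

Lemma signals_null (B : set (m.+2.-tuple R)) : measurable B ->
  (forall g : m.+2.-tuple R -> \bar R, measurable_fun setT g ->
    (forall y, 0 <= g y)%E -> (forall y, ~ B y -> g y = 0%E) ->
    cell_int allc g = 0%E) ->
  P [set w | B (signals Y w)] = 0%E.
Proof.
move=> mB B0.
have mYB : measurable [set w | B (signals Y w)].
  by rewrite -[X in measurable X]setTI; exact: measurable_signals.
rewrite measure_integral_indic//.
have mG : measurable_fun setT
    (fun p : m.+2.-tuple R * R => (\1_B p.1)%:E : \bar R).
  exact: (measurableT_comp (measurable_Eindic mB)).
have G0 (p : m.+2.-tuple R * R) : (0 <= (\1_B p.1 : R)%:E)%E by rewrite lee_fin.
transitivity (\int[P]_w (\1_B (signals Y w))%:E)%E => //.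
rewrite (auction_law mG)//; apply: B0.
- exact: measurable_joint_slice.
- by move=> y; exact: joint_slice_ge0.
- move=> y nBy; rewrite /joint_slice integral0_eq ?mul0e// => x _.
  by rewrite indicE memNset.
Qed.

Lemma signals_tie i j : i != j -> P [set w | Y i w = Y j w] = 0%E.
Proof.
move=> ij.
have -> : [set w | Y i w = Y j w] =
    [set w | [set y : m.+2.-tuple R | tnth y i = tnth y j] (signals Y w)].
  by apply/seteqP; split => w /=; rewrite !tnth_signals.
apply: signals_null => [|g mg g0 gB].
  have -> : [set y : m.+2.-tuple R | tnth y i = tnth y j] =
      [set y | tnth y i <= tnth y j] `&` [set y | tnth y j <= tnth y i].
    apply/seteqP; split => y /=; first by move=> ->; rewrite lexx.
    by move=> [h1 h2]; apply/eqP; rewrite eq_le h1.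
  by apply: measurableI; apply: measurable_le_set; exact: measurable_tnth.
rewrite (@cell_int_disintegrate _ _ allc i setT g erefl measurable_allc mg g0).
apply: integral0_eq => t _.
have mc : measurable_cell (set_coord allc i (At t)).
  by apply: measurable_set_coord => //; exact: measurable_allc.
have cj : set_coord allc i (At t) j = In setT.
  by rewrite /set_coord eq_sym (negbTE ij).
rewrite (cell_int_disintegrate cj mc mg g0).
(* With coordinate i fixed at t, a tie leaves a single point for coordinate j. *)
apply: (@integral_null_support _ [set t]) => //.
- exact: lebesgue_measure_set1.
- exact: (measurable_coord_integral j mc mg).
- by move=> s; exact: cell_int_ge0.
- move=> s st; rewrite (eq_cell_int_on (h := cst 0%E)) ?cell_int0// => y cy.
  apply: gB => yij; apply: st.
  have := cy i; have := cy j; rewrite /set_coord eqxx/= (negbTE ij) eqxx/=.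
  by move=> <- <-.
Qed.

Lemma signal_null i (N : set R) : measurable N -> leb N = 0%E ->
  P [set w | N (Y i w)] = 0%E.
Proof.
move=> mN N0.
have -> : [set w | N (Y i w)] =
    [set w | [set y : m.+2.-tuple R | N (tnth y i)] (signals Y w)].
  by apply/seteqP; split => w /=; rewrite tnth_signals.
apply: signals_null => [|g mg g0 gB].
  by rewrite -[X in measurable X]setTI; exact: measurable_tnth.
rewrite (@cell_int_disintegrate _ _ allc i setT g erefl measurable_allc mg g0).
apply: (integral_null_support mN N0).
- exact: (measurable_coord_integral i measurable_allc mg).
- by move=> s; exact: cell_int_ge0.
- move=> s st; rewrite (eq_cell_int_on (h := cst 0%E)) ?cell_int0// => y cy.
  apply: gB => /= yi; apply: st; move: yi.
  by have := cy i; rewrite /set_coord eqxx/= => ->.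
Qed.

Lemma leb_subsingleton (A : set R) : (forall s t, A s -> A t -> s <= t) ->
  measurable A /\ leb A = 0%E.
Proof.
move=> HA; have [[s As]|nA] := pselect (exists s, A s).
  have -> : A = [set s].
    apply/seteqP; split => t /=; last by move=> ->.
    by move=> At; apply/eqP; rewrite eq_le !HA.
  by split; [exact: measurable_set1|exact: lebesgue_measure_set1].
have -> : A = set0 by apply/seteqP; split => // t At; apply: nA; exists t.
by split; [exact: measurable0|exact: measure0].
Qed.

Lemma signal_inner i : P [set w | ~ inner IY (Y i w)] = 0%E.
Proof.
(* A point of [IY] that is not inner is a least or a greatest element, and there is at most one of
   each. *)
have [mA1 A10] := @leb_subsingleton [set t | IY t /\ forall s, IY s -> t <= s]
  ltac:(by move=> s t [_ sl] [It _]; exact: sl).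
have [mA2 A20] := @leb_subsingleton [set t | IY t /\ forall s, IY s -> s <= t]
  ltac:(by move=> s t [Is _] [_ tl]; exact: tl).
have -> : [set w | ~ inner IY (Y i w)] =
    [set w | [set t | IY t /\ forall s, IY s -> t <= s] (Y i w)] `|`
    [set w | [set t | IY t /\ forall s, IY s -> s <= t] (Y i w)].
  apply/seteqP; split => w /=.
    move=> ninn; apply: contrapT => /not_orP[n1 n2]; apply: ninn.
    have Iw := HY i w.
    have [a Ia aw] : exists2 a, IY a & a < Y i w.
      apply: contrapT => H; apply: n1; split => // s Is.
      by rewrite leNgt; apply/negP => ?; apply: H; exists s.
    have [b Ib bw] : exists2 b, IY b & Y i w < b.
      apply: contrapT => H; apply: n2; split => // s Is.
      by rewrite leNgt; apply/negP => ?; apply: H; exists s.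
    by exists a, b; rewrite aw bw.
  move=> [] [Iw H] [a [b [Ia Ib /andP[aw wb]]]].
    by have := H _ Ia; rewrite leNgt aw.
  by have := H _ Ib; rewrite leNgt wb.
have mYA A : measurable A -> measurable [set w | A (Y i w)].
  by move=> mA; rewrite -[X in measurable X]setTI; exact: measurable_funPT.
rewrite null_set_setU//; try exact: (signal_null i mA1 A10).
- exact: (mYA _ mA1).
- exact: (mYA _ mA2).
- exact: (signal_null i mA2 A20).
Qed.

End auction.

(** * Exchangeability of the other buyers *)

Section symmetry.
Context (R : realType) (m : nat) (d : measure_display) (T : measurableType d)
  (P : probability T R) (X Y : 'I_m.+2 -> {RV P >-> R}) (IY : set R)
  (f : m.+2.-tuple R -> R) (k : R.-pker (m.+2.-tuple R) ~> R).
Hypotheses (Hsym : symmetric_law X Y) (HIY : is_interval IY)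
  (Hf : is_density P (signals Y) f)
  (Hk : is_cond_law P (X ord0) (signals Y) k).
Local Notation leb := (@lebesgue_measure R).
Local Notation allc := (fun _ : 'I_m.+2 => @In R setT).

Let mf : measurable_fun setT f. Proof. by case: Hf. Qed.
Let f0 y : 0 <= f y. Proof. by case: Hf. Qed.

Definition permute_others (s : 'S_m.+1) (y : m.+2.-tuple R) : m.+2.-tuple R :=
  [tuple if unlift ord0 i is Some l then tnth y (lift ord0 (s l))
         else tnth y ord0 | i < m.+2].

Lemma permute_others0 s y : tnth (permute_others s y) ord0 = tnth y ord0.
Proof. by rewrite tnth_mktuple unlift_none. Qed.

Lemma permute_othersS s y l :
  tnth (permute_others s y) (lift ord0 l) = tnth y (lift ord0 (s l)).
Proof. by rewrite tnth_mktuple liftK. Qed.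

Lemma measurable_permute_others s : measurable_fun setT (permute_others s).
Proof.
apply/measurable_fun_tnthP => i.
case: (unliftP ord0 i) => [l|] ->.
  rewrite (_ : _ \o _ = (fun y => tnth y (lift ord0 (s l)))).
    exact: measurable_tnth.
  by apply/funext => y /=; rewrite permute_othersS.
rewrite (_ : _ \o _ = (fun y => tnth y ord0)); first exact: measurable_tnth.
by apply/funext => y /=; rewrite permute_others0.
Qed.

Lemma orthant_joint_cdf (v : 'I_m.+2 -> R) a :
  P [set w | orthant v a (signals Y w, X ord0 w)] =
  joint_cdf X Y ord0 a (v ord0) (fun l => v (lift ord0 l)).
Proof.
rewrite /joint_cdf; congr (P _); apply/seteqP; split => w /=.
  move=> [h1 h2]; split => // [|l].
    by have := h1 ord0; rewrite tnth_signals.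
  by have := h1 (lift ord0 l); rewrite tnth_signals.
move=> [h1 h2 h3]; split => // i; rewrite tnth_signals.
by case: (unliftP ord0 i) => [l|] ->; [exact: h3|exact: h2].
Qed.

Lemma orthant_permuted (s : 'S_m.+1) (v : 'I_m.+2 -> R) a :
  P [set w | orthant v a (permute_others s (signals Y w), X ord0 w)] =
  P [set w | orthant v a (signals Y w, X ord0 w)].
Proof.
(* Bounding the signals permuted by s means bounding the original ones by the bounds composed with
   the inverse of s. *)
rewrite orthant_joint_cdf -(Hsym.2 ord0 a _ _ (s^-1)%g).
rewrite /joint_cdf; congr (P _); apply/seteqP; split => w /=.
  move=> [h1 h2]; split => // [|l].
    by have := h1 ord0; rewrite permute_others0 tnth_signals.
  by have := h1 (lift ord0 ((s^-1)%g l)); rewrite permute_othersS tnth_signals permKV.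
move=> [h1 h2 h3]; split => // i.
case: (unliftP ord0 i) => [l|] ->.
  by rewrite permute_othersS tnth_signals; have := h3 (s l); rewrite /= permK.
by rewrite permute_others0 tnth_signals.
Qed.

Lemma permuted_law (s : 'S_m.+1) (G : m.+2.-tuple R * R -> \bar R) :
  measurable_fun setT G -> (forall p, 0 <= G p)%E ->
  (\int[P]_w G (permute_others s (signals Y w), X ord0 w) =
   \int[P]_w G (signals Y w, X ord0 w))%E.
Proof.
move=> mG G0.
have mX := measurable_funPT (X ord0).
have mYX : measurable_fun setT (fun w => (signals Y w, X ord0 w)).
  by apply: measurable_fun_pair => //; exact: measurable_signals.
have mYXs : measurable_fun setT
    (fun w => (permute_others s (signals Y w), X ord0 w)).
  apply: measurable_fun_pair => //; apply: measurableT_comp.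
    exact: measurable_permute_others.
  exact: measurable_signals.
have [nu1 H1] := law_measureP P mYXs; have [nu2 H2] := law_measureP P mYX.
have nuE (phi : T -> m.+2.-tuple R * R)
    (nu : {measure set (m.+2.-tuple R * R) -> \bar R}) (mphi : measurable_fun setT phi)
    (Hnu : forall g, measurable_fun setT g -> (forall p, 0 <= g p)%E ->
      (\int[P]_w g (phi w) = \int[nu]_p g p)%E) D : measurable D ->
    nu D = P [set w | D (phi w)].
  move=> mD; rewrite measure_integral_indic// -(Hnu (EFin \o \1_D))//.
  - rewrite [RHS]measure_integral_indic//.
    by rewrite -[X in measurable X]setTI; exact: mphi.
  - exact: measurable_Eindic.
  - by move=> p; rewrite lee_fin.
rewrite H1// H2//; apply: eq_measure_integral => D mD _.
apply: orthant_measure_unique => //.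
  rewrite (nuE _ _ mYXs H1)//.
  by apply: (le_lt_trans (probability_le1 P _)); rewrite ?ltry//;
    rewrite -[X in measurable X]setTI; exact: mYXs.
move=> v a; have mO := measurable_orthant v a.
by rewrite (nuE _ _ mYXs H1)// (nuE _ _ mYX H2)// orthant_permuted.
Qed.

(* Up to ties: buyer 1 wins, and the second highest bidder is [lift ord0 j]. *)
Definition top_bid (j : 'I_m.+1) : set (m.+2.-tuple R) :=
  [set y | [/\ inner IY (tnth y (lift ord0 j)), IY (tnth y ord0),
     tnth y (lift ord0 j) <= tnth y ord0 &
     forall l, IY (tnth y (lift ord0 l)) /\
               tnth y (lift ord0 l) <= tnth y (lift ord0 j)]].

Lemma measurable_top_bid j : measurable (top_bid j).
Proof.
have mI A i : measurable A -> measurable [set y : m.+2.-tuple R | A (tnth y i)].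
  by move=> mA; rewrite -[X in measurable X]setTI; exact: measurable_tnth.
have mIY : measurable IY by exact: is_interval_measurable.
have -> : top_bid j = [set y | inner IY (tnth y (lift ord0 j))] `&`
    ([set y | IY (tnth y ord0)] `&`
    ([set y | tnth y (lift ord0 j) <= tnth y ord0] `&`
     \bigcap_(l in [set: 'I_m.+1]) ([set y | IY (tnth y (lift ord0 l))] `&`
       [set y | tnth y (lift ord0 l) <= tnth y (lift ord0 j)]))).
  apply/seteqP; split => y /=.
    by move=> [h1 h2 h3 h4]; do 3 split => //; move=> l _; exact: h4.
  by move=> [h1 [h2 [h3 h4]]]; split => // l; exact: (h4 l Logic.I).
apply: measurableI; first by apply: mI; exact: measurable_inner.
apply: measurableI; first exact: mI.
apply: measurableI; first by apply: measurable_le_set; exact: measurable_tnth.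
apply: fin_bigcap_measurable => // l _; apply: measurableI; first exact: mI.
by apply: measurable_le_set; exact: measurable_tnth.
Qed.

Definition top_fun (j : 'I_m.+1) (G : R * R -> \bar R)
    (p : m.+2.-tuple R * R) : \bar R :=
  ((\1_(top_bid j) p.1)%:E * G (tnth p.1 (lift ord0 j), p.2))%E.

Lemma top_fun_ge0 j (G : R * R -> \bar R) p : (forall q, 0 <= G q)%E ->
  (0 <= top_fun j G p)%E.
Proof. by move=> G0; rewrite mule_ge0// lee_fin. Qed.

Lemma measurable_top_fun j (G : R * R -> \bar R) : measurable_fun setT G ->
  measurable_fun setT (top_fun j G).
Proof.
move=> mG; apply: emeasurable_funM.
  exact: (measurableT_comp (measurable_Eindic (measurable_top_bid j))).
apply: (measurableT_comp mG); apply: measurable_fun_pair => //.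
by apply: (measurableT_comp (measurable_tnth (lift ord0 j))).
Qed.

Lemma top_fun_permute i j (G : R * R -> \bar R) y x :
  top_fun j G (permute_others (tperm i j) y, x) = top_fun i G (y, x).
Proof.
have E : (permute_others (tperm i j) y \in top_bid j) = (y \in top_bid i).
  apply/idP/idP => /set_mem H; apply/mem_set.
    case: H; rewrite !permute_othersS permute_others0 tpermR => h1 h2 h3 h4.
    split => // l; have := h4 (tperm i j l).
    by rewrite permute_othersS tpermK.
  case: H => h1 h2 h3 h4.
  by split; rewrite ?permute_othersS ?permute_others0 ?tpermR// => l;
    rewrite permute_othersS.
by rewrite /top_fun/= permute_othersS tpermR !indicE E.
Qed.

(** The transposition of i and j exchanges the two runners-up and leaves the joint law of signals
    and value unchanged. *)
Lemma top_fun_sym i j (G : R * R -> \bar R) :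
  measurable_fun setT G -> (forall q, 0 <= G q)%E ->
  (\int[P]_w top_fun j G (signals Y w, X ord0 w) =
   \int[P]_w top_fun i G (signals Y w, X ord0 w))%E.
Proof.
move=> mG G0; rewrite -(permuted_law (tperm i j)).
- by apply: eq_integral => w _; rewrite top_fun_permute.
- exact: measurable_top_fun.
- by move=> p; exact: top_fun_ge0.
Qed.

(** The Lebesgue density, at second highest signal [z], of the expectation of [G] on the event that
    buyer 1 wins against the runner-up [j]. *)
Definition top_slice (j : 'I_m.+1) (G : R * R -> \bar R) (z : R) : \bar R :=
  cell_int (ladder_cell (above IY z) j z (below IY z))
    (joint_slice k f (fun p => G (z, p.2))).

Lemma measurable_top_slice j (G : R * R -> \bar R) : measurable_fun setT G ->
  (forall q, 0 <= G q)%E -> measurable_fun setT (top_slice j G).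
Proof.
move=> mG G0.
apply: (@measurable_cell_int R _ _ R
  (fun z => ladder_cell (above IY z) j z (below IY z))
  (fun zy => (\int[k zy.2]_x G (zy.1, x)) * (f zy.2)%:E)%E).
  move=> i; rewrite /ladder_cell; case: (i == ord0).
    exact: measurable_events_above.
  case: (i == lift ord0 j); first by left; exists id.
  exact: measurable_events_below.
apply: emeasurable_funM; first exact: measurable_kernel_integral.
by apply/measurable_EFinP; exact: measurableT_comp.
Qed.

Lemma top_slice_ge0 j (G : R * R -> \bar R) z : (forall q, 0 <= G q)%E ->
  (0 <= top_slice j G z)%E.
Proof.
by move=> G0; apply: cell_int_ge0 => y; exact: joint_slice_ge0.
Qed.

Lemma top_fun_disintegration j (G : R * R -> \bar R) :
  measurable_fun setT G -> (forall q, 0 <= G q)%E ->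
  (\int[P]_w top_fun j G (signals Y w, X ord0 w) =
   \int[leb]_(z in inner IY) top_slice j G z)%E.
Proof.
move=> mG G0; have mT := measurable_top_fun j mG.
have T0 p := top_fun_ge0 j p G0.
rewrite (auction_law Hf Hk mT T0).
have mS := measurable_joint_slice k mf mT T0.
have S0 y := joint_slice_ge0 k f0 y T0.
rewrite (@cell_int_disintegrate _ _ allc (lift ord0 j) setT _ erefl
  (@measurable_allc _ _) mS S0).
rewrite [RHS]integral_mkcond; apply: eq_integral => z _.
rewrite patchE; case: ifPn => [/set_mem Jz|/negP nJz]; last first.
  rewrite (eq_cell_int_on (h := cst 0%E)) ?cell_int0// => y cy.
  rewrite /joint_slice integral0_eq ?mul0e// => x _; rewrite /top_fun indicE.
  rewrite memNset ?mul0e// => -[Jy _ _ _]; apply: nJz; apply/mem_set.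
  by have := cy (lift ord0 j); rewrite /set_coord eqxx /= => <-.
rewrite /top_slice.
rewrite [RHS](@cell_int_sub _ _ (set_coord allc (lift ord0 j) (At z))); last first.
  move=> i; rewrite /ladder_cell /set_coord.
  have [->|i0] := eqVneq i ord0.
    by rewrite (negbTE (neq_lift ord0 j)).
  by case: ifP.
apply: eq_cell_int_on => y cy.
have yz : tnth y (lift ord0 j) = z.
  by have := cy (lift ord0 j); rewrite /set_coord eqxx.
rewrite patchE /joint_slice.
(* Once the runner-up is pinned at an inner z, the event [top_bid j] constrains the coordinates one
   by one, hence is a cell. *)
have UE : (y \in cell_set (ladder_cell (above IY z) j z (below IY z))) =
    (y \in top_bid j).
  apply/idP/idP => /set_mem H; apply/mem_set.
    have := H ord0; rewrite /ladder_cell eqxx/= => -[I0 z0].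
    split; rewrite ?yz//; first by move: z0; rewrite /= in_itv/= andbT.
    move=> l; have := H (lift ord0 l); rewrite /ladder_cell.
    rewrite eq_sym (negbTE (neq_lift ord0 l)).
    case: eqVneq => [_ /= ->|_ /=]; first by split => //; exact: inner_sub Jz.
    by move=> [Il]; rewrite in_itv.
  case: H; rewrite yz => h1 h2 h3 h4 i; rewrite /ladder_cell.
  case: (unliftP ord0 i) => [l|] ->; last first.
    by rewrite eqxx /=; split => //=; rewrite in_itv/= h3.
  rewrite eq_sym (negbTE (neq_lift ord0 l)).
  case: eqVneq => [->|_]; first by rewrite /= yz.
  by have [h5 h6] := h4 l; split => //=; rewrite in_itv.
rewrite UE; case: ifPn => yU.
  congr (_ * _)%E; apply: eq_integral => x _.
  by rewrite /top_fun /= indicE yU mul1e yz.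
rewrite integral0_eq ?mul0e// => x _.
by rewrite /top_fun /= indicE (negbTE yU) mul0e.
Qed.

End symmetry.

(** * Revenue *)

Lemma patch_in (R : realType) (D : set R) (g : R -> R) z : D z -> (g \_ D) z = g z.
Proof. by move=> Dz; rewrite patchE mem_set. Qed.

Lemma measurable_bigmax d (T : measurableType d) (R : realType) (I : Type)
    (s : seq I) (a : T -> R) (F : I -> T -> R) :
  measurable_fun setT a -> (forall i, measurable_fun setT (F i)) ->
  measurable_fun setT (fun w => \big[Num.max/a w]_(i <- s) F i w).
Proof.
move=> ma mF; elim: s => [|i s IH].
  by under eq_fun do rewrite big_nil.
by under eq_fun do rewrite big_cons; exact: measurable_maxr.
Qed.

Lemma leb_below_gt0 (R : realType) (IY : set R) (a z : R) : is_interval IY ->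
  IY a -> IY z -> a < z -> (0 < @lebesgue_measure R (IY `&` `]-oo, z]))%E.
Proof.
move=> HIY Ia Iz az; apply: (@lt_le_trans _ _ (@lebesgue_measure R `[a, z])).
  by rewrite lebesgue_measure_itv/= lte_fin az -EFinD lte_fin subr_gt0.
apply: le_measure; rewrite ?inE//.
  by apply: measurableI => //; exact: is_interval_measurable.
move=> t /=; rewrite !in_itv/= => /andP[at_ tz]; split => //.
by apply: (HIY a z) => //; rewrite at_ tz.
Qed.

Section revenue.
Context (R : realType) (m : nat) (d : measure_display) (T : measurableType d)
  (P : probability T R) (X Y : 'I_m.+2 -> {RV P >-> R}) (IY : set R)
  (f : m.+2.-tuple R -> R) (k : R.-pker (m.+2.-tuple R) ~> R) (u : R -> R).
Hypotheses (Hsym : symmetric_law X Y) (HIY : is_interval IY)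
  (HY : forall n w, IY (Y n w)) (Hf : is_density P (signals Y) f)
  (Hfpos : forall y : m.+2.-tuple R, (forall n, IY (tnth y n)) -> 0 < f y)
  (Hk : is_cond_law P (X ord0) (signals Y) k)
  (Hdep : positive_dependence k f IY)
  (Hu : weakly_risk_averse u)
  (HintX : P.-integrable setT (fun w => (X ord0 w)%:E))
  (Hint_condX : forall y1 z1 : R, IY y1 -> IY z1 ->
     cond_exists k f (given_Y1_Z1 m IY y1 z1) (fun x => x))
  (Hint_condu : forall y1 z1 b : R, IY y1 -> IY z1 ->
     cond_exists k f (given_Y1_Z1 m IY y1 z1) (fun x => u (x - b))).
Local Notation leb := (@lebesgue_measure R).
Local Notation wins := (buyer1_wins Y).
Local Notation Z := (Z1 Y).

Let mf : measurable_fun setT f. Proof. by case: Hf. Qed.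
Let f0 y : 0 <= f y. Proof. by case: Hf. Qed.

Lemma Z1_attained w : exists j, Z w = Y (lift ord0 j) w.
Proof.
rewrite /Z1; elim/big_ind: _ => [|s t [i ->] [j ->]|j _]; first by exists ord0.
  by rewrite maxEle; case: ifP => _; [exists j|exists i].
by exists j.
Qed.

Lemma le_Z1 w l : Y (lift ord0 l) w <= Z w.
Proof. exact: (le_bigmax _ (fun l => Y (lift ord0 l) w)). Qed.

Lemma measurable_Z1 : measurable_fun setT Z.
Proof. by apply: measurable_bigmax => [|i]; exact: measurable_funPT. Qed.

Lemma measurable_wins : measurable wins.
Proof. by apply: measurable_lt_set; [exact: measurable_Z1|exact: measurable_funPT]. Qed.

Lemma Z1_IY w : IY (Z w).
Proof. by have [j ->] := Z1_attained w; exact: HY. Qed.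

Lemma ae_signals : {ae P, forall w, (forall i j, i != j -> Y i w <> Y j w) /\
  (forall i, inner IY (Y i w))}.
Proof.
have mY i : measurable_fun setT (Y i) by exact: measurable_funPT.
apply: filterI; last first.
  apply: (@filter_forall _ _ (fun i w => inner IY (Y i w)) (almost_everywhere P) _) => i.
  exists [set w | ~ inner IY (Y i w)]; split => //.
    apply: measurableC; rewrite -[X in measurable X]setTI; apply: mY => //.
    exact: measurable_inner.
  exact: (signal_inner HY Hf Hk).
apply: (@filter_forall _ _ (fun i w => forall j, i != j -> Y i w <> Y j w)
  (almost_everywhere P) _) => i.
apply: (@filter_forall _ _ (fun j w => i != j -> Y i w <> Y j w)
  (almost_everywhere P) _) => j.
have [_|ij] := eqVneq i j; first exact: aeW.
exists [set w | Y i w = Y j w]; split.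
- have -> : [set w | Y i w = Y j w] =
      [set w | Y i w <= Y j w] `&` [set w | Y j w <= Y i w].
    apply/seteqP; split => w /=; first by move=> ->; rewrite lexx.
    by move=> [h1 h2]; apply/eqP; rewrite eq_le h1.
  by apply: measurableI; exact: measurable_le_set.
- exact: (signals_tie Hf Hk).
- by move=> w /= /not_implyP[_ /contrapT].
Qed.

(** Without ties exactly one buyer is the runner-up when buyer 1 wins, so the events [top_bid j]
    partition [wins] up to a null set. *)
Lemma wins_top_fun (G : R * R -> \bar R) :
  measurable_fun setT G -> (forall q, 0 <= G q)%E ->
  (\int[P]_(w in wins) G (Z w, X ord0 w) =
   \sum_(j < m.+1) \int[P]_w top_fun IY j G (signals Y w, X ord0 w))%E.
Proof.
move=> mG G0.
have mX := measurable_funPT (X ord0).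
have mYX : measurable_fun setT (fun w => (signals Y w, X ord0 w)).
  by apply: measurable_fun_pair => //; exact: measurable_signals.
have mT j : measurable_fun setT (fun w => top_fun IY j G (signals Y w, X ord0 w)).
  exact: (measurableT_comp (measurable_top_fun HIY j mG) mYX).
have T0 j w : (0 <= top_fun IY j G (signals Y w, X ord0 w))%E by exact: top_fun_ge0.
have mGZ : measurable_fun setT (fun w => G (Z w, X ord0 w)).
  apply: (measurableT_comp mG); apply: measurable_fun_pair => //.
  exact: measurable_Z1.
rewrite -ge0_integral_sum// [LHS]integral_mkcond.
apply: ge0_ae_eq_integral => //.
- by apply/(measurable_restrictT _ measurable_wins); exact: measurable_funTS mGZ.
- exact: emeasurable_sum.
- by move=> w _; rewrite patchE; case: ifP.
- by move=> w _; rewrite sume_ge0.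
apply: filterS ae_signals => w [tie inn] _.
rewrite patchE; case: ifPn => [/set_mem win|/negP nwin].
  have [j Zj] := Z1_attained w.
  rewrite (bigD1 j)//= big1 ?adde0 => [|i ij].
    rewrite /top_fun/= indicE mem_set ?mul1e ?tnth_signals ?Zj//.
    split.
    - by rewrite tnth_signals.
    - by rewrite tnth_signals.
    - by rewrite !tnth_signals -Zj ltW.
    - by move=> l; rewrite !tnth_signals -Zj; split; [exact: HY|exact: le_Z1].
  rewrite /top_fun/= indicE memNset ?mul0e// => -[_ _ _ /(_ j)].
  rewrite !tnth_signals => -[_ ji]; apply: (tie (lift ord0 i) (lift ord0 j)).
    by rewrite (inj_eq lift_inj).
  by apply/eqP; rewrite eq_le ji -Zj le_Z1.
(* The inequalities in [top_bid j] are weak; off [wins] they would force a tie between buyer 1 and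
   the runner-up. *)
apply/esym/big1 => j _; rewrite /top_fun/= indicE memNset ?mul0e// => -[_ _].
rewrite !tnth_signals => j0 top; apply: nwin; apply/mem_set.
have [i Zi] := Z1_attained w.
rewrite /buyer1_wins/= Zi (@le_lt_trans _ _ (Y (lift ord0 j) w))//.
  by have [_] := top i; rewrite !tnth_signals.
rewrite lt_neqAle j0 andbT; apply/eqP; apply: tie.
by rewrite eq_sym neq_lift.
Qed.

Section comparison.
Context (phi1 phi2 : R -> R).
Hypotheses (H1 : contract phi1) (H2 : contract phi2)
  (Hmono : forall s1 s2, {homo (fun x => s2 + phi2 (x - s2) -
     (s1 + phi1 (x - s1))) : x y / x <= y})
  (Hi1 : P.-integrable wins (fun w => (payment k f IY u phi1 X Y w)%:E))
  (Hi2 : P.-integrable wins (fun w => (payment k f IY u phi2 X Y w)%:E)).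

(** Bids are shown to be measurable on [inner IY]; extension by zero makes them functions on the
    line, and [Z] lies in [inner IY] almost surely. *)
Let s1 : R -> R := (fun z => bid k f IY u phi1 z z) \_ (inner IY).
Let s2 : R -> R := (fun z => bid k f IY u phi2 z z) \_ (inner IY).
Let H (q : R * R) : R :=
  s2 q.1 + phi2 (q.2 - s2 q.1) - (s1 q.1 + phi1 (q.2 - s1 q.1)).
Let Gp (q : R * R) : \bar R := (Num.max (H q) 0)%:E.
Let Gn (q : R * R) : \bar R := (Num.max (- H q) 0)%:E.

Let ms1 : measurable_fun setT s1.
Proof.
apply/(measurable_restrictT _ (measurable_inner IY)).
exact: (measurable_bid mf f0 HIY Hu Hint_condX Hint_condu H1).
Qed.

Let ms2 : measurable_fun setT s2.
Proof.
apply/(measurable_restrictT _ (measurable_inner IY)).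
exact: (measurable_bid mf f0 HIY Hu Hint_condX Hint_condu H2).
Qed.

Let mH : measurable_fun setT H.
Proof.
have [_ _ _ c1] := H1; have [_ _ _ c2] := H2.
have mpay (s phi : R -> R) : measurable_fun setT s -> continuous phi ->
    measurable_fun setT (fun q : R * R => s q.1 + phi (q.2 - s q.1)).
  move=> ms cphi; have ms' : measurable_fun setT (fun q : R * R => s q.1).
    exact: measurableT_comp.
  apply: measurable_funD => //.
  apply: (measurableT_comp (continuous_measurable_fun cphi)).
  exact: measurable_funB.
by apply: measurable_funB; exact: mpay.
Qed.

Let mGp : measurable_fun setT Gp.
Proof. by apply/measurable_EFinP; exact: measurable_maxr. Qed.

Let mGn : measurable_fun setT Gn.
Proof.
by apply/measurable_EFinP; apply: measurable_maxr => //; exact: measurable_funN.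
Qed.

Let Gp0 q : (0 <= Gp q)%E. Proof. by rewrite lee_fin le_max lexx orbT. Qed.
Let Gn0 q : (0 <= Gn q)%E. Proof. by rewrite lee_fin le_max lexx orbT. Qed.

(** Integrability given Y_1 = Z_1 = z is assumed at every point, but on the event Y_1 >= z it is
    not; the two finiteness hypotheses supply it, and they hold for almost every [z] because X_1 is
    integrable. *)
Lemma top_slice_comparison z : inner IY z ->
  (forall j, top_slice IY f k j (fun=> 1%E) z < +oo)%E ->
  (forall j, top_slice IY f k j (fun q => `|q.2|%:E) z < +oo)%E ->
  exists j, (top_slice IY f k j Gn z <= top_slice IY f k j Gp z)%E.
Proof.
move=> Jz slice1 slicex.
have [j [M1 [HM1 M1oo M1x H1_ge0]]] := given_comparison mf f0 HIY Hu
  Hint_condX Hint_condu H1 H2 Jz (@Hmono _ _).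
have [a [b [Ia Ib /andP[az zb]]]] := Jz.
have mb := measurable_below HIY z; have ma := measurable_above HIY z.
have [M2 HM2] : exists mu, represents k f (ladder_cell (above IY z) j z (below IY z)) mu.
  by apply: joint_measureP => // _; exact: measurable_ladder_cell.
have sliceE (G : R * R -> \bar R) : measurable_fun setT G -> (forall q, 0 <= G q)%E ->
    (top_slice IY f k j G z = \int[M2]_p G (z, p.2))%E.
  move=> mG G0; rewrite -HM2//; first by rewrite /joint_int big_seq1.
  apply: (measurableT_comp mG); exact: measurable_fun_pair.
have M2oo : (M2 setT < +oo)%E.
  rewrite -[ltLHS]mul1e -integral_cst//.
  by have := slice1 j; rewrite sliceE//; exact: measurable_cst.
have M2x : M2.-integrable setT (fun p => p.2%:E).
  apply/integrableP; split; first exact/measurable_EFinP.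
  have := slicex j; rewrite sliceE//.
  by apply/measurable_EFinP; exact: measurableT_comp.
pose h x := H (z, x).
have hE : h = fun x => bid k f IY u phi2 z z + phi2 (x - bid k f IY u phi2 z z) -
    (bid k f IY u phi1 z z + phi1 (x - bid k f IY u phi1 z z)).
  have e1 : s1 z = bid k f IY u phi1 z z by exact: patch_in.
  have e2 : s2 z = bid k f IY u phi2 z z by exact: patch_in.
  by rewrite -e1 -e2.
have h_mono : {homo h : x y / x <= y} by rewrite hE; exact: Hmono.
have ih (M : {measure set (m.+2.-tuple R * R) -> \bar R}) : (M setT < +oo)%E ->
    M.-integrable setT (fun p => p.2%:E) ->
    M.-integrable setT (fun p => (h p.2)%:E).
  move=> Moo Mx; rewrite hE; exact: (integrableB measurableT
    (contract_payment_integrable _ H2 Moo Mx)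
    (contract_payment_integrable _ H1 Moo Mx)).
have := dependence_nondecreasing mf f0 HIY Hfpos Hdep Ia Ib az zb HM1 HM2 M1oo M2oo
  h_mono (ih _ M1oo M1x) (ih _ M2oo M2x) M1x M2x.
have M1_gt0 : 0 < fine (M1 setT).
  rewrite fine_gt0// M1oo andbT.
  have c1 : measurable_cell (ladder_cell (At z) j z (below IY z)).
    exact: measurable_ladder_cell.
  rewrite -(@cells_mass_measure _ _ k f _ [:: tt] (fun=> _) _ HM1) /=.
  apply: (cells_mass_gt0 mf Hfpos c1) => [i A|i]; rewrite /ladder_cell.
    do 2 case: ifP => // _; move=> [<-]; apply: (leb_below_gt0 HIY Ia) => //.
    exact: inner_sub Jz.
  have Iz := inner_sub HIY Jz.
  by do 2 (case: ifP => _; first by move=> t /= ->); move=> t [].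
have M1h : 0 <= \int[M1]_p h p.2 by rewrite hE.
(* The cross-multiplied inequality bounds the integral over Y_1 >= z, times the mass of the cell Y_1
   = z, from below by 0; that mass is positive. *)
move=> /(le_trans (mulr_ge0 M1h (fine_ge0 (measure_ge0 _ _)))).
rewrite pmulr_lge0// => M2h.
exists j; rewrite !sliceE//.
have : (0 <= \int[M2]_p (h p.2)%:E)%E.
  rewrite -[leRHS]fineK ?lee_fin//.
  exact: (integrable_fin_num measurableT (ih _ M2oo M2x)).
have Gp_h : (fun p : m.+2.-tuple R * R => Gp (z, p.2)) = (fun p => (h p.2)%:E)^\+%E.
  by apply/funext => p; rewrite funeposE /Gp EFin_max.
have Gn_h : (fun p : m.+2.-tuple R * R => Gn (z, p.2)) = (fun p => (h p.2)%:E)^\-%E.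
  by apply/funext => p; rewrite funenegE /Gn EFin_max.
rewrite Gp_h Gn_h integralE sube_ge0//.
by rewrite (integrable_neg_fin_num measurableT (ih _ M2oo M2x)).
Qed.

Lemma top_slice_restrict j (G : R * R -> \bar R) (E : set R) z :
  top_slice IY f k j (G \_ (fst @^-1` E)) z = (top_slice IY f k j G \_ E) z.
Proof.
rewrite patchE; case: ifPn => [/set_mem Ez|/negP nEz].
  apply: eq_cell_int => y; congr (_ * _)%E; apply: eq_integral => x _.
  by rewrite patchE mem_set.
rewrite /top_slice (_ : joint_slice _ _ _ = cst 0%E) ?cell_int0//.
apply/funext => y; rewrite /joint_slice integral0_eq ?mul0e// => x _.
by rewrite patchE memNset// => Ez; apply: nEz; exact/mem_set.
Qed.

Lemma top_slice_ae_lty j (G : R * R -> \bar R) :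
  measurable_fun setT G -> (forall q, 0 <= G q)%E ->
  (\int[P]_w top_fun IY j G (signals Y w, X ord0 w) < +oo)%E ->
  leb.-integrable (inner IY) (top_slice IY f k j G) /\
  {ae leb, forall z, inner IY z -> (top_slice IY f k j G z < +oo)%E}.
Proof.
move=> mG G0; rewrite (top_fun_disintegration HIY Hf Hk)// => Goo.
have mS := measurable_top_slice k HIY Hf j mG G0.
have S0 z : (0 <= top_slice IY f k j G z)%E by exact: (top_slice_ge0 IY k Hf).
have iS : leb.-integrable (inner IY) (top_slice IY f k j G).
  apply/integrableP; split; first exact: measurable_funTS mS.
  by under eq_integral do rewrite gee0_abs//.
split => //.
have := @integrable_ae _ _ R leb _ (measurable_inner IY) _ iS.
by apply: filterS => z fz /fz; rewrite ge0_fin_numE.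
Qed.

(** The versions [f] and [k] need not be symmetric at any given z. Restricting [G] to z in [E] and
    applying [top_fun_sym] gives equal integrals over every measurable [E], hence equality almost
    everywhere. *)
Lemma top_slice_ae_eq i j (G : R * R -> \bar R) :
  measurable_fun setT G -> (forall q, 0 <= G q)%E ->
  (\int[P]_w top_fun IY j G (signals Y w, X ord0 w) < +oo)%E ->
  {ae leb, forall z, inner IY z ->
     top_slice IY f k j G z = top_slice IY f k i G z}.
Proof.
move=> mG G0 Goo; have [iS _] := top_slice_ae_lty mG G0 Goo.
apply: (@integral_ae_eq _ _ R leb _ (measurable_inner IY) _ _ iS).
  exact: measurable_funTS (measurable_top_slice k HIY Hf i mG G0).
move=> E EJ mE.
have mGE : measurable_fun setT (G \_ (fst @^-1` E)).
  have mE1 : measurable (fst @^-1` E : set (R * R)).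
    by rewrite -[X in measurable X]setTI; exact: measurable_fst.
  by apply/(measurable_restrictT G mE1); exact: measurable_funTS mG.
have GE0 q : (0 <= (G \_ (fst @^-1` E)) q)%E by rewrite patchE; case: ifP.
have intE l : (\int[leb]_(z in E) top_slice IY f k l G z =
    \int[P]_w top_fun IY l (G \_ (fst @^-1` E)) (signals Y w, X ord0 w))%E.
  transitivity (\int[leb]_(z in inner IY) (top_slice IY f k l G \_ E) z)%E.
    by rewrite -integral_mkcondr (setIidr EJ).
  rewrite (top_fun_disintegration HIY Hf Hk l mGE GE0).
  by apply: eq_integral => z _; rewrite -top_slice_restrict.
apply: etrans (esym (intE i)); apply: (etrans (intE j)).
exact: (top_fun_sym Hsym HIY i j mGE GE0).
Qed.

Let D w : R := payment k f IY u phi2 X Y w - payment k f IY u phi1 X Y w.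

Let iD : P.-integrable wins (fun w => (D w)%:E).
Proof. exact: (integrableB measurable_wins Hi2 Hi1). Qed.

Let aeD : {ae P, forall w, H (Z w, X ord0 w) = D w}.
Proof.
apply: filterS ae_signals => w [_ inn].
have Jz : inner IY (Z w) by have [j ->] := Z1_attained w; exact: inn.
have e1 : s1 (Z w) = bid k f IY u phi1 (Z w) (Z w) by exact: patch_in.
have e2 : s2 (Z w) = bid k f IY u phi2 (Z w) (Z w) by exact: patch_in.
by rewrite /D /payment -e1 -e2.
Qed.

Let GpD : (\int[P]_(w in wins) Gp (Z w, X ord0 w) =
  \int[P]_(w in wins) (fun w => (D w)%:E)^\+ w)%E.
Proof.
have mGZ : measurable_fun wins (fun w => Gp (Z w, X ord0 w)).
  apply: measurable_funTS; apply: (measurableT_comp mGp).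
  apply: measurable_fun_pair; first exact: measurable_Z1.
  exact: measurable_funPT.
apply: ge0_ae_eq_integral => //.
- exact: measurable_wins.
- by apply: measurable_funepos; case/integrableP: iD.
by apply: filterS aeD => w Hw win; rewrite funeposE -Hw /Gp EFin_max.
Qed.

Let GnD : (\int[P]_(w in wins) Gn (Z w, X ord0 w) =
  \int[P]_(w in wins) (fun w => (D w)%:E)^\- w)%E.
Proof.
have mGZ : measurable_fun wins (fun w => Gn (Z w, X ord0 w)).
  apply: measurable_funTS; apply: (measurableT_comp mGn).
  apply: measurable_fun_pair; first exact: measurable_Z1.
  exact: measurable_funPT.
apply: ge0_ae_eq_integral => //.
- exact: measurable_wins.
- by apply: measurable_funeneg; case/integrableP: iD.
by apply: filterS aeD => w Hw win; rewrite funenegE -Hw /Gn EFin_max.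
Qed.

Lemma top_fun_lty j (G : R * R -> \bar R) : measurable_fun setT G ->
  (forall q, 0 <= G q)%E -> (\int[P]_(w in wins) G (Z w, X ord0 w) < +oo)%E ->
  (\int[P]_w top_fun IY j G (signals Y w, X ord0 w) < +oo)%E.
Proof.
move=> mG G0; rewrite wins_top_fun// (bigD1 j)//=; apply: le_lt_trans.
rewrite leeDl// sume_ge0// => i _; apply: integral_ge0 => w _.
exact: top_fun_ge0.
Qed.

Lemma wins_comparison : (\int[P]_(w in wins) (fun w => (D w)%:E)^\- w <=
  \int[P]_(w in wins) (fun w => (D w)%:E)^\+ w)%E.
Proof.
have FF : Filter (almost_everywhere leb) := ae_filter_ringOfSetsType leb.
have Gp_oo j : (\int[P]_w top_fun IY j Gp (signals Y w, X ord0 w) < +oo)%E.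
  apply: (top_fun_lty j mGp Gp0); rewrite GpD.
  exact: (integral_funepos_lt_pinfty measurable_wins iD).
have Gn_oo j : (\int[P]_w top_fun IY j Gn (signals Y w, X ord0 w) < +oo)%E.
  apply: (top_fun_lty j mGn Gn0); rewrite GnD.
  exact: (integral_funeneg_lt_pinfty measurable_wins iD).
have mc1 : measurable_fun setT (fun _ : R * R => 1%E : \bar R) by exact: measurable_cst.
have mcx : measurable_fun setT (fun q : R * R => `|q.2|%:E : \bar R).
  by apply/measurable_EFinP; exact: measurableT_comp.
have one_oo : (\int[P]_(w in wins) 1 < +oo :> \bar R)%E.
  rewrite integral_cst ?mul1e; last exact: measurable_wins.
  by rewrite (le_lt_trans (probability_le1 P measurable_wins))// ltry.
have x_oo : (\int[P]_(w in wins) `|X ord0 w|%:E < +oo)%E.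
  have := integrableS measurableT measurable_wins (@subsetT _ _) HintX.
  by case/integrableP.
have ae_lty (G : R * R -> \bar R) : measurable_fun setT G ->
    (forall q, 0 <= G q)%E -> (\int[P]_(w in wins) G (Z w, X ord0 w) < +oo)%E ->
    {ae leb, forall z, forall j, inner IY z -> (top_slice IY f k j G z < +oo)%E}.
  move=> mG G0 Goo; apply: (@filter_forall _ _ (fun j z => inner IY z ->
    (top_slice IY f k j G z < +oo)%E) (almost_everywhere leb) FF) => j.
  by have [] := top_slice_ae_lty mG G0 (top_fun_lty j mG G0 Goo).
have ae1 := ae_lty _ mc1 (fun=> lee01) one_oo.
have aex := ae_lty _ mcx (fun q => normr_ge0 q.2) x_oo.
rewrite -GnD -GpD (wins_top_fun mGn Gn0) (wins_top_fun mGp Gp0); apply: lee_sum => j _.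
rewrite (top_fun_disintegration HIY Hf Hk j mGn Gn0).
rewrite (top_fun_disintegration HIY Hf Hk j mGp Gp0).
have mS G : measurable_fun setT G -> (forall q, 0 <= G q)%E ->
    measurable_fun (inner IY) (top_slice IY f k j G).
  by move=> mG G0; apply: measurable_funTS; exact: (measurable_top_slice k HIY Hf).
apply: ae_ge0_le_integral.
- exact: measurable_inner.
- by move=> z _; exact: (top_slice_ge0 IY k Hf).
- exact: mS.
- by move=> z _; exact: (top_slice_ge0 IY k Hf).
- exact: mS.
have aep : {ae leb, forall z, forall i, inner IY z ->
    top_slice IY f k i Gp z = top_slice IY f k j Gp z}.
  apply: (@filter_forall _ _ (fun i z => inner IY z ->
    top_slice IY f k i Gp z = top_slice IY f k j Gp z) (almost_everywhere leb)
    FF) => i.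
  exact: (top_slice_ae_eq j mGp Gp0 (Gp_oo i)).
have aen : {ae leb, forall z, forall i, inner IY z ->
    top_slice IY f k i Gn z = top_slice IY f k j Gn z}.
  apply: (@filter_forall _ _ (fun i z => inner IY z ->
    top_slice IY f k i Gn z = top_slice IY f k j Gn z) (almost_everywhere leb)
    FF) => i.
  exact: (top_slice_ae_eq j mGn Gn0 (Gn_oo i)).
apply: filterS2 (filterI ae1 aex) (filterI aep aen) => z [h1 hx] [hp hn] Jz.
(* The index i depends on z. As there are finitely many indices, one null set serves all the
   equalities, which transfer the comparison from i to the fixed j. *)
have [i Hi] := top_slice_comparison Jz (h1^~ Jz) (hx^~ Jz).
by rewrite -(hp i Jz) -(hn i Jz).
Qed.

Lemma Rintegral_payment_le :
  \int[P]_(w in wins) payment k f IY u phi1 X Y w <=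
  \int[P]_(w in wins) payment k f IY u phi2 X Y w.
Proof.
rewrite -subr_ge0 -RintegralB//; last exact: measurable_wins.
rewrite -/(D _) /Rintegral fine_ge0// integralE sube_ge0 ?wins_comparison//.
by rewrite (integrable_neg_fin_num measurable_wins iD).
Qed.

End comparison.
End revenue.

Lemma contract0 (R : realType) : contract (fun=> 0 : R).
Proof. by split=> [? ? _|? ?||?]; rewrite ?subr0//; exact: cvg_cst. Qed.

Lemma contract_linear (R : realType) (alpha : R) : 0 < alpha < 1 ->
  contract (fun w => alpha * w).
Proof.
move=> /andP[a0 a1]; split=> [x y xy|x y xy||].
- by rewrite ler_pM2l.
- rewrite -[X in X - _ < _]mul1r -[X in _ < X - _]mul1r -!mulrBl.
  by rewrite ltr_pM2l// subr_gt0.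
- by rewrite mulr0.
- by move=> x; apply: cvgMr; exact: cvg_id.
Qed.

(** * Positivity of the one-time revenue *)

Section positivity.
Context (R : realType) (m : nat) (d : measure_display) (T : measurableType d)
  (P : probability T R) (X Y : 'I_m.+2 -> {RV P >-> R}) (IY : set R)
  (f : m.+2.-tuple R -> R) (k : R.-pker (m.+2.-tuple R) ~> R) (u : R -> R).
Hypotheses (HIY : is_interval IY)
  (HY : forall n w, IY (Y n w)) (Hf : is_density P (signals Y) f)
  (Hfpos : forall y : m.+2.-tuple R, (forall n, IY (tnth y n)) -> 0 < f y)
  (Hk : is_cond_law P (X ord0) (signals Y) k)
  (Hu : weakly_risk_averse u)
  (HuposY : forall y : m.+2.-tuple R, (forall n, IY (tnth y n)) ->
     (k y).-integrable setT (fun x => (u x)%:E) /\ 0 < \int[k y]_x u x)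
  (Hint_condX : forall y1 z1 : R, IY y1 -> IY z1 ->
     cond_exists k f (given_Y1_Z1 m IY y1 z1) (fun x => x))
  (Hint_condu : forall y1 z1 b : R, IY y1 -> IY z1 ->
     cond_exists k f (given_Y1_Z1 m IY y1 z1) (fun x => u (x - b))).

(** By [bid_gt] at b = 0 the matter is the sign of the expected utility given Y_1 = Z_1 = z, and on
    every cell the integrand E[u(X_1) | Y = y] f(y) is positive. *)
Lemma bid_onetime_gt0 z : IY z -> 0 < bid k f IY u (fun=> 0) z z.
Proof.
move=> Iz; have [mf f0 _] := Hf.
have [mu Hmu] := represents_givenP k mf f0 HIY z.
apply/(bid_gt mf f0 HIY Hu Hint_condX Hint_condu Iz Hmu (contract0 R)).
have -> : (fun x => net_utility u (fun=> 0) (x - 0)) = u.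
  by apply/funext => x; rewrite /net_utility !subr0.
have mu_ : measurable_fun setT u.
  exact: continuous_measurable_fun (utility_continuous Hu).
rewrite given_Y1_Z1E /cells_num big_map.
have cell_gt0 j : (0 < cell_int (given_cell IY z j)
    (fun y => (\int[k y]_x (u x)%:E) * (f y)%:E))%E.
  apply: cell_int_gt0.
  - exact: measurable_given_cell.
  - exact: measurable_kernel_num.
  (* When [coord_in] keeps the set, the set contains a point other than z, hence one below z, and so
     an interval of positive length. *)
  - move=> i A; rewrite /given_cell /ladder_cell.
    do 2 case: ifP => // _; rewrite /coord_in; case: asboolP => // Anz [<-].
    move: Anz => /existsNP[a /not_implyP[[Ia az] /eqP nz]].
    by apply: (leb_below_gt0 HIY Ia) => //; rewrite lt_neqAle nz.
  - move=> y cy; have Iy i : IY (tnth y i).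
      have := cy i; rewrite /given_cell /ladder_cell.
      do 2 (case: ifP => _; first by move=> /= ->).
      by rewrite /coord_in; case: asboolP => _ /= => [->|[]].
    have [iu u_gt0] := HuposY Iy.
    rewrite mule_gt0//; last by rewrite lte_fin Hfpos.
    by rewrite -[ltRHS](fineK (integrable_fin_num measurableT iu)) lte_fin.
apply: (lt_le_trans (cell_gt0 ord0)); rewrite big_enum (bigD1 ord0)//=.
by rewrite leeDl//; apply: sume_ge0 => j _; apply: ltW; exact: cell_gt0.
Qed.

Lemma wins_gt0 : (0 < P (buyer1_wins Y))%E.
Proof.
have [mf f0 Hd] := Hf.
have [z [a [b [Ia Ib /andP[az zb]]]]] : exists z, inner IY z.
  apply: contrapT => /forallNP noinner.
  have := signal_inner HY Hf Hk ord0.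
  rewrite (_ : [set w | _] = setT) ?probability_setT; first by move/eqP; rewrite onee_eq0.
  by apply/seteqP; split => // w _; exact: noinner.
(* A box of positive mass on which buyer 1 wins; the side of buyer 1 is open at z, which makes the
   win strict. *)
pose c (i : 'I_m.+2) := if i == ord0 then In `]z, b]%classic else In `[a, z]%classic.
have mc : measurable_cell c.
  by move=> i; rewrite /c; case: ifP => _ /=; exact: measurable_itv.
apply: (@lt_le_trans _ _ (P (signals Y @^-1` cell_set c))); last first.
  apply: le_measure; rewrite ?inE.
  - rewrite -[X in measurable X]setTI; apply: measurable_signals => //.
    exact: measurable_cell_set.
  - exact: measurable_wins.
  - move=> w /= cw; rewrite /buyer1_wins/=.
    have [j ->] := Z1_attained Y w.
    have := cw (lift ord0 j); have := cw ord0; rewrite /c /= !tnth_signals.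
    by rewrite !in_itv/= => /andP[zY _] /andP[_ Yz]; exact: le_lt_trans zY.
rewrite Hd; last exact: measurable_cell_set.
have -> : (fun y => (f y * \1_(cell_set c) y)%:E) = (fun y => (f y)%:E) \_ (cell_set c).
  apply/funext => y; rewrite patchE indicE; case: ifP => _; first by rewrite mulr1.
  by rewrite mulr0.
rewrite -cell_int_sub => [|i]; last by rewrite /c; case: ifP.
have -> : cell_int c (fun y => (f y)%:E) = cells_mass f [:: c].
  by rewrite /cells_mass big_seq1.
apply: (cells_mass_gt0 mf Hfpos mc) => [i A|i]; rewrite /c.
  by case: ifP => _ [<-]; rewrite lebesgue_measure_itv/= lte_fin ?zb ?az -EFinD
    lte_fin subr_gt0.
case: ifP => _ t /=; rewrite in_itv/= => /andP[h1 h2].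
  by apply: (HIY Ia Ib); rewrite h2 (ltW (lt_trans az _)).
by apply: (HIY Ia Ib); rewrite h1 (le_trans h2 (ltW zb)).
Qed.

Lemma revenue_onetime_gt0 :
  P.-integrable (buyer1_wins Y) (fun w => (payment k f IY u (fun=> 0) X Y w)%:E) ->
  0 < revenue X Y k f IY u (fun=> 0).
Proof.
move=> Hint; have mwins := measurable_wins Y.
apply: divr_gt0; last first.
  by rewrite fine_gt0// wins_gt0/= (le_lt_trans (probability_le1 P mwins))// ltry.
have pay_gt0 w : 0 < payment k f IY u (fun=> 0) X Y w.
  by rewrite /payment addr0; apply: bid_onetime_gt0; exact: Z1_IY.
rewrite /Rintegral fine_gt0//; apply/andP; split; last first.
  by rewrite ltey_eq (integrable_fin_num mwins Hint).
apply: integral_gt0 => //.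
- by case/integrableP: Hint.
- by move=> w _; rewrite lte_fin.
- exact: wins_gt0.
Qed.

End positivity.

Lemma bid_plscE (R : realType) (m : nat) (k : R.-pker (m.+2.-tuple R) ~> R)
    (f : m.+2.-tuple R -> R) (IY : set R) (u : R -> R) (alpha y1 z1 : R) :
  bid_plsc k f IY u alpha y1 z1 = bid k f IY u (fun w => alpha * w) y1 z1.
Proof.
have netE b : (fun x => u ((1 - alpha) * (x - b))) =
    (fun x => u (x - b - alpha * (x - b))).
  by apply/funext => x; rewrite mulrBl mul1r.
rewrite /bid_plsc /bid; apply: (congr1 (xget 0)); apply/funext => b.
by rewrite /mkset netE.
Qed.

Lemma payment_plscE (R : realType) (m : nat) (d : measure_display)
    (T : measurableType d) (P : probability T R) (X Y : 'I_m.+2 -> {RV P >-> R})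
    (k : R.-pker (m.+2.-tuple R) ~> R) (f : m.+2.-tuple R -> R) (IY : set R)
    (u : R -> R) (alpha : R) :
  payment_plsc k f IY u alpha X Y = payment k f IY u (fun w => alpha * w) X Y.
Proof.
apply/funext => w; rewrite /payment_plsc /payment bid_plscE.
by rewrite mulrBl mul1r mulrBr addrCA.
Qed.

Theorem proposition5 (R : realType) (m : nat)
  (d : measure_display) (T : measurableType d) (P : probability T R)
  (X Y : 'I_m.+2 -> {RV P >-> R})
  (IY : set R) (f : m.+2.-tuple R -> R) (k : R.-pker (m.+2.-tuple R) ~> R)
  (u phi : R -> R)
  (Hsym : symmetric_law X Y)
  (HIY : is_interval IY)
  (HY : forall n w, IY (Y n w))
  (Hf : is_density P (signals Y) f)
  (Hfpos : forall y : m.+2.-tuple R, (forall n, IY (tnth y n)) -> 0 < f y)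
  (Hk : is_cond_law P (X ord0) (signals Y) k)
  (Hdep : positive_dependence k f IY)
  (Hu : weakly_risk_averse u)
  (Hphi : admissible_psc phi)
  (HuposY : forall y : m.+2.-tuple R, (forall n, IY (tnth y n)) ->
     (k y).-integrable setT (fun x => (u x)%:E) /\ 0 < \int[k y]_x u x)
  (HintX : P.-integrable setT (fun w => (X ord0 w)%:E))
  (Hint_condX : forall y1 z1 : R, IY y1 -> IY z1 ->
     cond_exists k f (given_Y1_Z1 m IY y1 z1) (fun x => x))
  (Hint_condu : forall y1 z1 b : R, IY y1 -> IY z1 ->
     cond_exists k f (given_Y1_Z1 m IY y1 z1) (fun x => u (x - b)))
  (Hint_phi : P.-integrable (buyer1_wins Y)
     (fun w => (payment k f IY u phi X Y w)%:E))
  (Hint_0 : P.-integrable (buyer1_wins Y)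
     (fun w => (payment k f IY u (fun=> 0) X Y w)%:E)) :
  (revenue X Y k f IY u phi >= revenue X Y k f IY u (fun=> 0) /\
   revenue X Y k f IY u (fun=> 0) > 0) /\
  (forall alpha : R, 0 < alpha < 1 ->
     (forall w delta : R, 0 <= delta ->
        phi (w + delta) - phi w <= alpha * delta) ->
     P.-integrable (buyer1_wins Y)
       (fun w => (payment_plsc k f IY u alpha X Y w)%:E) ->
     revenue X Y k f IY u phi <= revenue_plsc X Y k f IY u alpha).
Proof.
have [phi_homo phi_incr phi0 _ phi_cont] := Hphi.
have Cphi : contract phi by split.
have C0 := contract0 R.
have payment_le := Rintegral_payment_le Hsym HIY HY Hf Hfpos Hk Hdep Hu HintX
  Hint_condX Hint_condu.
have revenue_le (p1 p2 : T -> R) : \int[P]_(w in buyer1_wins Y) p1 w <=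
    \int[P]_(w in buyer1_wins Y) p2 w ->
    exp_given P (buyer1_wins Y) p1 <= exp_given P (buyer1_wins Y) p2.
  move=> p12; rewrite ler_pM2r// invr_gt0 fine_gt0//.
  rewrite (wins_gt0 HIY HY Hf Hfpos Hk)/=.
  by rewrite (le_lt_trans (probability_le1 P (measurable_wins Y)))// ltry.
split; first split.
- apply/revenue_le/payment_le => //.
  (* Against the zero contract, the difference of payments is a shifted [phi] up to a constant. *)
  by move=> s1 s2 x y xy; rewrite !addr0 lerD2r lerD2l phi_homo// lerB.
- exact: (revenue_onetime_gt0 HIY HY Hf Hfpos Hk Hu HuposY Hint_condX Hint_condu).
move=> alpha alpha01 phi_slope Hint_plsc.
rewrite /revenue_plsc payment_plscE.
rewrite payment_plscE in Hint_plsc.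
apply/revenue_le/payment_le => //; first exact: contract_linear.
move=> s1 s2 x y xy.
(* A shift changes alpha w only by a constant, so the slope bound at x - s1 with increment y - x is
   already the required monotonicity, for every s2. *)
have := phi_slope (x - s1) (y - x).
rewrite subr_ge0 => /(_ xy).
have -> : x - s1 + (y - x) = y - s1 by rewrite addrC addrA subrK.
lra.
Qed.
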